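(* There are constants $C, c > 0$ depending only on $n$ such that the following holds. Given a nonnegative function $M : \mathcal{Q} \to \mathbb{R}$ with $\sum_{Q \in \mathcal{Q}} M(Q)^n < \infty$, there exist a nonnegative integer $k$, a polynomial $p \in \mathcal{P}_k^\ast$ and an $\varepsilon > 0$ such that $$k \leq C\left(\sum_{Q \in \mathcal{Q}} M(Q)^n\right)^{1/n}$$ and such that for all $Q \in \mathcal{Q}$, $$\operatorname{vis}_\varepsilon(Z_p \cap Q) \geq c\, M(Q).$$
   Context: $\mathcal{Q}$ is the lattice of unit cubes $\prod_{i=1}^n[m_i,m_i+1)$, $m_i\in\mathbb{Z}$, of $\mathbb{R}^n$. $\mathcal{P}_k$ is the real vector space of polynomials of degree at most $k$ in $n$ real variables (dimension $\sim k^n$), equipped with a fixed Euclidean norm, and $\mathcal{P}_k^\ast$ is its unit sphere, a topological sphere $\mathbb{S}^N$ with its natural surface measure. For $p$ nonzero, $Z_p = \{x : p(x) = 0\}$. For a set $Z$ with unit normal $n(x)$ defined $\mathcal{H}_{n-1}$-a.e. and a unit vector $e$, $\operatorname{surf}_e(Z) = \int_Z |e\cdot n(x)|\,d\mathcal{H}_{n-1}(x)$. For $p \in \mathcal{P}_k^\ast$, a cube $Q$ and $\varepsilon>0$, the mollified directional surface area $\operatorname{surf}_{e,\varepsilon}(Z_p\cap Q)$ is the average of $\operatorname{surf}_e(Z_{p'} \cap Q)$ over $p'$ in the ball of radius $\varepsilon$ centred at $p$ in $\mathcal{P}_k^\ast$. With $\mathbb{B}$ the closed unit ball and $\widehat u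 = u/|u|$, $K_\varepsilon(Z_p\cap Q) = \{u \in \mathbb{B} : \operatorname{surf}_{\widehat u,\varepsilon}(Z_p\cap Q) \le 1/|u|\}$ (with $u = 0$ included), and $\operatorname{vis}_\varepsilon(Z_p\cap Q) = (\operatorname{vol} K_\varepsilon(Z_p\cap Q))^{-1/n}$. *)

(* Defs.v *)
From HB Require Import structures.
From mathcomp Require Import all_boot all_order all_algebra.
From mathcomp Require Import all_classical all_reals all_analysis.
Set Implicit Arguments. Unset Strict Implicit. Unset Printing Implicit Defensive.
Import Order.TTheory GRing.Theory Num.Theory.
Import numFieldNormedType.Exports.
Local Open Scope classical_set_scope.
Local Open Scope ring_scope.

Section Defs.
Variable R : realType.

(* omega m = volume of the unit ball of R^m = pi^(m/2)/Gamma(m/2+1) *)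
Fixpoint omega (m : nat) : R :=
  match m with
  | 0 => 1
  | 1 => 2
  | (m'.+2) as m2 => (2 * pi / m2%:R) * omega m'
  end.

Definition diam (T : Type) (d : T -> T -> R) (A : set T) : \bar R :=
  ereal_sup [set (d xy.1 xy.2)%:E | xy in A `*` A].

Definition hterm (T : Type) (d : T -> T -> R) (s : nat) (U : set T) : \bar R :=
  if U == set0 then 0%E else (omega s * (fine (diam d U) / 2) ^+ s)%:E.

Definition haus_delta (T : Type) (d : T -> T -> R) (s : nat) (delta : R)
    (A : set T) : \bar R :=
  ereal_inf [set (\sum_(0 <= i <oo) hterm d s (F i))%E
            | F in [set F : nat -> set T |
                     A `<=` \bigcup_i F i /\ forall i, (diam d (F i) <= delta%:E)%E]].

Definition haus (T : Type) (d : T -> T -> R) (s : nat) (A : set T) : \bar R :=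
  ereal_sup [set haus_delta d s delta A | delta in [set delta : R | 0 < delta]].

(* integral over A of a nonnegative function f against an outer measure mu,
   by the layer-cake formula  int f dmu = int_0^oo mu(f > t) dt *)
Definition hint (T : Type) (mu : set T -> \bar R) (f : T -> \bar R) (A : set T)
    : \bar R :=
  (\int[lebesgue_measure]_(t in [set t : R | (0 <= t)%R])
      mu [set x | A x /\ (t%:E < f x)%E])%E.

Definition edot (n : nat) (x y : 'rV[R]_n) : R := \sum_(i < n) x ord0 i * y ord0 i.
Definition enorm (n : nat) (x : 'rV[R]_n) : R := Num.sqrt (edot x x).
Definition edist (n : nat) (x y : 'rV[R]_n) : R := enorm (x - y).

Definition regular_defining (n : nat) (Z : set 'rV[R]_n) (x : 'rV[R]_n)
    (gU : ('rV[R]_n -> R) * set 'rV[R]_n) : Prop :=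
  let g := gU.1 in let U := gU.2 in
  [/\ open U /\ U x,
      (forall y, U y -> differentiable g y),
      (forall v y, U y -> ((fun z => ('d g z) v) @ y --> ('d g y) v)),
      (exists v, ('d g x) v != 0) &
      (Z `&` U = [set y | U y /\ g y = 0])].

(* |e . n(x)| where n(x) = grad g(x) / |grad g(x)| is the unit normal of Z
   at x; set to 0 at points where Z has no normal (H_{n-1}-null for Z_p) *)
Definition abs_normal_comp (n : nat) (e : 'rV[R]_n) (Z : set 'rV[R]_n)
    (x : 'rV[R]_n) : R :=
  match pselect (exists gU, regular_defining Z x gU) with
  | left P =>
      let g := (projT1 (cid P)).1 in
      `|('d g x) e| / Num.sqrt (\sum_(i < n) (('d g x) (delta_mx ord0 i)) ^+ 2)
  | right _ => 0
  end.

Definition surf (n : nat) (e : 'rV[R]_n) (Z A : set 'rV[R]_n) : \bar R :=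
  hint (haus (@edist n) n.-1) (fun x => (abs_normal_comp e Z x)%:E) (Z `&` A).

Definition cube_index (n : nat) := {ffun 'I_n -> int}.
Definition cube (n : nat) (m : cube_index n) : set 'rV[R]_n :=
  [set x | forall i : 'I_n, (m i)%:~R <= x ord0 i < (m i)%:~R + 1].

Definition mon (n k : nat) := {a : {ffun 'I_n -> 'I_k.+1} | (\sum_(i < n) val (a i) <= k)%N}.

(* a polynomial of P_k is given by its coefficients in the monomial basis *)
Definition poly_k (n k : nat) := mon n k -> R.

Definition peval (n k : nat) (p : poly_k n k) (x : 'rV[R]_n) : R :=
  \sum_(a : mon n k) p a * \prod_(i < n) x ord0 i ^+ val (val a i).

Definition zero_set (n k : nat) (p : poly_k n k) : set 'rV[R]_n :=
  [set x | peval p x = 0].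

Definition gram_form (n k : nat) (G : mon n k -> mon n k -> R) (p : poly_k n k) : R :=
  \sum_(a : mon n k) \sum_(b : mon n k) p a * G a b * p b.

Definition pos_def_gram (n k : nat) (G : mon n k -> mon n k -> R) : Prop :=
  (forall a b, G a b = G b a) /\
  (forall p : poly_k n k, (exists a, p a != 0) -> 0 < gram_form G p).

Definition gnorm (n k : nat) (G : mon n k -> mon n k -> R) (p : poly_k n k) : R :=
  Num.sqrt (gram_form G p).

Definition gdist (n k : nat) (G : mon n k -> mon n k -> R) (p q : poly_k n k) : R :=
  gnorm G (fun a => p a - q a).

Definition psphere (n k : nat) (G : mon n k -> mon n k -> R) : set (poly_k n k) :=
  [set p | gnorm G p = 1].

Definition sph_ball (n k : nat) (G : mon n k -> mon n k -> R) (p : poly_k n k)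
    (eps : R) : set (poly_k n k) :=
  [set q | psphere G q /\ gdist G q p < eps].

(* surface measure on P_k^* = S^N, N = dim P_k - 1 *)
Definition sph_measure (n k : nat) (G : mon n k -> mon n k -> R) :=
  haus (gdist G) (#|{: mon n k}|.-1).

Definition surf_moll (n k : nat) (G : mon n k -> mon n k -> R) (e : 'rV[R]_n)
    (eps : R) (p : poly_k n k) (Q : set 'rV[R]_n) : \bar R :=
  ((fine (sph_measure G (sph_ball G p eps)))^-1%:E *
   hint (sph_measure G) (fun q => surf e (zero_set q) Q) (sph_ball G p eps))%E.

Definition Kset (n k : nat) (G : mon n k -> mon n k -> R) (eps : R)
    (p : poly_k n k) (Q : set 'rV[R]_n) : set 'rV[R]_n :=
  [set u | enorm u <= 1 /\
           (u = 0 \/ (surf_moll G ((enorm u)^-1 *: u) eps p Q <= (enorm u)^-1%:E)%E)].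

Definition vol (n : nat) (A : set 'rV[R]_n) : \bar R := haus (@edist n) n A.

Definition vis (n k : nat) (G : mon n k -> mon n k -> R) (eps : R)
    (p : poly_k n k) (Q : set 'rV[R]_n) : \bar R :=
  let v := vol (Kset G eps p Q) in
  if v == 0%E then +oo%E else ((fine v) `^ (- (n%:R)^-1))%:E.

End Defs.

(* Main.v *)
Require Import Defs.
From HB Require Import structures.
From mathcomp Require Import all_boot all_order all_algebra all_fingroup.
From mathcomp Require Import all_classical all_reals all_analysis.
From mathcomp Require Import ring lra zify measurable_realfun.
Set Implicit Arguments. Unset Strict Implicit. Unset Printing Implicit Defensive.
Import Order.TTheory GRing.Theory Num.Theory.
Local Open Scope ring_scope.

(** Cubes with [M Q < 1] impose nothing beyond [K_eps] being contained in the unit ball, so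
    only finitely many cubes matter, with integer weights [r Q] comparable to [M Q ^ n] and
    total weight [S]; one has to produce [p] with [vol K_eps <= C / r Q] on each of them.

    Visibility is produced by random polynomials.  After a linear change of coordinates of
    the space of polynomials, the evaluation functionals at grid points of the cubes (with
    multiplicities [r Q]) are in isotropic position, so that on average two points of [Q]
    are nearly orthogonal; a polynomial with random coefficients in [{-1, 0, 1}] then takes
    different signs at them with probability bounded below.  Using several such polynomials
    of geometrically decreasing degrees [S ^ (1/n) / 2 ^ j], and repeating the construction
    on the cubes left behind, gives a list [L] of polynomials of total degree
    [O (S ^ (1/n))] such that at most a fraction [O (1 / r Q)] of the pairs of points of
    [Q] is not separated by a sign change of a member of [L].

    The final polynomial is the normalisation of [F - b], where [F] is the square of the
    product of [L] and [b > 0] is a small generic level: a segment joining separated points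
    crosses [{F = b}] transversally, and this persists for all polynomials in a small
    spherical ball and for all nearby segments.  If [u] lies in [K_eps] and [w] is a small
    multiple of [u], a Crofton type inequality, proved by covering arguments from the
    definition of Hausdorff measure, bounds by a small constant the proportion of points [z]
    for which the segment from [z] to [z + w] crosses the zero set.  Hence most pairs
    [(z, z + w)] are not separated, and counting pairs bounds the volume of [K_eps]. *)

(** * Isotropic position of a finite family of vectors *)

Section IsotropicPosition.
Variable R : realType.

(** Several scales of degree avoid a logarithmic loss. At scale [s / 2 ^ j], the pairs of [Q] that
    are not nearly orthogonal form a fraction [O(2 ^ (j n) / r Q)], while [O(j + 1)] polynomials of
    that scale divide the number of the other pairs by [4 ^ (n (j + 1))]. The series of
    [2 ^ (j n) / 4 ^ (j n)], for the pairs, and of [(j + 1) / 2 ^ j], for the degrees, both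
    converge. An average over all cubes only controls cubes that carry half of the weight, hence the
    repetition.

    The zero set of the product of [L] may be singular and unstable under perturbation. The function
    [F - b] is negative on it and positive at the grid points where [F] does not vanish, so
    separation survives, and transversality can be obtained by varying [b].

    Two grids are used because the errors of rounding depend on the coarse size [T] only. [T] is
    fixed from an a priori bound of the degree, then [L] and [F]; the refinement [T'] depends on the
    Lipschitz constants of [F], and the level and the radius of the spherical ball come last.

    Integrals are only bounded from below, by step functions, so that outer measures suffice. *)

Definition rdot (D : nat) (x y : 'rV[R]_D) : R := \sum_(i < D) x ord0 i * y ord0 i.

Lemma rdotC D (x y : 'rV[R]_D) : rdot x y = rdot y x.
Proof. by apply: eq_bigr => i _; rewrite mulrC. Qed.

Lemma rdotDl D (x y z : 'rV[R]_D) : rdot (x + y) z = rdot x z + rdot y z.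
Proof. by rewrite -big_split; apply: eq_bigr => i _; rewrite mxE mulrDl. Qed.

Lemma rdotZl D (a : R) (x z : 'rV[R]_D) : rdot (a *: x) z = a * rdot x z.
Proof. by rewrite mulr_sumr; apply: eq_bigr => i _; rewrite mxE mulrA. Qed.

Lemma rdotE D (x y : 'rV[R]_D) : x *m y^T = (rdot x y)%:M.
Proof.
apply/matrixP => i j; rewrite !ord1 !mxE eqxx mulr1n.
by apply: eq_bigr => l _; rewrite mxE.
Qed.

Lemma rdot_ge0 D (x : 'rV[R]_D) : 0 <= rdot x x.
Proof. by apply: sumr_ge0 => i _; rewrite -expr2 sqr_ge0. Qed.

Lemma rdot_eq0 D (x : 'rV[R]_D) : (rdot x x == 0) = (x == 0).
Proof.
apply/idP/eqP => [|->]; last first.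
  by rewrite /rdot big1 // => i _; rewrite mxE mulr0.
rewrite psumr_eq0; last by move=> i _; rewrite -expr2 sqr_ge0.
move/allP => h; apply/rowP => i; rewrite mxE.
have := h i; rewrite mem_index_enum => /(_ isT) /=.
by rewrite mulf_eq0 orbb => /eqP.
Qed.

Lemma rdot_gt0 D (x : 'rV[R]_D) : x != 0 -> 0 < rdot x x.
Proof. by move=> x0; rewrite lt0r rdot_eq0 x0 rdot_ge0. Qed.

Lemma coord_le_rdot D (x : 'rV[R]_D) i : x ord0 i ^+ 2 <= rdot x x.
Proof.
rewrite /rdot (bigD1 i) //= -expr2 lerDl.
by apply: sumr_ge0 => j _; rewrite -expr2 sqr_ge0.
Qed.

(** The block matrix [M] has two triangular factorisations, one for each diagonal block taken as
    pivot; their determinants are compared. *)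
Lemma det_rank_one D (p : 'rV[R]_D) (a : R) :
  \det (1%:M - a *: (p^T *m p)) = 1 - a * rdot p p.
Proof.
pose M := block_mx (1%:M : 'M[R]_1) p (a *: p^T) (1%:M : 'M[R]_D).
have h1 : M = block_mx 1%:M 0 (a *: p^T) 1%:M *m
              block_mx 1%:M p 0 (1%:M - a *: (p^T *m p)).
  rewrite mulmx_block !mul0mx !mulmx0 !mul1mx !mulmx1 !addr0 /M.
  by congr block_mx; rewrite -scalemxAl addrCA subrr addr0.
have h2 : M = block_mx (1%:M - a *: (p *m p^T)) p 0 1%:M *m
              block_mx 1%:M 0 (a *: p^T) 1%:M.
  rewrite mulmx_block !mul0mx !mulmx0 !mul1mx !mulmx1 !add0r /M.
  by congr block_mx; rewrite -scalemxAr subrK.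
have : \det M = \det M by [].
rewrite {1}h1 h2 !det_mulmx !det_lblock !det_ublock !det1 !mul1r !mulr1 => ->.
by rewrite rdotE det_mx11 !mxE eqxx !mulr1n.
Qed.

(** A crude Hadamard inequality, from the Leibniz formula. The factorial is harmless: it only enters
    the positive lower bound of the potential. *)
Lemma det_sqr_bound D (A : 'M[R]_D) :
  (\det A) ^+ 2 <= (D`!%:R) ^+ 2 * \prod_(i < D) rdot (row i A) (row i A).
Proof.
have h : `|\det A| <= D`!%:R * \prod_(i < D) Num.sqrt (rdot (row i A) (row i A)).
  rewrite /determinant; apply: le_trans (ler_norm_sum _ _ _) _.
  apply: (@le_trans _ _ (\sum_(s : 'S_D) \prod_(i < D) Num.sqrt (rdot (row i A) (row i A)))).
    apply: ler_sum => s _; rewrite normrM normrX normrN1 expr1n mul1r normr_prod.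
    apply: ler_prod => i _; rewrite normr_ge0 /= -sqrtr_sqr ler_wsqrtr //.
    by have := coord_le_rdot (row i A) (s i); rewrite mxE.
  by rewrite sumr_const card_Sn mulr_natl.
have -> : \prod_(i < D) rdot (row i A) (row i A) =
   (\prod_(i < D) Num.sqrt (rdot (row i A) (row i A))) ^+ 2.
  by rewrite -prodrXl; apply: eq_bigr => i _; rewrite sqr_sqrtr // rdot_ge0.
rewrite -exprMn -real_normK ?num_real // lerXn2r ?nnegrE //.
by rewrite mulr_ge0 // prodr_ge0 // => i _; rewrite sqrtr_ge0.
Qed.

Lemma det_sqr_gt0 D (T : 'M[R]_D) : T \in unitmx -> 0 < (\det T) ^+ 2.
Proof. by move=> uT; rewrite exprn_even_gt0 //= -unitfE -unitmxE. Qed.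

(* The potential [\prod |v T|^2 / |det T|^(2r)], whose near-minimisers are in
   approximately isotropic position. *)
Definition iso_pot D (bs : seq 'M[R]_D) (T : 'M[R]_D) : R :=
  (\prod_(B <- bs) \prod_(i < D) rdot (row i B *m T) (row i B *m T))
  / ((\det T) ^+ 2) ^+ size bs.

(** The Hadamard bound for each [B *m T] has [\det T] as a factor, which the denominator of the
    potential cancels. *)
Lemma iso_pot_ge D (bs : seq 'M[R]_D) (T : 'M[R]_D) :
  T \in unitmx ->
  \prod_(B <- bs) ((\det B) ^+ 2 / (D`!%:R) ^+ 2) <= iso_pot bs T.
Proof.
move=> uT; have dT := det_sqr_gt0 uT.
have f0 : 0 < (D`!%:R : R) ^+ 2 by rewrite exprn_gt0 // ltr0n fact_gt0.
rewrite /iso_pot ler_pdivlMr; last exact: exprn_gt0.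
elim: bs => [|B bs IH]; first by rewrite !big_nil expr0 mulr1.
rewrite !big_cons /= [X in _ * X <= _]exprS mulrACA; apply: ler_pM => //.
- by rewrite mulr_ge0 ?sqr_ge0 // mulr_ge0 ?invr_ge0 ?sqr_ge0.
- rewrite mulr_ge0 //; last by apply: exprn_ge0; rewrite ltW.
  by apply: prodr_ge0 => C _; rewrite mulr_ge0 ?invr_ge0 ?sqr_ge0.
rewrite mulrAC -exprMn -det_mulmx ler_pdivrMr // mulrC.
apply: le_trans (det_sqr_bound _) _; apply: ler_wpM2l; first exact: ltW.
by rewrite [leLHS](eq_bigr _ (fun i _ => congr1 (fun v => rdot v v) (row_mul i B T))).
Qed.

Lemma iso_pot_gt0 D (bs : seq 'M[R]_D) : all (mem unitmx) bs ->
  0 < \prod_(B <- bs) ((\det B) ^+ 2 / (D`!%:R) ^+ 2).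
Proof.
move=> /allP h; rewrite big_seq; apply: prodr_gt0 => B /h /= uB.
by rewrite divr_gt0 ?det_sqr_gt0 //; rewrite exprn_gt0 // ltr0n fact_gt0.
Qed.

(** A direction [p] along which the rows concentrate too much is contracted by one half. This
    divides [(\det T) ^+ 2] by 4 and removes 3/4 of each squared component along [p]. With [r]
    bases, [1 + x <= expR x] gives the numerator a factor [expR (- 3 r)] against [4 ^ r] from the
    denominator, and [4 * expR (- 3) <= 1 / 2]. *)
Lemma iso_pot_shrink D (bs : seq 'M[R]_D) (T : 'M[R]_D) (p : 'rV[R]_D) :
  (0 < size bs)%N -> all (mem unitmx) bs -> T \in unitmx ->
  4 * (size bs)%:R * rdot p p <
  \sum_(B <- bs) \sum_(i < D)
     rdot p (row i B *m T) ^+ 2 / rdot (row i B *m T) (row i B *m T) ->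
  exists2 T', T' \in unitmx & 2 * iso_pot bs T' <= iso_pot bs T.
Proof.
move=> r0 ubs uT hp.
have p0 : p != 0.
  apply/negP => /eqP p0; move: hp; rewrite p0 big1; last first.
    move=> B _; rewrite big1 // => i _.
    by rewrite /rdot big1 ?expr0n ?mul0r // => l _; rewrite mxE mul0r.
  by rewrite (eqP (_ : rdot 0 0 == 0)) ?rdot_eq0 // mulr0 ltxx.
have pp := rdot_gt0 p0.
pose a := (2 * rdot p p)^-1.
pose U := 1%:M - a *: (p^T *m p).
have detU : \det U = 2^-1.
  by rewrite det_rank_one /a invfM -mulrA mulVf ?gt_eqF // mulr1; lra.
exists (T *m U).
  by rewrite unitmx_mul uT /= unitmxE detU unitfE; lra.
pose t (B : 'M[R]_D) i := rdot p (row i B *m T) ^+ 2 / rdot (row i B *m T) (row i B *m T) / rdot p p.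
have uU (u : 'rV[R]_D) : rdot (u *m U) (u *m U) =
    rdot u u - 3 / 4 * (rdot p u ^+ 2 / rdot p p).
  have -> : u *m U = u + (- (a * rdot u p)) *: p.
    rewrite mulmxBr mulmx1 -scalemxAr mulmxA rdotE mul_scalar_mx scalerA.
    by rewrite scaleNr.
  rewrite rdotDl rdotZl !(rdotC _ (u + _)) !rdotDl !rdotZl (rdotC u p) /a.
  by field; rewrite gt_eqF.
rewrite /iso_pot det_mulmx detU (exprMn 2) (exprMn (size bs)).
have X0 : 0 < (\det T ^+ 2) ^+ size bs by apply: exprn_gt0; apply: det_sqr_gt0.
have Y0 : 0 < ((2^-1 : R) ^+ 2) ^+ size bs by apply: exprn_gt0; lra.
rewrite ler_pdivlMr //.
have cancelX (x y z : R) : x != 0 -> 2 * (z / (x * y)) * x = 2 * (z / y).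
  by move=> xn0; rewrite invfM (mulrC x^-1) -!mulrA mulVf // mulr1.
rewrite cancelX ?gt_eqF //.
have row0 B i : B \in bs -> 0 < rdot (row i B *m T) (row i B *m T).
  move=> Bbs; apply: rdot_gt0; apply/negP => /eqP h.
  have uB : B \in unitmx by move/allP: ubs => /(_ _ Bbs).
  have := congr1 (fun x => x *m invmx T *m invmx B) h.
  rewrite !mul0mx mulmxK // rowE mulmxK // => /rowP /(_ i).
  by rewrite !mxE !eqxx => /eqP; rewrite oner_eq0.
have hb : \prod_(B <- bs) \prod_(i < D) rdot (row i B *m (T *m U)) (row i B *m (T *m U))
   <= (\prod_(B <- bs) \prod_(i < D) rdot (row i B *m T) (row i B *m T)) *
      expR (- (3 * (size bs)%:R)).
  have step : \prod_(B <- bs) \prod_(i < D) rdot (row i B *m (T *m U)) (row i B *m (T *m U))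
    <= (\prod_(B <- bs) \prod_(i < D) rdot (row i B *m T) (row i B *m T)) *
      expR (\sum_(B <- bs) \sum_(i < D) (- (3 / 4 * t B i))).
    rewrite expR_sum -big_split /= [leLHS]big_seq [leRHS]big_seq.
    apply: ler_prod => B Bbs; rewrite prodr_ge0 /=; last by move=> i _; apply: rdot_ge0.
    rewrite expR_sum -big_split /=; apply: ler_prod => i _.
    rewrite rdot_ge0 /= mulmxA uU.
    have -> : rdot (row i B *m T) (row i B *m T) -
      3 / 4 * (rdot p (row i B *m T) ^+ 2 / rdot p p) =
      rdot (row i B *m T) (row i B *m T) * (1 + - (3 / 4 * t B i)).
      by rewrite /t; field; rewrite !gt_eqF ?row0.
    by rewrite ler_wpM2l ?rdot_ge0 // expR_ge1Dx.
  apply: le_trans step _.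
    rewrite ler_wpM2l ?ler_expR //.
      by apply: prodr_ge0 => B _; apply: prodr_ge0 => i _; apply: rdot_ge0.
    have -> : \sum_(B <- bs) \sum_(i < D) (- (3 / 4 * t B i)) = - (3 / 4) / rdot p p *
      \sum_(B <- bs) \sum_(i < D)
       rdot p (row i B *m T) ^+ 2 / rdot (row i B *m T) (row i B *m T).
      rewrite mulr_sumr; apply: eq_bigr => B _; rewrite mulr_sumr; apply: eq_bigr => i _.
      by rewrite /t; ring.
    move: hp; set y := \sum_(_ <- _) _ => hp.
    have -> : - (3 / 4) / rdot p p * y = - (3 / 4 * y / rdot p p) by ring.
    by rewrite lerN2 ler_pdivlMr //; move: hp; set x := rdot p p; lra.
apply: (@le_trans _ _ (2 * ((\prod_(B <- bs) \prod_(i < D) rdot (row i B *m T) (row i B *m T)) *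
      expR (- (3 * (size bs)%:R)) / (2^-1 ^+ 2) ^+ size bs))).
  by rewrite ler_wpM2l //; rewrite ler_wpM2r // invr_ge0 ltW.
rewrite mulrCA -mulrA ler_piMr //.
  by apply: prodr_ge0 => B _; apply: prodr_ge0 => i _; apply: rdot_ge0.
rewrite -mulNr expRM_natr mulrCA -expr_div_n.
have e3 : expR (- 3) / (2^-1) ^+ 2 <= 2^-1 :> R.
  rewrite expRN ler_pdivrMr; last by lra.
  have e1 : 2 <= expR 1 :> R by apply: le_trans (expR_ge1Dx _); lra.
  have -> : 3 = 1 + 1 + 1 :> R by lra.
  rewrite !expRD -[leRHS]invrK lef_pV2 ?posrE; last 2 first.
  - by rewrite !mulr_gt0 ?expR_gt0.
  - by rewrite invr_gt0; lra.
  by have : (2 * 2 * 2 : R) <= expR 1 * expR 1 * expR 1; [rewrite !ler_pM //; lra | lra].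
have e0 : 0 <= expR (- 3) / (2^-1) ^+ 2 :> R.
  by rewrite mulr_ge0 ?expR_ge0 // invr_ge0; lra.
case: (size bs) r0 => // r _; rewrite exprS.
have : (expR (- 3) / (2^-1) ^+ 2) ^+ r <= 1 :> R by rewrite exprn_ile1 //; lra.
have : 0 <= (expR (- 3) / (2^-1) ^+ 2) ^+ r :> R by rewrite exprn_ge0.
move: e3 e0; set x := expR (-3) / _; set y := _ ^+ r => *; nra.
Qed.

Lemma isotropic_position D (bs : seq 'M[R]_D) : all (mem unitmx) bs ->
  exists2 T, T \in unitmx & forall p,
  \sum_(B <- bs) \sum_(i < D)
     rdot p (row i B *m T) ^+ 2 / rdot (row i B *m T) (row i B *m T)
  <= 4 * (size bs)%:R * rdot p p.
Proof.
move=> ubs; have [r0|] := ltnP 0 (size bs); last first.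
  rewrite leqn0 => /eqP /size0nil ->; exists 1%:M; first exact: unitmx1.
  by move=> p; rewrite big_nil mulr0 mul0r.
pose E := [set iso_pot bs T | T in [set T | T \in unitmx]]%classic.
pose m := \prod_(B <- bs) ((\det B) ^+ 2 / (D`!%:R) ^+ 2).
have m0 : 0 < m := iso_pot_gt0 ubs.
have lbE : lbound E m by move=> _ [T /= uT <-]; exact: iso_pot_ge.
have hE : has_inf E.
  by split; [exists (iso_pot bs 1%:M); exists 1%:M => //=; exact: unitmx1 | exists m].
have infE0 : 0 < inf E by apply: lt_le_trans m0 _; apply: lb_le_inf => //; case: hE.
(* The slack is the infimum itself: the potential of [T] is below twice the infimum, so it cannot be
   halved. *)
have [_ [T uT <-]] := inf_adherent infE0 hE.
move=> hT; exists T => // p.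
rewrite leNgt; apply/negP => hp; have [T' uT' h] := iso_pot_shrink r0 ubs uT hp.
have : inf E <= iso_pot bs T' by apply: ge_inf; [exists m | exists T'].
by move: h hT; set x := iso_pot _ T'; set y := inf E; lra.
Qed.

(** Bases are extracted as long as the family spans the space; what remains lies in a hyperplane.
    For evaluation vectors this means that the remaining points are zeros of one nonzero
    polynomial. *)
Lemma greedy_bases D (s : seq 'rV[R]_D) : (0 < D)%N ->
  exists (bs : seq 'M[R]_D) (rest : seq 'rV[R]_D),
  [/\ all (mem unitmx) bs,
      perm_eq s (flatten [seq [seq row i B | i <- enum 'I_D] | B <- bs] ++ rest) &
      exists2 c : 'cV[R]_D, c != 0 & forall v, v \in rest -> v *m c = 0].
Proof.
move=> D0; have [N] := ubnP (size s); elim: N s => // N IH s /ltnSE sN.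
pose M : 'M[R]_(size s, D) := \matrix_(i < size s) nth 0 s i.
have [fM|nfM] := boolP (row_full M); last first.
  exists [::], s; split => //=.
  have : cokermx M != 0.
    by rewrite -mxrank_eq0 mxrank_coker subn_eq0 -ltnNge ltn_neqAle nfM rank_leq_col.
  case: (pickP (fun j => col j (cokermx M) != 0)) => [j hj _|h /negP[]]; last first.
    apply/eqP/matrixP => i j; move: (h j) => /negbFE /eqP /colP /(_ i).
    by rewrite !mxE.
  exists (col j (cokermx M)) => // v /(nthP 0) [i si <-].
  have -> : nth 0 s i = row (Ordinal si) M by rewrite rowK.
  by rewrite colE mulmxA -row_mul mulmx_coker row0 mul0mx.
pose f := fullrankfun fM.
have finj : injective f := @fullrankfun_inj _ _ _ M fM.
pose B : 'M[R]_D := rowsub f M.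
have uB : B \in unitmx by exact: fullrowsub_unit.
pose F := [seq f i | i <- enum 'I_D].
pose rst := [seq i <- enum 'I_(size s) | i \notin F].
have pe : perm_eq (enum 'I_(size s)) (F ++ rst).
  apply: uniq_perm; rewrite ?enum_uniq // ?cat_uniq.
    rewrite map_inj_uniq // enum_uniq filter_uniq ?enum_uniq //= andbT.
    by apply/hasPn => i; rewrite mem_filter => /andP[].
  by move=> i; rewrite mem_enum mem_cat /rst mem_filter mem_enum; case: (i \in F).
have se : s = [seq nth 0 s (val i) | i <- enum 'I_(size s)].
  rewrite map_comp val_enum_ord; apply: (@eq_from_nth _ 0); rewrite ?size_map ?size_iota //.
  by move=> i si; rewrite (nth_map 0%N) ?size_iota // nth_iota.
have szF : size F = D by rewrite size_map size_enum_ord.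
have szr : (size rst < size s)%N.
  have := perm_size pe; rewrite size_cat szF size_enum_ord => e.
  apply: (@leq_trans (D + size rst)); last by rewrite -e.
  by rewrite -[X in (X < _)%N]add0n ltn_add2r.
case: (IH [seq nth 0 s (val i) | i <- rst]).
  by rewrite size_map; apply: leq_trans szr _.
move=> bs [rest [ubs ps hc]]; exists (B :: bs), rest; split => //=.
  by rewrite uB.
rewrite {1}se; apply: (@perm_trans _ [seq nth 0 s (val i) | i <- F ++ rst]).
  exact: perm_map.
rewrite map_cat -catA; apply: perm_cat => //.
have -> // : [seq nth 0 s (val i) | i <- F] = [seq row i B | i <- enum 'I_D].
by rewrite -map_comp; apply: eq_map => i /=; rewrite /B row_rowsub rowK.
Qed.
End IsotropicPosition.

(** * Moments and signs of random linear forms *)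

Section LazySigns.
Variable R : realType.

(* Expectation over [D] independent coordinates taking the values -1, 0, 1 with
   probabilities 1/6, 2/3, 1/6; up to scaling they match the Gaussian moments up
   to order five. *)
Fixpoint lexp (D : nat) (f : seq R -> R) : R :=
  if D is D'.+1 then
    6^-1 * lexp D' (fun l => f (-1 :: l)) + 2 / 3 * lexp D' (fun l => f (0 :: l))
    + 6^-1 * lexp D' (fun l => f (1 :: l))
  else f [::].

Lemma eq_lexp D (f g : seq R -> R) : f =1 g -> lexp D f = lexp D g.
Proof. by move=> /funext ->. Qed.

Lemma lexp_le D (f g : seq R -> R) :
  (forall l, size l = D -> f l <= g l) -> lexp D f <= lexp D g.
Proof.
elim: D f g => [|D IH] f g fg /=; first exact: fg.
have h a : lexp D (fun l => f (a :: l)) <= lexp D (fun l => g (a :: l)).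
  by apply: IH => l sl; apply: fg; rewrite /= sl.
by have := h (-1); have := h 0; have := h 1; lra.
Qed.

Lemma lexpD D (f g : seq R -> R) : lexp D (fun l => f l + g l) = lexp D f + lexp D g.
Proof. by elim: D f g => //= D IH f g; rewrite !IH; ring. Qed.

Lemma lexpZ D a (f : seq R -> R) : lexp D (fun l => a * f l) = a * lexp D f.
Proof. by elim: D f => //= D IH f; rewrite !IH; ring. Qed.

Lemma lexp_cst D a : lexp D (fun=> a) = a.
Proof. by elim: D => //= D ->; field. Qed.

Lemma lexp3 D (f g h : seq R -> R) :
  6^-1 * lexp D f + 2 / 3 * lexp D g + 6^-1 * lexp D h =
  lexp D (fun l => 6^-1 * f l + 2 / 3 * g l + 6^-1 * h l).
Proof. by rewrite !lexpD !lexpZ. Qed.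

Lemma lexp_sum D (I : Type) (s : seq I) (F : I -> seq R -> R) :
  lexp D (fun l => \sum_(i <- s) F i l) = \sum_(i <- s) lexp D (F i).
Proof.
elim: s => [|i s IH]; first by rewrite big_nil -[RHS](lexp_cst D); apply: eq_lexp => l; rewrite big_nil.
by rewrite big_cons -IH -lexpD; apply: eq_lexp => l; rewrite big_cons.
Qed.

Lemma lexp_exists D (f : seq R -> R) a :
  lexp D f <= a -> exists2 l, size l = D & f l <= a.
Proof.
elim: D f => [|D IH] f /= h; first by exists [::].
have [h1|h1] := leP (lexp D (fun l => f (-1 :: l))) a.
  by have [l sl fl] := IH _ h1; exists (-1 :: l); rewrite /= ?sl.
have [h2|h2] := leP (lexp D (fun l => f (0 :: l))) a.
  by have [l sl fl] := IH _ h2; exists (0 :: l); rewrite /= ?sl.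
have [h3|h3] := leP (lexp D (fun l => f (1 :: l))) a.
  by have [l sl fl] := IH _ h3; exists (1 :: l); rewrite /= ?sl.
by exfalso; lra.
Qed.

Fixpoint ldot (l a : seq R) : R :=
  if l is x :: l' then if a is y :: a' then x * y + ldot l' a' else 0 else 0.

Lemma lexp_dot2 D a b : size a = D -> size b = D ->
  lexp D (fun l => ldot l a * ldot l b) = 3^-1 * ldot a b.
Proof.
elim: D a b => [|D IH] [|x a] [|y b] //=; rewrite ?mulr0 //= => - [sa] [sb].
have e t : lexp D (fun l => (t * x + ldot l a) * (t * y + ldot l b)) =
   t ^+ 2 * (x * y) + t * x * lexp D (fun l => ldot l b)
   + t * y * lexp D (fun l => ldot l a) + 3^-1 * ldot a b.
  transitivity (lexp D (fun l => t ^+ 2 * (x * y) + t * x * ldot l b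
     + t * y * ldot l a + ldot l a * ldot l b)); first by apply: eq_lexp => l; ring.
  by rewrite !lexpD !lexpZ lexp_cst IH.
by rewrite !e; field.
Qed.

Let sq a := ldot a a.

(** The constants are [3 / 9], [15 / 27] and [105 / 81], from the moments of a Gaussian variable of
    variance [sq a / 3]. The induction conditions on the first coordinate. *)
Lemma lexp_dot_even a : let D := size a in
  [/\ lexp D (fun l => ldot l a ^+ 4) = 3^-1 * sq a ^+ 2,
      lexp D (fun l => ldot l a ^+ 6) <= 5 / 9 * sq a ^+ 3 &
      lexp D (fun l => ldot l a ^+ 8) <= 35 / 27 * sq a ^+ 4].
Proof.
rewrite /sq; elim: a => [|x a [IH4 IH6 IH8]] /=.
  by rewrite !expr0n /= !mulr0.
have IH2 : lexp (size a) (fun l => ldot l a ^+ 2) = 3^-1 * ldot a a.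
  by rewrite -(@lexp_dot2 (size a)) //; apply: eq_lexp => l; rewrite expr2.
have v0 : 0 <= ldot a a by elim: (a) => //= y b; rewrite -expr2; have := sqr_ge0 y; lra.
set m := fun k => lexp (size a) (fun l => ldot l a ^+ k).
have e4 : 6^-1 * lexp (size a) (fun l => (-1 * x + ldot l a) ^+ 4)
   + 2 / 3 * lexp (size a) (fun l => (0 * x + ldot l a) ^+ 4)
   + 6^-1 * lexp (size a) (fun l => (1 * x + ldot l a) ^+ 4) =
   m 4 + 3^-1 * (6 * x ^+ 2 * m 2 + x ^+ 4).
  rewrite lexp3.
  transitivity (lexp (size a) (fun l => ldot l a ^+ 4 + 3^-1 * (6 * x ^+ 2 * ldot l a ^+ 2 + x ^+ 4))).
    by apply: eq_lexp => l; field.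
  by rewrite lexpD (lexpZ _ 3^-1) !lexpD !(lexpZ _ (_ * x ^+ _)) lexp_cst.
have e6 : 6^-1 * lexp (size a) (fun l => (-1 * x + ldot l a) ^+ 6)
   + 2 / 3 * lexp (size a) (fun l => (0 * x + ldot l a) ^+ 6)
   + 6^-1 * lexp (size a) (fun l => (1 * x + ldot l a) ^+ 6) =
   m 6 + 3^-1 * (15 * x ^+ 2 * m 4 + 15 * x ^+ 4 * m 2 + x ^+ 6).
  rewrite lexp3.
  transitivity (lexp (size a) (fun l => ldot l a ^+ 6 + 3^-1 * (15 * x ^+ 2 * ldot l a ^+ 4 + 15 * x ^+ 4 * ldot l a ^+ 2 + x ^+ 6))).
    by apply: eq_lexp => l; field.
  by rewrite lexpD (lexpZ _ 3^-1) !lexpD !(lexpZ _ (_ * x ^+ _)) lexp_cst.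
have e8 : 6^-1 * lexp (size a) (fun l => (-1 * x + ldot l a) ^+ 8)
   + 2 / 3 * lexp (size a) (fun l => (0 * x + ldot l a) ^+ 8)
   + 6^-1 * lexp (size a) (fun l => (1 * x + ldot l a) ^+ 8) =
   m 8 + 3^-1 * (28 * x ^+ 2 * m 6 + 70 * x ^+ 4 * m 4 + 28 * x ^+ 6 * m 2 + x ^+ 8).
  rewrite lexp3.
  transitivity (lexp (size a) (fun l => ldot l a ^+ 8 + 3^-1 * (28 * x ^+ 2 * ldot l a ^+ 6 + 70 * x ^+ 4 * ldot l a ^+ 4 + 28 * x ^+ 6 * ldot l a ^+ 2 + x ^+ 8))).
    by apply: eq_lexp => l; field.
  by rewrite lexpD (lexpZ _ 3^-1) !lexpD !(lexpZ _ (_ * x ^+ _)) lexp_cst.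
move: IH2 IH4 IH6 IH8; rewrite -!/(m _) => m2 m4 m6 m8.
rewrite e4 e6 e8 m2 m4; move: (ldot a a) v0 m6 m8 => v v0 m6 m8.
have X0 : 0 <= x ^+ 2 by exact: sqr_ge0.
have xx : x * x = x ^+ 2 by ring.
have x4 : x ^+ 4 = (x ^+ 2) ^+ 2 by ring.
have x6 : x ^+ 6 = (x ^+ 2) ^+ 3 by ring.
have x8 : x ^+ 8 = (x ^+ 2) ^+ 4 by ring.
rewrite xx x4 x6 x8; move: (x ^+ 2) X0 => X X0; split.
- by field.
- have := mulr_ge0 v0 (sqr_ge0 X); have := exprn_ge0 3 X0; lra.
- have h6 : X * m 6 <= X * (5 / 9 * v ^+ 3) by rewrite ler_wpM2l.
  have := mulr_ge0 v0 (exprn_ge0 3 X0); have := exprn_ge0 4 X0.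
  have := mulr_ge0 (sqr_ge0 v) (sqr_ge0 X); lra.
Qed.

(** The proof computes the exact value, which is that of Wick's formula for Gaussian coordinates of
    variance 1/3. *)
Lemma lexp_dot22_ge a b : size a = size b ->
  9^-1 * (sq a * sq b) <= lexp (size a) (fun l => (ldot l a * ldot l b) ^+ 2).
Proof.
rewrite /sq; move=> sab; have -> :
    lexp (size a) (fun l => (ldot l a * ldot l b) ^+ 2) =
    9^-1 * (ldot a a * ldot b b + 2 * ldot a b ^+ 2); last first.
  by rewrite ler_wpM2l ?invr_ge0 // lerDl mulr_ge0 ?sqr_ge0.
elim: a b sab => [|x a IH] [|y b] /= sab; [by ring | by [] | by [] |].
move: sab => /eqP; rewrite eqSS => /eqP sab.
rewrite lexp3.
transitivity (lexp (size a) (fun l => (ldot l a * ldot l b) ^+ 2 + 3^-1 *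
  (y ^+ 2 * (ldot l a * ldot l a) + x ^+ 2 * (ldot l b * ldot l b)
    + 4 * (x * y) * (ldot l a * ldot l b) + x ^+ 2 * y ^+ 2))).
  by apply: eq_lexp => l; field.
rewrite lexpD lexpZ !lexpD !lexpZ lexp_cst IH // !lexp_dot2 //.
by field.
Qed.

(** A quartic polynomial in the product [X Y] of the two forms serves as test function: it is
    nonpositive where the signs agree and at most 5 elsewhere, so one fifth of its expectation
    bounds the probability of disagreement from below. Near orthogonality makes the linear term
    small, and the eighth moments control the quartic one. *)
Lemma lexp_sign a b : size a = size b -> sq a = 1 -> sq b = 1 ->
  ldot a b ^+ 2 <= 1000^-1 ->
  lexp (size a) (fun l => ((0 < ldot l a) == (0 < ldot l b))%:R) <= 1 - 500^-1.
Proof.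
move=> sab a1 b1 ab.
have m2 := lexp_dot22_ge sab; rewrite a1 b1 in m2.
have m1 := lexp_dot2 erefl (esym sab).
have [_ _ a8] := lexp_dot_even a; rewrite a1 in a8.
have [_ _ b8] := lexp_dot_even b; rewrite b1 -sab in b8.
have m4 : lexp (size a) (fun l => (ldot l a * ldot l b) ^+ 4) <= 35 / 27.
  apply: (@le_trans _ _ (lexp (size a) (fun l => 2^-1 * (ldot l a ^+ 8 + ldot l b ^+ 8)))).
    apply: lexp_le => l _; have := sqr_ge0 (ldot l a ^+ 4 - ldot l b ^+ 4).
    by move: (ldot l a) (ldot l b) => x y; lra.
  by rewrite lexpZ lexpD; lra.
(* AM-GM gives [3 y ^ 2 - 2 y - y ^ 4 <= 0] for [y >= 0], and this polynomial is
   at most 5 everywhere. *)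
apply: (@le_trans _ _ (lexp (size a) (fun l => 1 - 5^-1 *
   (3^-1 * (ldot l a * ldot l b) ^+ 2 - 2 / 3 * (ldot l a * ldot l b)
     - 81^-1 * (ldot l a * ldot l b) ^+ 4)))).
  apply: lexp_le => l _; move: (ldot l a) (ldot l b) => x y.
  have le5 (z : R) : 3 * z ^+ 2 - 2 * z - z ^+ 4 <= 5.
    have := sqr_ge0 (z ^+ 2 - 2); have := sqr_ge0 (z + 1); lra.
  have := le5 (x * y / 3).
  have -> : 3 * (x * y / 3) ^+ 2 - 2 * (x * y / 3) - (x * y / 3) ^+ 4 =
    3^-1 * (x * y) ^+ 2 - 2 / 3 * (x * y) - 81^-1 * (x * y) ^+ 4 by field.
  move: (le5 (x * y / 3)) => _ h.
  have le0 : 0 <= x * y -> 3^-1 * (x * y) ^+ 2 - 2 / 3 * (x * y) - 81^-1 * (x * y) ^+ 4 <= 0.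
    move: (x * y) => z z0.
    have : 0 <= z * (z - 3) ^+ 2 * (z + 6) by apply: mulr_ge0; [apply: mulr_ge0 => //; exact: sqr_ge0 | rewrite addr_ge0].
    lra.
  have [x0|x0] := ltP 0 x; have [y0|y0] := ltP 0 y; rewrite /= ?mulr1n ?mulr0n.
  - by have := le0 (ltW (mulr_gt0 x0 y0)); lra.
  - lra.
  - lra.
  - by have := le0 (mulr_le0 x0 y0); lra.
have -> : lexp (size a) (fun l => 1 - 5^-1 *
   (3^-1 * (ldot l a * ldot l b) ^+ 2 - 2 / 3 * (ldot l a * ldot l b)
     - 81^-1 * (ldot l a * ldot l b) ^+ 4)) = 1 - 5^-1 *
  (3^-1 * lexp (size a) (fun l => (ldot l a * ldot l b) ^+ 2)
   - 2 / 3 * lexp (size a) (fun l => ldot l a * ldot l b)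
   - 81^-1 * lexp (size a) (fun l => (ldot l a * ldot l b) ^+ 4)).
  transitivity (lexp (size a) (fun l => 1 + (- 15^-1) * (ldot l a * ldot l b) ^+ 2
    + 2 / 15 * (ldot l a * ldot l b) + 405^-1 * (ldot l a * ldot l b) ^+ 4)).
    by apply: eq_lexp => l; field.
  by rewrite !lexpD !lexpZ lexp_cst; field.
rewrite m1; have : ldot a b <= 31 / 960.
  have := sqr_ge0 (ldot a b - 31 / 960); nra.
move: m2 m4; set p := lexp _ _; set q := lexp _ _; lra.
Qed.
End LazySigns.

(** * Counting on grids along coordinate lines *)

Section GridCounting.
Variables n T : nat.
Definition grid := {ffun 'I_n -> 'I_T}.

Definition upd (x : grid) (l : 'I_n) (t : 'I_T) : grid :=
  [ffun i => if i == l then t else x i].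

(** Double counting of the pairs [(x, t)]: the involution [g] exchanges [t] with the coordinate
    [x l], so every point of [A] is met [T] times. *)
Lemma card_fibers (A : {set grid}) (l : 'I_n) (d : nat) :
  (forall x, #|[set t | upd x l t \in A]| <= d)%N -> (#|A| * T <= d * T ^ n)%N.
Proof.
move=> h; pose g (p : grid * 'I_T) := (upd p.1 l p.2, p.1 l).
have gK : involutive g.
  move=> [x t]; rewrite /g /= !ffunE eqxx; congr (_, _).
  by apply/ffunP => i; rewrite !ffunE; case: eqP => [->|].
have -> : (#|A| * T = \sum_(x : grid) \sum_(t : 'I_T) (upd x l t \in A))%N.
  rewrite pair_big /= (reindex_inj (inv_inj gK)) /=.
  rewrite -(pair_big xpredT xpredT (fun (x : grid) (t : 'I_T) => (upd (upd x l t) l (x l) \in A : nat))) /=.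
  under eq_bigr => x _.
    under eq_bigr => t _.
      have -> : upd (upd x l t) l (x l) = x.
        by apply/ffunP => i; rewrite !ffunE; case: eqP => [->|].
      over.
    rewrite sum_nat_const card_ord; over.
  by rewrite -big_distrr /= -sum1_card mulnC; congr (_ * _)%N; rewrite big_mkcond.
apply: (@leq_trans (\sum_(x : grid) d)).
  apply: leq_sum => x _; apply: leq_trans (h x).
  by rewrite -sum1_card [leqRHS]big_mkcond; apply: leq_sum => t _; rewrite inE; case: (_ \in _).
by rewrite sum_nat_const card_ffun !card_ord mulnC.
Qed.

Definition mix (l : nat) (x y : grid) : grid := [ffun i : 'I_n => if (i < l)%N then x i else y i].

Lemma mix0 x y : mix 0 x y = y. Proof. by apply/ffunP => i; rewrite ffunE. Qed.
Lemma mixn x y : mix n x y = x. Proof. by apply/ffunP => i; rewrite ffunE ltn_ord. Qed.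

Lemma mix_step (P : pred grid) x y : P x -> ~~ P y ->
  exists l : 'I_n, P (mix l.+1 x y) && ~~ P (mix l x y).
Proof.
move=> Px Py; case: (pickP (fun l : 'I_n => P (mix l.+1 x y) && ~~ P (mix l x y))) => [l|e].
  by exists l.
have {}e l : (l <= n)%N -> ~~ P (mix l x y).
  elim: l => [|l IH] ln; first by rewrite mix0.
  by have := e (Ordinal ln); rewrite /= (IH (ltnW ln)) andbT => /negbT.
by have := e n (leqnn n); rewrite mixn Px.
Qed.

(** On the path from [f x] to [x] that replaces one coordinate at a time, [P] changes at some step
    [l]. The hypothesis bounds such changes along each line of direction [l], where [f] is evaluated
    at the moving point. *)
Lemma card_path_change (P : pred grid) (f : grid -> grid) (d : nat) :
  (forall (l : 'I_n) x, #|[set t | P (mix l.+1 (upd x l t) (f (upd x l t)))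
      && ~~ P (mix l (upd x l t) (f (upd x l t)))]| <= d)%N ->
  (#|[set x | P x && ~~ P (f x)]| * T <= n * d * T ^ n)%N.
Proof.
move=> h; pose A (l : 'I_n) := [set x | P (mix l.+1 x (f x)) && ~~ P (mix l x (f x))].
apply: (@leq_trans (\sum_(l < n) #|A l| * T)%N).
  rewrite -big_distrl leq_mul2r; apply/orP; right.
  apply: (@leq_trans #|\bigcup_l A l|).
    apply: subset_leq_card; apply/fintype.subsetP => x.
    rewrite inE => /andP[Px Py]; have [l hl] := mix_step Px Py.
    by apply/bigcupP; exists l => //; rewrite inE.
  by elim/big_rec2: _ => [|l k B _ hk]; rewrite ?cards0 // (leq_trans (leq_card_setU _ _)) ?leq_add2l.
rewrite -mulnA -[X in (_ <= X * _)%N]card_ord -sum_nat_const.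
apply: leq_sum => l _; apply: (@card_fibers (A l) l) => x.
by apply: leq_trans (h l x); rewrite subset_leq_card //; apply/fintype.subsetP => t; rewrite !inE.
Qed.
End GridCounting.

(** * Polynomial functions and their zeros on grids *)

Section Polynomials.
Variables (R : realType) (n : nat).
Implicit Types (f g : 'rV[R]_n -> R).

Definition ispol k f := exists p : poly_k R n k, f =1 peval p.

Lemma ispolD k f g : ispol k f -> ispol k g -> ispol k (fun x => f x + g x).
Proof.
move=> [p fp] [q gq]; exists (fun a => p a + q a) => x.
by rewrite fp gq /peval -big_split; apply: eq_bigr => a _; rewrite mulrDl.
Qed.

Lemma ispolZ k c f : ispol k f -> ispol k (fun x => c * f x).
Proof.
move=> [p fp]; exists (fun a => c * p a) => x.
by rewrite fp /peval mulr_sumr; apply: eq_bigr => a _; rewrite mulrA.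
Qed.

Lemma eq_ispol k f g : f =1 g -> ispol k f -> ispol k g.
Proof. by move=> /funext ->. Qed.

Lemma ispol_monom k (a : 'I_n -> nat) : (\sum_i a i <= k)%N ->
  ispol k (fun x => \prod_i x ord0 i ^+ a i).
Proof.
move=> ak; have ai i : (a i < k.+1)%N.
  by rewrite ltnS (leq_trans _ ak) // (bigD1 i) //= leq_addr.
pose a' : {ffun 'I_n -> 'I_k.+1} := [ffun i => Ordinal (ai i)].
have ha' : (\sum_(i < n) val (a' i) <= k)%N.
  by rewrite (leq_trans _ ak) // leq_sum // => i _; rewrite ffunE.
exists (fun b => (b == Sub a' ha')%:R) => x.
rewrite /peval (bigD1 (Sub a' ha')) //= eqxx mul1r [X in _ = _ + X]big1 ?addr0; last first.
  by move=> b /negbTE ->; rewrite mul0r.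
by apply: eq_bigr => i _; rewrite ffunE.
Qed.

Lemma ispol_cst k c : ispol k (fun=> c).
Proof.
apply: (@eq_ispol k (fun x => c * \prod_i x ord0 i ^+ 0)).
  by move=> x; rewrite big1 ?mulr1 // => i _.
by apply: ispolZ; apply: ispol_monom; rewrite big1.
Qed.

Lemma ispol_sum k (I : Type) (s : seq I) (P : pred I) (F : I -> 'rV[R]_n -> R) :
  (forall i, P i -> ispol k (F i)) -> ispol k (fun x => \sum_(i <- s | P i) F i x).
Proof.
move=> h; elim: s => [|i s IH].
  by apply: eq_ispol (ispol_cst k 0) => x; rewrite big_nil.
case Pi : (P i).
  by apply: eq_ispol (ispolD (h i Pi) IH) => x; rewrite big_cons Pi.
by apply: eq_ispol IH => x; rewrite big_cons Pi.
Qed.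

Lemma ispolM k l f g : ispol k f -> ispol l g -> ispol (k + l) (fun x => f x * g x).
Proof.
move=> [p fp] [q gq].
apply: (@eq_ispol _ (fun x => \sum_(a : mon n k) \sum_(b : mon n l) p a * q b *
    \prod_i x ord0 i ^+ (val (val a i) + val (val b i)))).
  move=> x; rewrite fp gq /peval mulr_suml; apply: eq_bigr => a _.
  rewrite mulr_sumr; apply: eq_bigr => b _.
  under eq_bigr => i _ do rewrite exprD.
  by rewrite big_split /= mulrACA.
apply: ispol_sum => a _; apply: ispol_sum => b _; apply: ispolZ; apply: ispol_monom.
by rewrite big_split leq_add //; [exact: (valP a) | exact: (valP b)].
Qed.

Lemma ispol_le k l f : (k <= l)%N -> ispol k f -> ispol l f.
Proof.
move=> kl fk; rewrite -(subnKC kl).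
by apply: eq_ispol (ispolM fk (ispol_cst (l - k) 1)) => x; rewrite mulr1.
Qed.

Lemma ispol_line k f (x v : 'rV[R]_n) : ispol k f ->
  exists2 r : {poly R}, (size r <= k.+1)%N & forall s, f (x + s *: v) = r.[s].
Proof.
move=> [p fp].
exists (\sum_(a : mon n k) p a *: \prod_i ((x ord0 i)%:P + (v ord0 i) *: 'X) ^+ val (val a i)).
  apply: (leq_trans (size_sum _ _ _)); apply/bigmax_leqP => a _.
  apply: (leq_trans (size_scale_leq _ _)).
  have dl i : (size (((x ord0 i)%:P + (v ord0 i) *: 'X) ^+ val (val a i)) <= (val (val a i)).+1)%N.
    apply: (leq_trans (size_poly_exp_leq _ _)); rewrite ltnS.
    rewrite -[leqRHS]mul1n leq_mul2r; apply/orP; right.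
    apply: (@leq_trans 2.-1) => //; rewrite -!subn1 leq_sub2r //.
    apply: (leq_trans (size_polyD _ _)); rewrite geq_max size_polyC.
    by rewrite (leq_trans (leq_b1 _)) //= (leq_trans (size_scale_leq _ _)) ?size_polyX.
  apply: (@leq_trans (\sum_i val (val a i)).+1); last by rewrite ltnS; exact: (valP a).
  elim/big_rec2: _ => [|i y q _ hq]; first by rewrite size_poly1.
  apply: (leq_trans (size_polyMleq _ _)).
  by move: (dl i) hq; set A := size _; set B := size q; lia.
move=> s; rewrite fp /peval horner_sum; apply: eq_bigr => a _.
rewrite hornerZ horner_prod; congr (_ * _); apply: eq_bigr => i _.
by rewrite !mxE horner_exp !hornerE mulrC.
Qed.

Definition gpt T (m : cube_index n) (x : grid n T) : 'rV[R]_n :=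
  \row_i ((m i)%:~R + (x i)%:R / T%:R).

Lemma gpt_upd T m (x : grid n T) l t :
  gpt m (upd x l t) = gpt m x + ((t%:R - (x l)%:R) / T%:R) *: delta_mx ord0 l.
Proof.
apply/rowP => i; rewrite !mxE !ffunE eqxx /=.
by case: eqP => [->|_] /=; rewrite ?mulr1 ?mulr0 ?addr0 //; ring.
Qed.

Lemma gpt_upd_line T m k f (x : grid n T) l : ispol k f ->
  exists2 r : {poly R}, (size r <= k.+1)%N & forall t, f (gpt m (upd x l t)) = r.[t%:R].
Proof.
move=> fk.
have [r sr hr] := ispol_line (gpt m x - ((x l)%:R / T%:R) *: delta_mx ord0 l)
                    (T%:R^-1 *: delta_mx ord0 l) fk.
exists r => // t; rewrite -hr gpt_upd scalerA mulrBl scalerBl; congr f.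
by rewrite addrAC addrA addrAC.
Qed.

Lemma card_roots_grid T (r : {poly R}) : r != 0 ->
  (#|[set t : 'I_T | r.[t%:R] == 0%R]| < size r)%N.
Proof.
move=> r0; rewrite cardE -(size_map (fun t : 'I_T => t%:R : R)); apply: max_poly_roots => //.
  apply/allP => _ /mapP[t + ->]; rewrite mem_enum inE.
  by [].
rewrite map_inj_uniq ?enum_uniq // => t t' /eqP.
by rewrite eqr_nat => /eqP /val_inj.
Qed.

(** A bound of Schwartz-Zippel type: the path counting is applied to the constant map [x0]. On a
    line where the comparison point is not a zero, the restriction is a nonzero polynomial with at
    most [k] roots. *)
Lemma card_zeros_grid T (m : cube_index n) k f (x0 : grid n T) : ispol k f ->
  f (gpt m x0) != 0 ->
  (#|[set x : grid n T | f (gpt m x) == 0%R]| * T <= n * k * T ^ n)%N.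
Proof.
move=> fk f0; pose P (x : grid n T) := f (gpt m x) == 0.
have -> : [set x : grid n T | f (gpt m x) == 0] =
    [set x | P x && ~~ P ((fun=> x0) x)].
  by apply/setP => x; rewrite !inE /P f0 andbT.
apply: card_path_change => l x /=.
have mixE t : mix l.+1 (upd x l t) x0 = upd (mix l x x0) l t.
  apply/ffunP => i; rewrite !ffunE ltnS leq_eqVlt.
  by have [->|il] := eqVneq i l; rewrite ?eqxx //= (negbTE (_ : val i != val l)).
have mixE' t : mix l (upd x l t) x0 = upd (mix l x x0) l (x0 l).
  apply/ffunP => i; rewrite !ffunE.
  by have [->|il] := eqVneq i l; rewrite ?ltnn.
have [r sr hr] := gpt_upd_line m (mix l x x0) l fk.
under eq_finset => t do rewrite mixE mixE' /P !hr.
have [r0|r0] := eqVneq r.[(x0 l)%:R] 0.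
  by rewrite (_ : [set _ | _] = finset.set0) ?cards0 //; apply/setP => t; rewrite !inE andbF.
have rn0 : r != 0 by apply: contraNneq r0 => ->; rewrite horner0.
rewrite -ltnS; apply: leq_trans sr; apply: leq_ltn_trans (card_roots_grid T rn0).
by rewrite subset_leq_card //; apply/fintype.subsetP => t; rewrite !inE => /andP[].
Qed.

Section Box.
Variable s : nat.
(** Exponents are bounded in each variable separately: the dimension is exactly [s ^ n], and
    evaluation on a product grid is a tensor product of Vandermonde matrices. The total degree is at
    most [n * s.-1]. *)
Definition box := {ffun 'I_n -> 'I_s}.
Definition bmon (a : box) (x : 'rV[R]_n) : R := \prod_i x ord0 i ^+ val (a i).
Definition bvec (x : 'rV[R]_n) : 'rV[R]_#|{: box}| := \row_j bmon (enum_val j) x.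
Definition bpoly (c : 'cV[R]_#|{: box}|) (x : 'rV[R]_n) : R := (bvec x *m c) ord0 ord0.

Lemma card_box : #|{: box}| = (s ^ n)%N.
Proof. by rewrite card_ffun !card_ord. Qed.

Lemma bpolyE c x : bpoly c x = \sum_j bmon (enum_val j) x * c j ord0.
Proof. by rewrite /bpoly mxE; apply: eq_bigr => j _; rewrite mxE. Qed.

Lemma ispol_bpoly c : ispol (n * s.-1) (bpoly c).
Proof.
apply: (@eq_ispol _ (fun x => \sum_j c j ord0 * bmon (enum_val j) x)).
  by move=> x; rewrite bpolyE; apply: eq_bigr => j _; rewrite mulrC.
apply: ispol_sum => j _; apply: ispolZ; apply: ispol_monom.
apply: (@leq_trans (\sum_(i < n) s.-1)); last by rewrite sum_nat_const card_ord.
by apply: leq_sum => i _; have := ltn_ord (enum_val j i); rewrite /=; lia.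
Qed.

(** Interpolation: the products of entries of the inverse Vandermonde matrices recover each
    coefficient from the values on a subgrid with [s] points in each direction. *)
Lemma bpoly_neq0 T (m : cube_index n) c : (s <= T)%N -> c != 0 ->
  exists x : grid n T, bpoly c (gpt m x) != 0.
Proof.
move=> sT c0; case: (pickP (fun x : grid n T => bpoly c (gpt m x) != 0)) => [x|h].
  by exists x.
case/negP: c0; apply/eqP/colP => j0; rewrite [RHS]mxE.
pose tn (i : 'I_n) (j : 'I_s) : R := (m i)%:~R + j%:R / T%:R.
pose V i : 'M[R]_s := Vandermonde s (\row_j tn i j).
have T0 : (0 < n)%N -> (T%:R : R) != 0.
  move=> n0; rewrite pnatr_eq0 -lt0n (leq_trans _ sT) //.
  by apply: leq_ltn_trans (ltn_ord (enum_val j0 (Ordinal n0))).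
have uV i : V i \in unitmx.
  have Tn0 : (T%:R : R) != 0 by apply: T0; apply: leq_ltn_trans (ltn_ord i).
  rewrite unitmxE unitfE det_Vandermonde; apply/prodf_neq0 => a _; apply/prodf_neq0 => b ab.
  rewrite !mxE /tn opprD addrACA subrr add0r -mulrBl mulf_neq0 ?invr_eq0 //.
  by rewrite subr_eq0 eqr_nat; apply: contraTneq ab => ->; rewrite ltnn.
have VW i (a b : 'I_s) : \sum_(j < s) tn i j ^+ a * invmx (V i) j b = (a == b)%:R :> R.
  have /matrixP /(_ a b) := mulmxV (uV i); rewrite !mxE => <-.
  by apply: eq_bigr => j _; rewrite !mxE.
pose b0 := enum_val j0.
pose wd (x : box) : grid n T := [ffun i => widen_ord sT (x i)].
have key : \sum_(x : box) (\prod_i invmx (V i) (x i) (b0 i)) * bpoly c (gpt m (wd x)) = c j0 ord0.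
  transitivity (\sum_(x : box) \sum_(j < #|{: box}|)
     (\prod_i (tn i (x i) ^+ val ((enum_val j : box) i) * invmx (V i) (x i) (b0 i))) * c j ord0).
    apply: eq_bigr => x _; rewrite bpolyE mulr_sumr; apply: eq_bigr => j _.
    rewrite mulrA; congr (_ * _); rewrite mulrC /bmon -big_split /=.
    by apply: eq_bigr => i _; rewrite mxE ffunE.
  rewrite exchange_big /= (bigD1 j0) //= [X in _ + X]big1 ?addr0.
    rewrite -mulr_suml -(bigA_distr_bigA (fun i j => tn i j ^+ enum_val j0 i * invmx (V i) j (b0 i))) /=.
    by rewrite big1 ?mul1r // => i _; rewrite VW eqxx.
  move=> j jj0.
  rewrite -mulr_suml -(bigA_distr_bigA (fun i l => tn i l ^+ enum_val j i * invmx (V i) l (b0 i))) /=.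
  have [i hi] : exists i, enum_val j i != b0 i.
    apply/existsP; rewrite -negb_forall; apply: contra jj0 => /forallP e.
    by apply/eqP/enum_val_inj/ffunP => i; apply/eqP/e.
  by rewrite (bigD1 i) //= VW (negbTE hi) !mul0r.
by rewrite -key big1 // => x _; have /negbFE/eqP -> := h (wd x); rewrite mulr0.
Qed.

Lemma card_bpoly_zeros T (m : cube_index n) c : (s <= T)%N -> c != 0 ->
  (#|[set x : grid n T | bpoly c (gpt m x) == 0%R]| * T <= n * (n * s.-1) * T ^ n)%N.
Proof.
by move=> sT c0; have [x hx] := bpoly_neq0 m sT c0; apply: card_zeros_grid (ispol_bpoly c) hx.
Qed.
End Box.
End Polynomials.

(** * Choosing polynomials by weighted averages *)

Section GreedySelection.
Variables (R : realType) (I X : Type) (idx : seq I) (ag : X -> I -> bool).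

(** [X] will be a type of functions, without decidable equality, which excludes [all] and membership
    in sequences. *)
Fixpoint allProp (P : X -> Prop) (L : seq X) : Prop :=
  if L is f :: L' then P f /\ allProp P L' else True.

Lemma allProp_cat P L1 L2 : allProp P L1 -> allProp P L2 -> allProp P (L1 ++ L2).
Proof. by elim: L1 => //= f L1 IH [Pf h1] h2; split => //; exact: IH. Qed.

(** Here [ag f i] says that [f] fails to separate the pair [i]. Quantifying over all weights makes
    choices composable, since every choice changes the weights for the next ones. *)
Definition reduces (ok : X -> Prop) (lam : I -> R) := forall wt : I -> R,
  (forall i, 0 <= wt i) -> exists2 f, ok f &
  \sum_(i <- idx) wt i * (ag f i)%:R <= \sum_(i <- idx) wt i * lam i.

Definition reduces_seq (ok : X -> Prop) (m : nat) (lam : I -> R) := forall wt : I -> R,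
  (forall i, 0 <= wt i) -> exists L, [/\ size L = m, allProp ok L &
  \sum_(i <- idx) wt i * (all (ag^~ i) L)%:R <= \sum_(i <- idx) wt i * lam i].

(** The method of conditional expectations: [f] is chosen for weights that already contain the
    expected gain [lam ^+ m] of the later choices, which are then made for the weights restricted to
    the pairs left by [f]. *)
Lemma reduces_iter ok lam m : (forall i, 0 <= lam i) -> reduces ok lam ->
  reduces_seq ok m (fun i => lam i ^+ m).
Proof.
move=> lam0 h; elim: m => [|m IH] wt wt0.
  by exists [::]; split => //=; under eq_bigr => i _ do rewrite mulr1.
have [|f okf hf] := h (fun i => wt i * lam i ^+ m).
  by move=> i; rewrite mulr_ge0 ?exprn_ge0.
have [|L [sL okL hL]] := IH (fun i => wt i * (ag f i)%:R).
  by move=> i; rewrite mulr_ge0.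
exists (f :: L); split => //=; first by rewrite sL.
have -> : \sum_(i <- idx) wt i * (ag f i && all (ag^~ i) L)%:R =
          \sum_(i <- idx) wt i * (ag f i)%:R * (all (ag^~ i) L)%:R.
  by apply: eq_bigr => i _; rewrite -mulrA -natrM mulnb.
apply: le_trans hL _.
have -> : \sum_(i <- idx) wt i * (ag f i)%:R * lam i ^+ m =
          \sum_(i <- idx) wt i * lam i ^+ m * (ag f i)%:R.
  by apply: eq_bigr => i _; rewrite mulrAC.
by apply: le_trans hf _; rewrite le_eqVlt; apply/orP; left; apply/eqP;
   apply: eq_bigr => i _; rewrite exprSr mulrA.
Qed.

Lemma reduces_levels (J : nat) (ok : nat -> X -> Prop) (m : nat -> nat) (lam : nat -> I -> R) :
  (forall j i, 0 <= lam j i) -> (forall j, reduces (ok j) (lam j)) ->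
  forall wt : I -> R, (forall i, 0 <= wt i) -> exists Ls : seq (seq X),
   [/\ size Ls = J,
       forall j, (j < J)%N -> size (nth [::] Ls j) = m j /\ allProp (ok j) (nth [::] Ls j) &
  \sum_(i <- idx) wt i * (all (all (ag^~ i)) Ls)%:R
    <= \sum_(i <- idx) wt i * \prod_(j < J) lam j i ^+ m j].
Proof.
move=> lam0 h; elim: J => [|J IH] wt wt0.
  by exists [::]; split => //=; under [leRHS]eq_bigr => i _ do rewrite big_ord0.
have [|L [sL okL hL]] := reduces_iter (m J) (lam0 J) (h J) (wt := fun i => wt i * \prod_(j < J) lam j i ^+ m j).
  by move=> i; rewrite mulr_ge0 // prodr_ge0 // => j _; rewrite exprn_ge0.
have [|Ls [sLs hLs h2]] := IH (fun i => wt i * (all (ag^~ i) L)%:R).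
  by move=> i; rewrite mulr_ge0.
exists (rcons Ls L); split => //=; first by rewrite size_rcons sLs.
  move=> j; rewrite ltnS nth_rcons sLs leq_eqVlt => /orP[/eqP->|jJ].
    by rewrite ltnn eqxx.
  by rewrite jJ; exact: hLs.
have -> : \sum_(i <- idx) wt i * (all (all (ag^~ i)) (rcons Ls L))%:R =
          \sum_(i <- idx) wt i * (all (ag^~ i) L)%:R * (all (all (ag^~ i)) Ls)%:R.
  by apply: eq_bigr => i _; rewrite all_rcons -mulrA -natrM mulnb.
apply: le_trans h2 _.
have -> : \sum_(i <- idx) wt i * (all (ag^~ i) L)%:R * \prod_(j < J) lam j i ^+ m j =
  \sum_(i <- idx) wt i * (\prod_(j < J) lam j i ^+ m j) * (all (ag^~ i) L)%:R.
  by apply: eq_bigr => i _; rewrite mulrAC.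
by apply: le_trans hL _; rewrite le_eqVlt; apply/orP; left; apply/eqP;
   apply: eq_bigr => i _; rewrite big_ord_recr /= mulrA.
Qed.
End GreedySelection.

(** * Random polynomials separating pairs of grid points *)

Section OneStep.
Variables (R : realType) (n : nat).

Definition gidx T (QQ : seq (cube_index n)) : seq (cube_index n * (grid n T * grid n T)) :=
  [seq (Q, p) | Q <- QQ, p <- enum {: grid n T * grid n T}].

Definition agr T (f : 'rV[R]_n -> R) (i : cube_index n * (grid n T * grid n T)) : bool :=
  (0 < f (gpt R i.1 i.2.1)) == (0 < f (gpt R i.1 i.2.2)).

(** The bound on the zeros will make [F] nonzero, hence larger than the level [b], at most points of
    the grid. *)
Definition okpol T k (f : 'rV[R]_n -> R) := ispol k f /\ forall Q,
  (#|[set x : grid n T | f (gpt R Q x) == 0%R]| * T <= n * k * T ^ n)%N.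

Definition rowseq D (u : 'rV[R]_D) : seq R := [seq u ord0 j | j <- enum 'I_D].

Lemma ldotE (l a : seq R) : size l = size a ->
  ldot l a = \sum_(i < size a) nth 0 l i * nth 0 a i.
Proof.
elim: l a => [|x l IH] [|y a] //= h; first by rewrite big_ord0.
by move: h => [h]; rewrite big_ord_recl /= IH.
Qed.

Lemma size_rowseq D (u : 'rV[R]_D) : size (rowseq u) = D.
Proof. by rewrite size_map size_enum_ord. Qed.

Lemma nth_rowseq D (u : 'rV[R]_D) (j : 'I_D) : nth 0 (rowseq u) j = u ord0 j.
Proof. by rewrite (nth_map j) ?size_enum_ord // nth_ord_enum. Qed.

Lemma ldot_row D (l : seq R) (u : 'rV[R]_D) : size l = D ->
  ldot l (rowseq u) = \sum_(j < D) nth 0 l j * u ord0 j.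
Proof.
move=> sl; rewrite ldotE ?size_rowseq //.
by apply: eq_bigr => j _; rewrite nth_rowseq.
Qed.

Lemma ldot_rdot D (u v : 'rV[R]_D) : ldot (rowseq u) (rowseq v) = rdot u v.
Proof. by rewrite ldot_row ?size_rowseq //; apply: eq_bigr => j _; rewrite nth_rowseq. Qed.

Lemma lexp_sign_row D (u v : 'rV[R]_D) : u != 0 -> v != 0 ->
  rdot u v ^+ 2 <= 1000^-1 * (rdot u u * rdot v v) ->
  lexp D (fun l => ((0 < ldot l (rowseq u)) == (0 < ldot l (rowseq v)))%:R) <= 1 - 500^-1.
Proof.
move=> u0 v0 huv; have u1 := rdot_gt0 u0; have v1 := rdot_gt0 v0.
pose a := (Num.sqrt (rdot u u))^-1; pose b := (Num.sqrt (rdot v v))^-1.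
have a0 : 0 < a by rewrite invr_gt0 sqrtr_gt0.
have b0 : 0 < b by rewrite invr_gt0 sqrtr_gt0.
have a2 : a ^+ 2 * rdot u u = 1 by rewrite exprVn sqr_sqrtr ?ltW // mulVf ?gt_eqF.
have b2 : b ^+ 2 * rdot v v = 1 by rewrite exprVn sqr_sqrtr ?ltW // mulVf ?gt_eqF.
have sgnE c (w : 'rV[R]_D) l : 0 < c -> size l = D ->
    (0 < ldot l (rowseq (c *: w))) = (0 < ldot l (rowseq w)).
  move=> c0 sl; rewrite !ldot_row //.
  have -> : \sum_(j < D) nth 0 l j * (c *: w) ord0 j = c * \sum_(j < D) nth 0 l j * w ord0 j.
    by rewrite mulr_sumr; apply: eq_bigr => j _; rewrite mxE mulrCA.
  by rewrite pmulr_rgt0.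
apply: (@le_trans _ _ (lexp D (fun l => ((0 < ldot l (rowseq (a *: u))) ==
    (0 < ldot l (rowseq (b *: v))))%:R))).
  by apply: lexp_le => l sl; rewrite !sgnE.
rewrite -[D in lexp D](size_rowseq (a *: u)); apply: lexp_sign; rewrite ?size_rowseq //.
- by rewrite ldot_rdot rdotZl rdotC rdotZl mulrA -expr2.
- by rewrite ldot_rdot rdotZl rdotC rdotZl mulrA -expr2.
rewrite ldot_rdot rdotZl rdotC rdotZl rdotC mulrA exprMn exprMn.
apply: le_trans (ler_wpM2l _ huv) _; first by rewrite mulr_ge0 ?sqr_ge0.
by rewrite mulrCA mulrACA a2 b2 !mulr1.
Qed.

Lemma bvec_neq0 s x : (0 < s)%N -> bvec s x != 0 :> 'rV[R]_#|{: box n s}|.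
Proof.
move=> s0; apply/negP => /eqP /rowP /(_ (enum_rank [ffun=> Ordinal s0])) /eqP.
rewrite !mxE enum_rankK /bmon big1 ?oner_eq0 // => i _.
by rewrite ffunE expr0.
Qed.
End OneStep.

Section OneStepMain.
Variables (R : realType) (n : nat).

Definition seplam T (sep : pred (cube_index n * (grid n T * grid n T)))
  (i : cube_index n * (grid n T * grid n T)) : R := if sep i then 1 - 500^-1 else 1.

Lemma card_grid T : #|{: grid n T}| = (T ^ n)%N.
Proof. by rewrite card_ffun !card_ord. Qed.

(* Up to a few exceptional points, evaluation functionals can be brought in isotropic
   position; a random polynomial then takes values of opposite sign at most pairs. *)
Lemma isotropic_evaluations s T (QQ : seq (cube_index n)) (r : cube_index n -> nat) :
  (0 < s)%N ->
  exists (U : 'M[R]_#|{: box n s}|) (c : 'cV[R]_#|{: box n s}|),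
  [/\ U \in unitmx, c != 0 &
      forall p, \sum_(Q <- QQ) \sum_(x : grid n T) (r Q)%:R *
        (if bpoly c (gpt R Q x) == 0 then 0 else
           rdot p (bvec s (gpt R Q x) *m U) ^+ 2 /
           rdot (bvec s (gpt R Q x) *m U) (bvec s (gpt R Q x) *m U))
      <= 4 * ((\sum_(Q <- QQ) r Q)%:R * T%:R ^+ n / s%:R ^+ n) * rdot p p].
Proof.
move=> s0; set D := #|{: box n s}|.
have D0 : (0 < D)%N by rewrite /D card_box expn_gt0 s0.
have DE : D%:R = s%:R ^+ n :> R by rewrite /D card_box natrX.
(* Each evaluation is repeated [r Q] times, which makes the final bound on a cube inversely
   proportional to its weight. *)
pose vs : seq 'rV[R]_D := flatten [seq flatten [seq nseq (r Q) (bvec s (gpt R Q x)) |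
  x <- enum {: grid n T}] | Q <- QQ].
have sumvs (phi : 'rV[R]_D -> R) : \sum_(v <- vs) phi v =
    \sum_(Q <- QQ) \sum_(x : grid n T) (r Q)%:R * phi (bvec s (gpt R Q x)).
  rewrite big_flatten big_map; apply: eq_bigr => Q _.
  rewrite big_flatten big_map big_enum; apply: eq_bigr => x _.
  by rewrite big_nseq -Monoid.iteropE mulr_natl.
have [bs [rest [ubs pvs [c c0 hc]]]] := greedy_bases vs D0.
have [U uU hU] := isotropic_position ubs.
have sumbs (phi : 'rV[R]_D -> R) : \sum_(v <- vs) phi v =
    \sum_(B <- bs) \sum_(i < D) phi (row i B) + \sum_(v <- rest) phi v.
  rewrite (perm_big _ pvs) big_cat big_flatten big_map /=; congr (_ + _).
  by apply: eq_bigr => B _; rewrite big_map big_enum.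
have szbs : (size bs)%:R <= (\sum_(Q <- QQ) r Q)%:R * T%:R ^+ n / s%:R ^+ n :> R.
  rewrite -DE ler_pdivlMr ?ltr0n //.
  have := sumbs (fun=> 1); rewrite sumvs.
  have -> : \sum_(Q <- QQ) \sum_(x : grid n T) (r Q)%:R * 1 =
     (\sum_(Q <- QQ) r Q)%:R * T%:R ^+ n :> R.
    rewrite natr_sum mulr_suml; apply: eq_bigr => Q _.
    by rewrite mulr1 sumr_const card_grid -[LHS]mulr_natr natrX.
  move=> ->; rewrite (_ : \sum_(B <- bs) _ = (size bs)%:R * D%:R) ?lerDl ?sumr_ge0 //.
  rewrite -natrM -sum1_size big_distrl /= natr_sum; apply: eq_bigr => B _.
  by rewrite sumr_const card_ord mul1n.
exists U, c; split => // p.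
pose q (v : 'rV[R]_D) := rdot p (v *m U) ^+ 2 / rdot (v *m U) (v *m U).
have q0 v : 0 <= q v by rewrite mulr_ge0 ?sqr_ge0 // invr_ge0 rdot_ge0.
(* The zeros of [c] are discarded; they include all vectors left over by the extraction of bases. *)
pose phi (v : 'rV[R]_D) := if (v *m c) ord0 ord0 == 0 then 0 else q v.
rewrite -(sumvs phi) sumbs [X in _ + X]big_seq [X in _ + X]big1 ?addr0; last first.
  by move=> v /hc vc; rewrite /phi vc mxE eqxx.
apply: (@le_trans _ _ (\sum_(B <- bs) \sum_(i < D) q (row i B))).
  by apply: ler_sum => B _; apply: ler_sum => i _; rewrite /phi; case: ifP.
by apply: le_trans (hU p) _; rewrite ler_wpM2r ?rdot_ge0 // ler_wpM2l.
Qed.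

(** A pair is usable when neither point is a zero of [c] and the transformed evaluations are nearly
    orthogonal. For fixed [x], isotropy tested on the vector of [x] itself bounds the number of
    correlated [y] by Markov's inequality, with the constant [4000 = 4 * 1000]. *)
Lemma random_step s T (QQ : seq (cube_index n)) (r : cube_index n -> nat) :
  (0 < s)%N -> (s <= T)%N ->
  exists sep : pred (cube_index n * (grid n T * grid n T)),
  (forall Q, Q \in QQ -> (0 < r Q)%N -> uniq QQ ->
    (r Q)%:R * #|[set p | ~~ sep (Q, p)]|%:R <=
    4000 * ((\sum_(Q <- QQ) r Q)%:R * T%:R ^+ n / s%:R ^+ n) * T%:R ^+ n
    + (r Q)%:R * (2 * (n * (n * s.-1))%:R * (T%:R ^+ n * T%:R ^+ n) / T%:R) :> R) /\
  reduces (gidx T QQ) (@agr R n T) (okpol T (n * s.-1)) (seplam sep).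
Proof.
move=> s0 sT; have [U [c [uU c0 hU]]] := isotropic_evaluations T QQ r s0.
have T0 : (0 < T)%N by exact: leq_trans sT.
set D := #|{: box n s}| in U c uU c0 hU *.
pose psi Q (x : grid n T) := bvec s (gpt R Q x) *m U.
have psi0 Q x : psi Q x != 0.
  apply: contra (bvec_neq0 (gpt R Q x) s0) => /eqP h.
  by rewrite -(mulmxK uU (bvec _ _)) -/(psi Q x) h mul0mx.
pose far Q x y := rdot (psi Q x) (psi Q y) ^+ 2 <=
   1000^-1 * (rdot (psi Q x) (psi Q x) * rdot (psi Q y) (psi Q y)).
pose E Q := [set x : grid n T | bpoly c (gpt R Q x) == 0].
pose sep (i : cube_index n * (grid n T * grid n T)) :=
  [&& i.2.1 \notin E i.1, i.2.2 \notin E i.1 & far i.1 i.2.1 i.2.2].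
exists sep; split.
  move=> Q QQQ r0 uQ.
  set ST := (\sum_(Q <- QQ) r Q)%:R * _ / _ in hU *.
  pose nf x := [set y | (y \notin E Q) && ~~ far Q x y].
  have hnf x : (r Q)%:R * #|nf x|%:R <= 4000 * ST :> R.
    have px := rdot_gt0 (psi0 Q x).
    have := hU (psi Q x); rewrite (bigD1_seq Q) //=.
    set A := \sum_(x0 : grid n T) _; set B := \sum_(i <- _ | _) _ => hAB.
    have B0 : 0 <= B.
      apply: sumr_ge0 => i _; apply: sumr_ge0 => y _; apply: mulr_ge0 => //.
      by case: ifP => // _; rewrite mulr_ge0 ?sqr_ge0 // invr_ge0 rdot_ge0.
    have : (r Q)%:R * #|nf x|%:R * (1000^-1 * rdot (psi Q x) (psi Q x)) <= A.
      rewrite -mulrA /A -mulr_sumr ler_wpM2l // -sum1_card natr_sum mulr_suml big_mkcond /=.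
      apply: ler_sum => y _; rewrite /nf !inE /far -ltNge.
      case: ifP => [/andP[/negbTE -> h]|_]; last first.
        by case: ifP => // _; rewrite mulr_ge0 ?sqr_ge0 // invr_ge0 rdot_ge0.
      by rewrite mul1r ler_pdivlMr ?rdot_gt0 ?psi0 // -mulrA ltW.
    move=> h; rewrite -(ler_pM2r px).
    move: h hAB; set a := (r Q)%:R * _; set b := rdot _ _; nra.
  have hE : #|E Q|%:R <= (n * (n * s.-1))%:R * T%:R ^+ n / T%:R :> R.
    rewrite ler_pdivlMr ?ltr0n // -natrX -!natrM ler_nat.
    exact: card_bpoly_zeros.
  have hcard : (#|[set p | ~~ sep (Q, p)]| <= 2 * (#|E Q| * T ^ n) + \sum_x #|nf x|)%N.
    apply: (@leq_trans (\sum_(x : grid n T) \sum_(y : grid n T)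
       ((x \in E Q) + (y \in E Q) + (y \in nf x)))%N).
      rewrite pair_big -sum1_card [leqLHS]big_mkcond; apply: leq_sum => -[x y] _.
      rewrite !inE /sep /= negb_and negb_and !inE.
      by do 2!case: (_ == 0) => //=; case: (far _ _ _).
    have inE1 (A : {set grid n T}) : (\sum_(y : grid n T) (y \in A) = #|A|)%N.
      by rewrite -sum1_card [RHS]big_mkcond.
    have sumE x : (\sum_(y : grid n T) ((x \in E Q) + (y \in E Q) + (y \in nf x)) =
        (x \in E Q) * T ^ n + #|E Q| + #|nf x|)%N.
      by rewrite big_split /= big_split /= sum_nat_const card_grid mulnC !inE1.
    rewrite [leqLHS](eq_bigr _ (fun x _ => sumE x)) big_split /= big_split /=.
    by rewrite sum_nat_const card_grid -big_distrl /= inE1 mul2n -addnn [(T ^ n * _)%N]mulnC.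
  apply: (@le_trans _ _ ((r Q)%:R * (2 * (#|E Q| * T ^ n) + \sum_x #|nf x|)%:R)).
    by rewrite ler_wpM2l // ler_nat.
  rewrite natrD mulrDr addrC lerD //.
    rewrite natr_sum mulr_sumr; apply: (@le_trans _ _ (\sum_(x : grid n T) 4000 * ST)).
      by apply: ler_sum.
    by rewrite sumr_const card_grid -[leLHS]mulr_natr natrX.
  apply: ler_wpM2l => //.
  have := ler_wpM2r (exprn_ge0 n (ler0n R T)) hE.
  rewrite (natrM _ 2) (natrM _ #|_|) natrX.
  by move: (#|E Q|%:R) ((n * _)%:R) (T%:R ^+ n) (T%:R^-1) => a b t ti; lra.
move=> wt wt0.
pose cof l : 'cV[R]_D := U *m (\col_j nth 0 l j).
have bpE l x : size l = D -> bpoly (cof l) x = ldot l (rowseq (bvec s x *m U)).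
  move=> sl; rewrite ldot_row // /bpoly /cof mulmxA mxE.
  by apply: eq_bigr => j _; rewrite [X in _ * X]mxE mulrC.
have [|l sl hl] := @lexp_exists R D (fun l => \sum_(i <- gidx T QQ) wt i *
   (agr (bpoly (cof l)) i)%:R) (\sum_(i <- gidx T QQ) wt i * seplam sep i).
  rewrite lexp_sum; apply: ler_sum => -[Q [x y]] _; rewrite lexpZ ler_wpM2l //.
  apply: (@le_trans _ _ (lexp D (fun l => ((0 < ldot l (rowseq (psi Q x))) ==
       (0 < ldot l (rowseq (psi Q y))))%:R))).
    by apply: lexp_le => l sl; rewrite /agr /= !bpE.
  rewrite /seplam; case: ifP => [/and3P[_ _ h]|_].
    exact: (lexp_sign_row (psi0 Q x) (psi0 Q y) h).
  by rewrite -[leRHS](lexp_cst D); apply: lexp_le => l _; rewrite lern1 leq_b1.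
(* The zero polynomial violates the bound on zeros; the constant 1, which likewise separates no
   pair, replaces it. *)
exists (if cof l == 0 then fun=> 1 else bpoly (cof l)).
  case: eqP => [_|/eqP cl0]; last first.
    by split; [exact: ispol_bpoly | move=> Q; exact: card_bpoly_zeros].
  split; first exact: ispol_cst.
  by move=> Q; rewrite (_ : [set _ | _] = finset.set0) ?cards0 //; apply/setP => x; rewrite !inE oner_eq0.
apply: le_trans hl; apply: ler_sum => i _; rewrite ler_wpM2l // /agr.
case: ifP => [/eqP ->|//]; rewrite !ltr01 eqxx.
by rewrite /bpoly !mulmx0 !mxE ltxx eqxx.
Qed.
End OneStepMain.

(** * Combining the scales of degree *)

Section Levels.
Variables (R : realType) (n : nat).

(** If [j] is the first level at which [h] fails, the preceding level already contributes the factor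
    [G j]; if there is none, the last level contributes [G J]. *)
Lemma prod_levels_le (J : nat) (h : nat -> bool) (G : nat -> R) :
  G 0%N = 1 -> (forall j, 0 <= G j <= 1) ->
  \prod_(j < J) (if h j then G j.+1 else 1) <= \sum_(j < J) (~~ h j)%:R * G j + G J.
Proof.
move=> G0 G1; elim: J => [|J IH]; first by rewrite !big_ord0 G0 add0r.
have Gg j : 0 <= G j by case/andP: (G1 j).
have P01 : 0 <= \prod_(j < J) (if h j then G j.+1 else 1) <= 1.
  elim/big_rec: _ => [|j y _ /andP[y0 y1]]; first by rewrite ler01 lexx.
  have := G1 j.+1; case: ifP => _ /andP[g0 g1]; last by rewrite mul1r y0 y1.
  by rewrite mulr_ge0 //= mulr_ile1.
have S0 : 0 <= \sum_(j < J) (~~ h j)%:R * G j by apply: sumr_ge0 => j _; rewrite mulr_ge0.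
rewrite !big_ord_recr /=; case/andP: P01 => p0 p1; case: (h J) => /=.
  rewrite mul0r addr0; apply: (@le_trans _ _ (G J.+1)); last by rewrite lerDr.
  by rewrite ler_piMl.
by rewrite mulr1 mul1r; apply: le_trans IH _; rewrite lerDl.
Qed.

Lemma sum_half (J : nat) : \sum_(j < J) (2^-1 : R) ^+ j <= 2.
Proof.
suff -> : \sum_(j < J) (2^-1 : R) ^+ j = 2 - 2 * 2^-1 ^+ J.
  by rewrite lerBlDr lerDl mulr_ge0 // exprn_ge0 // invr_ge0.
elim: J => [|J IH]; first by rewrite big_ord0 expr0; lra.
by rewrite big_ord_recr /= IH exprS; lra.
Qed.

Lemma sum_half_lin (J : nat) : \sum_(j < J) j.+1%:R * (2^-1 : R) ^+ j <= 4.
Proof.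
suff -> : \sum_(j < J) j.+1%:R * (2^-1 : R) ^+ j = 4 - 2 * (J%:R + 2) * 2^-1 ^+ J.
  by rewrite lerBlDr lerDl !mulr_ge0 ?addr_ge0 // exprn_ge0 // invr_ge0.
elim: J => [|J IH]; first by rewrite big_ord0 expr0; lra.
by rewrite big_ord_recr /= IH exprS -natr1; field.
Qed.

Definition agrL T (L : seq (nat * ('rV[R]_n -> R))) (Q : cube_index n) : {set grid n T * grid n T} :=
  [set p | all (fun kf => agr kf.2 (Q, p)) L].

Definition okpair T (kf : nat * ('rV[R]_n -> R)) := okpol T kf.1 kf.2.

Lemma root_size (S : nat) : (0 < n)%N -> (0 < S)%N -> exists s : nat,
  [/\ (0 < s)%N, (S <= s ^ n)%N, (s <= S)%N & s%:R <= 2 * S%:R `^ (n%:R)^-1 :> R].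
Proof.
move=> n0 S0; have exS : exists s, (S <= s ^ n)%N.
  by exists S; rewrite -{1}(expn1 S) leq_pexp2l.
case: (ex_minnP exS) => s hs smin.
have s0 : (0 < s)%N by case: s hs {smin}; rewrite ?exp0n // leqNgt S0.
exists s; split => //; first by apply: smin; rewrite -{1}(expn1 S) leq_pexp2l.
have S1 : 1 <= S%:R `^ (n%:R)^-1 :> R.
  apply: (@le_trans _ _ (1 `^ (n%:R)^-1)); first by rewrite powR1.
  by rewrite ge0_ler_powR ?nnegrE ?invr_ge0 ?ler1n.
suff : s.-1%:R <= S%:R `^ (n%:R)^-1 :> R by rewrite -{2}(prednK s0) -natr1; lra.
have -> : s.-1%:R = ((s.-1%:R : R) ^+ n) `^ (n%:R)^-1.
  rewrite -powR_mulrn // -powRrM mulfV ?powRr1 //.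
  by rewrite pnatr_eq0 -lt0n.
rewrite ge0_ler_powR ?nnegrE ?invr_ge0 ?exprn_ge0 // -natrX ler_nat ltnW // ltnNge.
by apply/negP => /smin; rewrite leqNgt prednK // leqnn.
Qed.

Lemma lam_small : exists mu : nat, (1 - 500^-1 : R) ^+ mu <= 4^-1.
Proof.
have q01 : `|1 - 500^-1 : R| < 1 by rewrite ger0_norm; lra.
have := cvg_expr q01 => /(@cvgr_dist_lt _ R^o) /(_ 4^-1) [|N _ hN]; first by lra.
by exists N; have := hN N (leqnn N); rewrite /= sub0r normrN => /(le_lt_trans (ler_norm _)) /ltW.
Qed.

(** Markov's inequality turns a bound on the sum over all cubes into one for each cube outside a set
    of at most half of the weight. The lower bound on [T] makes the pairs with an exceptional point
    negligible even against weights as large as the total. *)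
Lemma one_stage : (0 < n)%N -> exists C1 K2 : R, [/\ 0 < C1, 0 < K2 &
  forall (QQ : seq (cube_index n)) (r : cube_index n -> nat) T,
  uniq QQ -> (forall Q, Q \in QQ -> 0 < r Q)%N ->
  (0 < \sum_(Q <- QQ) r Q)%N ->
  (2 * n * n * (\sum_(Q <- QQ) r Q) * (\sum_(Q <- QQ) r Q) <= T)%N ->
  exists L : seq (nat * ('rV[R]_n -> R)),
  [/\ allProp (okpair T) L,
      (\sum_(kf <- L) kf.1)%:R <= C1 * (\sum_(Q <- QQ) r Q)%:R `^ (n%:R)^-1 &
      2 * (\sum_(Q <- QQ | K2 * T%:R ^+ n * T%:R ^+ n < (r Q)%:R * #|agrL T L Q|%:R :> R) r Q)%:R
       <= (\sum_(Q <- QQ) r Q)%:R :> R]].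
Proof.
move=> n0; have [mu hmu] := lam_small.
have lam_ge0 : 0 <= 1 - 500^-1 :> R by lra.
(* 4000 for the correlated pairs and 1 for the pairs with an exceptional point. In [K1], the series
   over the levels gives the 2 and the pairs usable at every level give the 1. *)
have [K hK] : exists K : R, K = 4001 by exists 4001.
have K0 : 0 < K by rewrite hK ltr0n.
pose K1 := 2 * K + 1; pose K2 := 2 * K1.
have K10 : 0 < K1 by rewrite /K1; lra.
exists (8 * (mu * n * n).+1%:R), K2; split; [by rewrite mulr_gt0 | by rewrite mulr_gt0 |].
move=> QQ r T uQ r0; set S := (\sum_(Q <- QQ) r Q)%N => S0 hT.
have [s [s0 Ss sS s2]] := root_size n0 S0.
have rS Q : Q \in QQ -> (r Q <= S)%N.
  by move=> QQQ; rewrite /S (bigD1_seq Q) //= leq_addr.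
have ST : (S <= T)%N by apply: leq_trans hT; rewrite leq_pmull // !muln_gt0 n0 S0.
have T0 : (0 < T)%N by exact: leq_trans ST.
(* The degree in each variable is [s.-1 %/ 2 ^ j], which vanishes at deep levels: these cost nothing
   in the total degree. *)
pose sj j := (s.-1 %/ 2 ^ j).+1.
have sjs j : (sj j <= s)%N by rewrite /sj -{2}(prednK s0) ltnS leq_div.
have sjS j : (sj j <= S)%N by exact: leq_trans (sjs j) sS.
have sjT j : (sj j <= T)%N by exact: leq_trans (sjS j) ST.
have sj2 j : (S <= (sj j * 2 ^ j) ^ n)%N.
  apply: leq_trans Ss _; rewrite leq_exp2r // -{1}(prednK s0) /sj.
  by rewrite ltn_ceil // expn_gt0.
have /choice[sep hsep] : forall j, exists sepj : pred (cube_index n * (grid n T * grid n T)),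
    (forall Q, Q \in QQ ->
    (r Q)%:R * #|[set p | ~~ sepj (Q, p)]|%:R <= K * 2 ^+ (j * n) * (T%:R ^+ n * T%:R ^+ n) :> R) /\
    reduces (gidx T QQ) (@agr R n T) (okpol T (n * (sj j).-1)) (seplam R sepj).
  move=> j.
  have [sepj [h1 h2]] := random_step R QQ r (ltn0Sn _ : 0 < sj j)%N (sjT j).
  exists sepj; split => // Q QQQ; apply: le_trans (h1 Q QQQ (r0 _ QQQ) uQ) _.
  have t0 : 0 <= (T%:R ^+ n * T%:R ^+ n : R) by rewrite mulr_ge0 ?exprn_ge0.
  have hA : S%:R / (sj j)%:R ^+ n <= 2 ^+ (j * n) :> R.
    rewrite ler_pdivrMr ?exprn_gt0 ?ltr0n // -!natrX -natrM ler_nat.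
    by apply: leq_trans (sj2 j) _; rewrite expnMn mulnC expnM.
  have hB : (r Q)%:R * (2 * (n * (n * (sj j).-1))%:R / T%:R) <= 1 :> R.
    rewrite !mulrA ler_pdivrMr ?ltr0n // mul1r -!natrM ler_nat.
    apply: leq_trans hT; have -> : (r Q * 2 * (n * (n * (sj j).-1)) =
        2 * n * n * ((sj j).-1 * r Q))%N by ring.
    rewrite -[leqRHS]mulnA leq_mul2l; apply/orP; right; apply: leq_mul; last exact: rS.
    by apply: leq_trans (sjS j); exact: leq_pred.
  have h1j : 1 <= (2 : R) ^+ (j * n) by rewrite exprn_ege1 // ler1n.
  have -> : 4000 * (S%:R * T%:R ^+ n / (sj j)%:R ^+ n) * T%:R ^+ n =
     4000 * (S%:R / (sj j)%:R ^+ n) * (T%:R ^+ n * T%:R ^+ n) :> R by ring.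
  have -> : (r Q)%:R * (2 * (n * (n * (sj j).-1))%:R * (T%:R ^+ n * T%:R ^+ n) / T%:R) =
     ((r Q)%:R * (2 * (n * (n * (sj j).-1))%:R / T%:R)) * (T%:R ^+ n * T%:R ^+ n) :> R by ring.
  rewrite -mulrDl ler_wpM2r //; move: hA hB h1j; rewrite hK.
  move: (S%:R / _) (_ * (_ / _)) (2 ^+ _) => a b c; lra.
(* At level [j], the [m j] choices leave a fraction [4 ^ - (n (j + 1))] of the usable pairs on
   average. The number of levels only has to satisfy [S <= 4 ^ (n J)]. *)
clear hK; pose m j := (mu * n * j.+1)%N; pose J := s.
pose lam j := seplam R (sep j).
have lam0 j i : 0 <= lam j i by rewrite /lam /seplam; case: ifP => _; lra.
(* Weights are squared: on a bad cube one factor [r Q] times the number of pairs exceeds the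
   threshold, and the other factor remains as its weight. *)
have [|Ls [sLs hLs hsum]] := reduces_levels J m lam0 (fun j => (hsep j).2)
   (wt := fun i => (r i.1)%:R ^+ 2); first by move=> i; rewrite exprn_ge0.
pose L := flatten [seq [seq ((n * (sj j).-1)%N, f) | f <- nth [::] Ls j] | j <- iota 0 J].
have LsE : Ls = [seq nth [::] Ls j | j <- iota 0 J] by rewrite -/(mkseq _ _) -sLs mkseq_nth.
have agE i : all (fun kf => agr kf.2 i) L = all (all (fun f => agr f i)) Ls.
  rewrite [in RHS]LsE /L; elim: (iota 0 J) => //= j js IH.
  by rewrite all_cat IH all_map.
exists L; split.
- rewrite /L; have : all (fun j => j < J)%N (iota 0 J) by apply/allP => j; rewrite mem_iota.
  elim: (iota 0 J) => //= j js IH /andP[jJ hjs]; apply: allProp_cat; last exact: IH.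
  by have [_] := hLs j jJ; elim: (nth [::] Ls j) => //= f l IHl [okf okl]; split => //; exact: IHl.
- rewrite big_flatten big_map.
  have -> : iota 0 J = index_iota 0 J by rewrite /index_iota subn0.
  rewrite big_mkord.
  apply: (@le_trans _ _ (4 * (mu * n * n)%:R * s%:R)); last first.
    have : (mu * n * n)%:R * s%:R <= (mu * n * n).+1%:R * (2 * S%:R `^ (n%:R)^-1) :> R.
      by apply: ler_pM => //; rewrite ler_nat.
    move=> h; rewrite -[leLHS]mulrA; move: h.
    by move: (_ * s%:R) ((mu * n * n).+1%:R) (_ `^ _) => a b c; lra.
  rewrite natr_sum; apply: (@le_trans _ _ (\sum_(j < J) (mu * n * n)%:R * s%:R *
      (j.+1%:R * (2^-1 : R) ^+ j))); last first.
    rewrite -mulr_sumr; have := sum_half_lin J.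
    have : 0 <= (mu * n * n)%:R * s%:R :> R by rewrite mulr_ge0.
    move=> h1 h2; rewrite -[leRHS]mulrA; move: h1 h2.
    by move: (_ * s%:R) (\sum_(_ < _) _) => a b; nra.
  apply: ler_sum => j _; have [sz _] := hLs j (ltn_ord j).
  rewrite big_map big_const_seq count_predT iter_addn_0 sz /m /=.
  have hj : (s.-1 %/ 2 ^ j)%:R <= s%:R * (2^-1) ^+ j :> R.
    rewrite exprVn ler_pdivlMr ?exprn_gt0 // -natrX -natrM ler_nat.
    by apply: leq_trans (leq_divM _ _) _; exact: leq_pred.
  have -> : (n * (s.-1 %/ 2 ^ j) * (mu * n * j.+1))%:R =
     ((mu * n * n)%:R * j.+1%:R) * (s.-1 %/ 2 ^ j)%:R :> R by rewrite -!natrM; congr _%:R; ring.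
  have -> : (mu * n * n)%:R * s%:R * (j.+1%:R * 2^-1 ^+ j) =
     ((mu * n * n)%:R * j.+1%:R) * (s%:R * 2^-1 ^+ j) :> R by ring.
  by rewrite ler_wpM2l // mulr_ge0.
have T2 : 0 < (T%:R ^+ n * T%:R ^+ n : R) by rewrite mulr_gt0 ?exprn_gt0 ?ltr0n.
pose G j : R := (4^-1) ^+ (n * j).
have G0 : G 0%N = 1 by rewrite /G muln0 expr0.
have G1 j : 0 <= G j <= 1 by rewrite /G exprn_ge0 ?exprn_ile1 //; lra.
have GJ : S%:R * G J <= 1.
  rewrite /G exprVn ler_pdivrMr ?exprn_gt0 // mul1r -natrX ler_nat.
  apply: leq_trans Ss _; rewrite mulnC expnM leq_exp2r //.
  by apply: ltnW; apply: leq_trans (ltn_expl s (isT : 1 < 2)%N) _; rewrite leq_exp2r.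
have key Q : Q \in QQ ->
    (r Q)%:R * \sum_(p : grid n T * grid n T) \prod_(j < J) lam j (Q, p) ^+ m j
    <= K1 * (T%:R ^+ n * T%:R ^+ n).
  move=> QQQ.
  apply: (@le_trans _ _ ((r Q)%:R * \sum_(p : grid n T * grid n T)
     (\sum_(j < J) (~~ sep j (Q, p))%:R * G j + G J))).
    rewrite ler_wpM2l //; apply: ler_sum => p _.
    apply: le_trans (prod_levels_le J (fun j => sep j (Q, p)) G0 G1).
    apply: ler_prod => j _; rewrite exprn_ge0 //= /lam /seplam /G; case: ifP => _.
      by rewrite /m -mulnA exprM; apply: lerXn2r; rewrite ?nnegrE ?exprn_ge0.
    by rewrite expr1n.
  rewrite big_split /= exchange_big /= mulrDr mulr_sumr.
  have -> : K1 * (T%:R ^+ n * T%:R ^+ n) =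
     K * (T%:R ^+ n * T%:R ^+ n) * 2 + (T%:R ^+ n * T%:R ^+ n) :> R by rewrite /K1; ring.
  apply: lerD; last first.
    rewrite sumr_const card_prod !card_grid -[X in _ * X]mulr_natr natrM !natrX mulrA.
    apply: ler_piMl; first exact: ltW.
    apply: (le_trans _ GJ); rewrite ler_wpM2r ?ler_nat ?rS //.
    by case/andP: (G1 J).
  apply: (@le_trans _ _ (\sum_(j < J) K * (T%:R ^+ n * T%:R ^+ n) * 2^-1 ^+ j)); last first.
    rewrite -mulr_sumr; apply: ler_wpM2l; last exact: sum_half.
    by apply: mulr_ge0; exact: ltW.
  apply: ler_sum => j _; rewrite -mulr_suml.
  have -> : \sum_(p : grid n T * grid n T) (~~ sep j (Q, p))%:R =
     #|[set p | ~~ sep j (Q, p)]|%:R :> R.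
    rewrite -sum1_card natr_sum [RHS]big_mkcond; apply: eq_bigr => p _.
    by rewrite inE; case: (sep _ _).
  rewrite mulrA; have Gj : 0 <= G j by case/andP: (G1 j).
  apply: le_trans (ler_wpM2r Gj ((hsep j).1 Q QQQ)) _.
  have -> : K * 2 ^+ (j * n) * (T%:R ^+ n * T%:R ^+ n) * G j =
    K * (T%:R ^+ n * T%:R ^+ n) * (2 ^+ (j * n) * G j) by ring.
  apply: ler_wpM2l; first by apply: mulr_ge0; exact: ltW.
  have -> : 2 ^+ (j * n) * G j = (2^-1 ^+ n) ^+ j.
    by rewrite /G mulnC -exprMn -exprM; congr (_ ^+ _); field.
  rewrite lerXn2r ?nnegrE ?exprn_ge0 ?invr_ge0 //.
  rewrite -[leRHS]expr1 ler_wiXn2l ?invr_ge0 //; lra.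
pose bad Q := K2 * T%:R ^+ n * T%:R ^+ n < (r Q)%:R * #|agrL T L Q|%:R :> R.
change (2 * (\sum_(Q <- QQ | bad Q) r Q)%:R <= S%:R :> R).
have agrE Q : #|agrL T L Q|%:R = \sum_(p : grid n T * grid n T)
    (all (all (fun f => agr f (Q, p))) Ls)%:R :> R.
  rewrite -sum1_card natr_sum big_mkcond; apply: eq_bigr => p _.
  by rewrite inE agE; case: (all _ _).
have hS : \sum_(Q <- QQ) (r Q)%:R ^+ 2 * #|agrL T L Q|%:R <=
    K1 * (T%:R ^+ n * T%:R ^+ n) * S%:R :> R.
  move: hsum; rewrite /gidx !big_allpairs /= => hsum.
  apply: le_trans (le_trans hsum _).
    by apply: ler_sum => Q _; rewrite agrE mulr_sumr big_enum.
  rewrite /S natr_sum mulr_sumr [leLHS]big_seq [leRHS]big_seq; apply: ler_sum => Q QQQ.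
  rewrite big_enum /= -mulr_sumr expr2 -mulrA mulrC ler_wpM2r //.
  exact: key.
have hbad : \sum_(Q <- QQ | bad Q) K2 * (T%:R ^+ n * T%:R ^+ n) * (r Q)%:R <=
    \sum_(Q <- QQ) (r Q)%:R ^+ 2 * #|agrL T L Q|%:R :> R.
  rewrite big_mkcond; apply: ler_sum => Q _; case: ifP => [|_]; last first.
    by rewrite mulr_ge0 ?exprn_ge0.
  rewrite /bad => /ltW h; rewrite expr2 -[leRHS]mulrA [leLHS]mulrC [X in _ * X <= _]mulrA.
  by apply: ler_wpM2l.
move: (le_trans hbad hS); rewrite -mulr_sumr -natr_sum.
have c0 : 0 < K1 * (T%:R ^+ n * T%:R ^+ n) :> R by exact: mulr_gt0.
have -> : K2 * (T%:R ^+ n * T%:R ^+ n) = K1 * (T%:R ^+ n * T%:R ^+ n) * 2 :> R by rewrite /K2; ring.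
by rewrite -[leLHS]mulrA ler_pM2l.
Qed.

Lemma agrL_cat T L1 L2 Q : agrL T (L1 ++ L2) Q = agrL T L1 Q :&: agrL T L2 Q.
Proof. by apply/setP => p; rewrite !inE all_cat. Qed.

(** The stage is repeated on the bad cubes, whose weight is at most halved each time, so the degrees
    are bounded by a geometric series of ratio [2 ^ (-1 / n)]. The condition on [T] is inherited by
    subfamilies, and appending polynomials only shrinks [agrL]. *)
Lemma visible_list : (0 < n)%N -> exists C K2 : R, [/\ 0 < C, 0 < K2 &
  forall (QQ : seq (cube_index n)) (r : cube_index n -> nat) T,
  uniq QQ -> (forall Q, Q \in QQ -> 0 < r Q)%N ->
  (2 * n * n * (\sum_(Q <- QQ) r Q) * (\sum_(Q <- QQ) r Q) <= T)%N ->
  exists L : seq (nat * ('rV[R]_n -> R)),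
  [/\ allProp (okpair T) L,
      (\sum_(kf <- L) kf.1)%:R <= C * (\sum_(Q <- QQ) r Q)%:R `^ (n%:R)^-1 &
      forall Q, Q \in QQ -> (r Q)%:R * #|agrL T L Q|%:R <= K2 * T%:R ^+ n * T%:R ^+ n :> R]].
Proof.
move=> n0; have [C1 [K2 [C10 K20 hC1]]] := one_stage n0.
pose rho : R := 2^-1 `^ (n%:R)^-1.
have ni0 : 0 < (n%:R : R)^-1 by rewrite invr_gt0 ltr0n.
have rho0 : 0 <= rho by exact: powR_ge0.
have rho1 : rho < 1.
  have <- : 1 `^ (n%:R)^-1 = 1 :> R by rewrite powR1.
  by rewrite gt0_ltr_powR // ?nnegrE; lra.
exists (C1 / (1 - rho)), K2; split; [by rewrite divr_gt0 // subr_gt0 | by [] |].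
move=> QQ r T; move: {2}(\sum_(Q <- QQ) r Q)%N (leqnn (\sum_(Q <- QQ) r Q)) => B.
elim: B QQ => [|B IH] QQ hB uQ r0 hT.
all: have [S0|S0] := posnP (\sum_(Q <- QQ) r Q)%N.
- exists [::]; split => //; first by rewrite big_nil mulr_ge0 ?powR_ge0 // ltW // divr_gt0 // subr_gt0.
  move=> Q QQQ; have := r0 Q QQQ; move: S0 => /eqP.
  by rewrite (bigD1_seq Q) //= addn_eq0 => /andP[/eqP ->].
- by move: hB; rewrite leqNgt S0.
- exists [::]; split => //; first by rewrite big_nil mulr_ge0 ?powR_ge0 // ltW // divr_gt0 // subr_gt0.
  move=> Q QQQ; have := r0 Q QQQ; move: S0 => /eqP.
  by rewrite (bigD1_seq Q) //= addn_eq0 => /andP[/eqP ->].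
have [L1 [ok1 deg1 hbad]] := hC1 QQ r T uQ r0 S0 hT.
set S := (\sum_(Q <- QQ) r Q)%N in hB hT S0 deg1 hbad *.
pose bad Q := K2 * T%:R ^+ n * T%:R ^+ n < (r Q)%:R * #|agrL T L1 Q|%:R :> R.
pose QB := [seq Q <- QQ | bad Q].
have SB : 2 * (\sum_(Q <- QB) r Q)%:R <= S%:R :> R by rewrite /QB big_filter.
have SB' : (2 * \sum_(Q <- QB) r Q <= S)%N by rewrite -(ler_nat R) natrM.
have [||||L2 [ok2 deg2 h2]] := IH QB.
- by move: SB' hB S0; rewrite -/S; lia.
- exact: filter_uniq.
- by move=> Q; rewrite mem_filter => /andP[_ /r0].
- apply: leq_trans hT; move: SB'; set a := (\sum_(Q <- QB) r Q)%N => SB'.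
  have aS : (a <= S)%N by lia.
  by rewrite leq_mul // leq_mul.
exists (L1 ++ L2); split; first exact: allProp_cat.
- rewrite big_cat natrD; apply: le_trans (lerD deg1 deg2) _.
  have hr : (\sum_(Q <- QB) r Q)%:R `^ (n%:R)^-1 <= rho * S%:R `^ (n%:R)^-1 :> R.
    rewrite -powRM ?invr_ge0 // ge0_ler_powR ?nnegrE ?mulr_ge0 ?invr_ge0 //; lra.
  have k0 : 0 <= C1 / (1 - rho) by rewrite ltW // divr_gt0 // subr_gt0.
  apply: le_trans (lerD (lexx _) (ler_wpM2l k0 hr)) _.
  rewrite le_eqVlt; apply/orP; left; apply/eqP; field.
  by rewrite subr_eq0 gt_eqF.
move=> Q QQQ; case bQ : (bad Q).
  apply: le_trans (h2 Q _); last by rewrite mem_filter bQ.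
  by rewrite ler_wpM2l // ler_nat agrL_cat subset_leq_card // finset.subsetIr.
move: bQ; rewrite /bad => /negbT; rewrite -leNgt; apply: le_trans.
by rewrite ler_wpM2l // ler_nat agrL_cat subset_leq_card // finset.subsetIl.
Qed.
End Levels.

(** * Refined grids, rounding and translations *)

Section Refinement.
Variables (R : realType) (n T T' : nat).
Hypotheses (T0 : (0 < T)%N) (T'0 : (0 < T')%N).
Let N := (T * T')%N.
Let N0 : (0 < N)%N. Proof. by rewrite muln_gt0 T0. Qed.

Fact flP (t : 'I_N) : (t %/ T' < T)%N. Proof. by rewrite ltn_divLR. Qed.
Fact ceP (t : 'I_T) : (t * T' < N)%N. Proof. by rewrite ltn_pmul2r. Qed.
(* [fl] rounds a point of the fine grid down to the coarse grid, [ce] embeds the latter. *)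
Definition fl (z : grid n N) : grid n T := [ffun l => Ordinal (flP (z l))].
Definition ce (x : grid n T) : grid n N := [ffun l => Ordinal (ceP (x l))].
Let md (z : grid n N) : grid n T' := [ffun l => Ordinal (ltn_pmod (z l) T'0)].

Lemma gpt_ce (m : cube_index n) x : gpt R m (ce x) = gpt R m x.
Proof.
apply/rowP => l; rewrite !mxE !ffunE /=; congr (_ + _); rewrite /N !natrM.
have := T0; have := T'0; rewrite -!(ltr0n R) => h1 h2.
by field; rewrite !gt_eqF.
Qed.

Let flmd_inj : injective (fun z => (fl z, md z)).
Proof.
move=> z z' [/ffunP e1 /ffunP e2]; apply/ffunP => l; apply: val_inj => /=.
have /(congr1 val) /= := e1 l; have /(congr1 val) /= := e2 l; rewrite !ffunE /= => h1 h2.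
by rewrite (divn_eq (z l) T') (divn_eq (z' l) T') h1 h2.
Qed.

Lemma card_fl (A : {set grid n T}) : (#|[set z | fl z \in A]| <= #|A| * T' ^ n)%N.
Proof.
have <- : #|finset.setX A [set: grid n T']| = (#|A| * T' ^ n)%N.
  by rewrite cardsX cardsT card_ffun !card_ord.
rewrite -(card_imset _ flmd_inj); apply: subset_leq_card; apply/fintype.subsetP => _ /imsetP[z + ->].
by rewrite !inE => ->.
Qed.

Lemma card_fl_pair (A : {set grid n T * grid n T}) :
  (#|[set zy : grid n N * grid n N | (fl zy.1, fl zy.2) \in A]| <= #|A| * (T' ^ n * T' ^ n))%N.
Proof.
pose g (zy : grid n N * grid n N) := ((fl zy.1, fl zy.2), (md zy.1, md zy.2)).
have ginj : injective g.
  by move=> [z y] [z' y'] [h1 h2 h3 h4]; congr (_, _); apply: flmd_inj; congr (_, _).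
have <- : #|finset.setX A [set: grid n T' * grid n T']| = (#|A| * (T' ^ n * T' ^ n))%N.
  by rewrite cardsX cardsT card_prod card_ffun !card_ord.
rewrite -(card_imset _ ginj); apply: subset_leq_card; apply/fintype.subsetP => _ /imsetP[z + ->].
by rewrite !inE => ->.
Qed.

Fact fl1P (t : 'I_N) : (t %/ T' * T' < N)%N.
Proof. by apply: leq_ltn_trans (ltn_ord t); exact: leq_divM. Qed.
Let fl1 (t : 'I_N) : 'I_N := Ordinal (fl1P t).

(* A block of length [T'] in which the sign is not constant contains a root. *)
Lemma line_sign_changes (r : {poly R}) k : (size r <= k.+1)%N ->
  (#|[set t : 'I_N | ((0 < r.[t%:R]) != (0 < r.[(fl1 t)%:R]))%R]| <= k * T')%N.
Proof.
move=> sr; set B := [set t | _].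
have [->|/set0Pn[t0 t0B]] := eqVneq B finset.set0; first by rewrite cards0.
have r0 : r != 0.
  by apply/negP => /eqP r0; move: t0B; rewrite inE r0 !horner0 eqxx.
have rt (t : 'I_N) : t \in B -> exists2 x, (t %/ T' * T')%:R <= x <= t%:R & root r x.
  have le1 : (t %/ T' * T')%:R <= t%:R :> R by rewrite ler_nat leq_divM.
  rewrite inE /=; case: ltP => h1; case: ltP => h2 // _.
    have [|x hx rx] := @poly_ivt _ r _ _ le1; last by exists x.
    by rewrite h2 ltW.
  have [|x hx rx] := @poly_ivt _ (- r) _ _ le1; last by exists x; rewrite // rootN in rx.
  by rewrite !hornerN oppr_le0 oppr_ge0 h1 ltW.
pose bl := [set Ordinal (flP t) | t in B].
have /choice[g hg] : forall b : 'I_T, exists x, b \in bl -> (b * T')%:R <= x < (b.+1 * T')%:R /\ root r x.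
  move=> b; case bb: (b \in bl); last by exists 0.
  have /imsetP[t tB ->] := bb; have [x /andP[x1 x2] rx] := rt t tB; exists x => _; split => //=.
  by rewrite x1 (le_lt_trans x2) // ltr_nat -ltn_divLR.
have ginj : {in bl &, injective g}.
  move=> b b' bb bb' e; have [/andP[h1 h2] _] := hg b bb; have [/andP[h1' h2'] _] := hg b' bb'.
  apply: val_inj; apply/eqP; rewrite eqn_leq.
  have := le_lt_trans h1 (eq_ind_r (fun x => x < _) h2' e).
  have := le_lt_trans h1' (eq_ind (g b) (fun x => x < _) h2 _ e).
  by rewrite !ltr_nat !ltn_pmul2r // !ltnS => -> ->.
have blk : (#|bl| <= k)%N.
  rewrite -ltnS; apply: leq_trans sr.
  have -> : #|bl| = size [seq g b | b <- enum bl] by rewrite size_map cardE.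
  apply: max_poly_roots => //.
    by apply/allP => x /mapP[b + ->]; rewrite mem_enum => bb; case: (hg b bb).
  rewrite map_inj_in_uniq ?enum_uniq // => b b' hb hb'; apply: ginj; by rewrite -mem_enum.
apply: leq_trans (leq_mul blk (leqnn T')).
pose h (t : 'I_N) := (Ordinal (flP t), Ordinal (ltn_pmod t T'0)).
have hinj : injective h.
  move=> t t' [h1 h2]; apply: val_inj => /=.
  by rewrite (divn_eq t T') (divn_eq t' T') h1 h2.
have <- : #|finset.setX bl [set: 'I_T']| = (#|bl| * T')%N by rewrite cardsX cardsT card_ord.
rewrite -(card_imset _ hinj); apply: subset_leq_card; apply/fintype.subsetP => _ /imsetP[t tB ->].
by rewrite finset.in_setX finset.in_setT andbT; apply: imset_f.
Qed.

(** The path counting is applied to [z] and its rounding. The resulting proportion depends on [T]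
    only, which leaves [T'] free for later estimates; the two directions of sign change account for
    the factor 2. *)
Lemma card_sign_changes (m : cube_index n) k (f : 'rV[R]_n -> R) : ispol k f ->
  (#|[set z : grid n N | ((0 < f (gpt R m z)) != (0 < f (gpt R m (fl z))))%R]| * T <= 2 * n * k * N ^ n)%N.
Proof.
move=> pf; pose P z := 0 < f (gpt R m (z : grid n N)).
have main (P' : pred (grid n N)) : (forall z z', P' z && ~~ P' z' -> P z != P z') ->
    (#|[set z | P' z && ~~ P' (ce (fl z))]| * T <= n * k * N ^ n)%N.
  move=> hP; rewrite -(leq_pmul2r T'0) -mulnA -/N.
  apply: leq_trans (_ : n * (k * T') * N ^ n <= _)%N; last by rewrite mulnA -!mulnA [(T' * _)%N]mulnC.
  apply: card_path_change => l x.
  set x1 := mix l.+1 x (ce (fl x)).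
  have [r sr hr] := gpt_upd_line m x1 l pf.
  apply: leq_trans (line_sign_changes sr); apply: subset_leq_card; apply/fintype.subsetP => t.
  rewrite !inE => /hP; rewrite /P.
  have cu i : i != l -> ce (fl (upd x l t)) i = ce (fl x) i.
    by move=> il; apply: val_inj; rewrite !ffunE /= ?ffunE /= ?ffunE (negbTE il).
  have uu i : i != l -> upd x l t i = x i by move=> il; rewrite ffunE (negbTE il).
  have -> : mix l.+1 (upd x l t) (ce (fl (upd x l t))) = upd x1 l t.
    apply/ffunP => i; rewrite [LHS]ffunE [RHS]ffunE; case: (eqVneq i l) => [->|il].
      by rewrite ltnSn ffunE eqxx.
    by rewrite cu // uu // /x1 [RHS]ffunE.
  have -> : mix l (upd x l t) (ce (fl (upd x l t))) = upd x1 l (fl1 t).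
    apply/ffunP => i; rewrite [LHS]ffunE [RHS]ffunE; case: (eqVneq i l) => [->|il].
      by rewrite ltnn; apply: val_inj; rewrite !ffunE /= ?ffunE /= ?ffunE eqxx.
    rewrite cu // uu // /x1 [RHS]ffunE ltnS [in RHS]leq_eqVlt.
    by have -> : (i == l :> nat) = false by apply/eqP => /val_inj /eqP; rewrite (negbTE il).
  by rewrite !hr.
have eP z : (0 < f (gpt R m (fl z))) = P (ce (fl z)) by rewrite /P gpt_ce.
set B := [set z | _].
have sub : B \subset [set z | P z && ~~ P (ce (fl z))] :|: [set z | ~~ P z && ~~ ~~ P (ce (fl z))].
  apply/fintype.subsetP => z; rewrite !inE eP -/(P z).
  by case: (P z); case: (P _).
apply: leq_trans (leq_mul (subset_leq_card sub) (leqnn T)) _.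
apply: leq_trans (leq_mul (leq_card_setU _ _) (leqnn T)) _.
have h1 := main P (fun z z' => ltac:(by case: (P z); case: (P z'))).
have h2 := main (predC P) (fun z z' => ltac:(by rewrite /=; case: (P z); case: (P z'))).
by rewrite mulnDl; apply: leq_trans (leq_add h1 h2) _; rewrite -!mulnA mul2n addnn.
Qed.

Lemma card_has_sum (I : finType) (X : Type) (L : seq (nat * X)) (P : X -> pred I) (c d : nat) :
  allProp (fun kf => #|[set z | P kf.2 z]| * c <= kf.1 * d)%N L ->
  (#|[set z | has (fun kf => P kf.2 z) L]| * c <= (\sum_(kf <- L) kf.1) * d)%N.
Proof.
elim: L => [|kf L IH] /=; first by rewrite (_ : [set z | false] = finset.set0) ?cards0 //; apply/setP => z; rewrite !inE.
move=> [h1 /IH h2]; rewrite big_cons mulnDl.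
apply: leq_trans (leq_add h1 h2); rewrite -mulnDl leq_mul2r; apply/orP; right.
apply: leq_trans (leq_card_setU _ _); apply: subset_leq_card; apply/fintype.subsetP => z.
by rewrite !inE.
Qed.

Lemma allProp_impl (X : Type) (P Q : X -> Prop) L : (forall x, P x -> Q x) -> allProp P L -> allProp Q L.
Proof. by move=> h; elim: L => //= x L IH [/h Px /IH]. Qed.

Lemma card_list_changes (m : cube_index n) (L : seq (nat * ('rV[R]_n -> R))) : allProp (okpair T) L ->
  (#|[set z : grid n N | has (fun kf => (0 < kf.2 (gpt R m z))%R != (0 < kf.2 (gpt R m (fl z)))%R) L]| * T
     <= 2 * n * (\sum_(kf <- L) kf.1) * N ^ n)%N.
Proof.
move=> ok; have -> : (2 * n * (\sum_(kf <- L) kf.1) * N ^ n = (\sum_(kf <- L) kf.1) * (2 * n * N ^ n))%N by ring.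
apply: (@card_has_sum _ _ L (fun f z => (0 < f (gpt R m z)) != (0 < f (gpt R m (fl z))))).
apply: allProp_impl ok => -[k f] [/= pf _]; apply: leq_trans (card_sign_changes m pf) _.
by rewrite leq_eqVlt; apply/orP; left; apply/eqP; ring.
Qed.

Lemma card_list_zeros (m : cube_index n) (L : seq (nat * ('rV[R]_n -> R))) : allProp (okpair T) L ->
  (#|[set z : grid n N | has (fun kf => kf.2 (gpt R m (fl z)) == 0%R) L]| * T
     <= n * (\sum_(kf <- L) kf.1) * N ^ n)%N.
Proof.
move=> ok; pose A := [set x : grid n T | has (fun kf => kf.2 (gpt R m x) == 0%R) L].
have hA : (#|A| * T <= (\sum_(kf <- L) kf.1) * (n * T ^ n))%N.
  apply: (@card_has_sum _ _ L (fun f x => f (gpt R m x) == 0%R)).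
  apply: allProp_impl ok => -[k f] [/= _ /(_ m)] h; apply: leq_trans h _.
  by rewrite leq_eqVlt; apply/orP; left; apply/eqP; ring.
have -> : [set z : grid n N | has (fun kf => kf.2 (gpt R m (fl z)) == 0%R) L] = [set z | fl z \in A].
  by apply/setP => z; rewrite !inE.
apply: leq_trans (leq_mul (card_fl A) (leqnn T)) _.
rewrite mulnAC /N expnMn; apply: leq_trans (leq_mul hA (leqnn _)) _.
by rewrite leq_eqVlt; apply/orP; left; apply/eqP; ring.
Qed.

(* Translation by [v - N / 2], modulo [N] so that it is a bijection of the grid. *)
Definition sh (v z : grid n N) : grid n N :=
  [ffun l => Ordinal (ltn_pmod (z l + v l + N./2) N0)].

Let modcancel a b c : (a < N)%N -> (b < N)%N -> (c + a = c + b %[mod N])%N -> a = b.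
Proof. by move=> aN bN /eqP; rewrite eqn_modDl !modn_small // => /eqP. Qed.

Lemma sh_inj v : injective (sh v).
Proof.
move=> z z' /ffunP e; apply/ffunP => l; have /(congr1 val) := e l; rewrite !ffunE /=.
rewrite -!addnA ![(_ + (v l + _))%N]addnC => /modcancel h; apply: val_inj; exact: h.
Qed.

Lemma shl_inj z : injective (fun v => sh v z).
Proof.
move=> v v' /ffunP e; apply/ffunP => l; have /(congr1 val) := e l; rewrite !ffunE /=.
rewrite ![(z l + _)%N]addnC -!addnA ![(_ + (z l + _))%N]addnC => /modcancel h; apply: val_inj; exact: h.
Qed.

(** The central index stands for the zero vector, so that short vectors of either sign have indices
    far from the ends of the range. *)
Definition wv (v : grid n N) : 'rV[R]_n := \row_l ((v l)%:R / N%:R - 2^-1).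

Lemma gpt_sh (m : cube_index n) (v z : grid n N) : ~~ odd N -> (forall l, (N./2 <= z l + v l < N + N./2)%N) ->
  gpt R m (sh v z) = gpt R m z + wv v.
Proof.
move=> oN h; apply/rowP => l; rewrite !mxE !ffunE /=; have /andP[h1 h2] := h l.
have N2 : (N = N./2 + N./2)%N by rewrite -[LHS]odd_double_half (negbTE oN) add0n addnn.
have -> : ((z l + v l + N./2) %% N = z l + v l - N./2)%N.
  have -> : (z l + v l + N./2 = (z l + v l - N./2) + N)%N by move: N2 h1 h2; lia.
  by rewrite modnDr modn_small //; move: h1 h2; lia.
rewrite natrB // natrD.
have e : N%:R = (N./2)%:R + (N./2)%:R :> R by rewrite -natrD -N2.
have N0' : 0 < N%:R :> R by rewrite ltr0n.
have -> : (N./2)%:R = N%:R / 2 :> R by rewrite e; field.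
by field; rewrite gt_eqF.
Qed.
End Refinement.

Import numFieldNormedType.Exports.
Local Open Scope classical_set_scope.
Local Open Scope ring_scope.
Local Notation gnorm := Defs.gnorm.

(** * Hausdorff measure by coverings *)

Section Hausdorff.
Variables (R : realType) (T : Type) (d : T -> T -> R).
Hypothesis d_ge0 : forall x y, 0 <= d x y.
Implicit Types (A U : set T) (s : nat).

Lemma omega_gt0 m : 0 < omega R m.
Proof.
have [k] := ubnP m; elim: k m => // k IH [|[|m]] mk //=.
by rewrite mulr_gt0 ?divr_gt0 ?mulr_gt0 ?pi_gt0 ?IH //; lia.
Qed.

Lemma diam_le U b : (forall x y, U x -> U y -> d x y <= b) -> (diam d U <= b%:E)%E.
Proof. by move=> h; apply: ge_ereal_sup => _ [[x y] [/= Ux Uy] <-]; rewrite lee_fin h. Qed.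

Lemma diam_fine U delta x y : (diam d U <= delta%:E)%E -> U x -> U y ->
  d x y <= fine (diam d U).
Proof.
move=> h Ux Uy; have h1 : ((d x y)%:E <= diam d U)%E.
  by apply: ereal_sup_ubound; exists (x, y).
by move: h h1; case: (diam d U) => //= r _; rewrite lee_fin.
Qed.

Lemma fine_diam_ge0 U : U !=set0 -> 0 <= fine (diam d U).
Proof.
move=> [x Ux]; have h1 : ((d x x)%:E <= diam d U)%E.
  by apply: ereal_sup_ubound; exists (x, x).
by move: h1 (d_ge0 x x); case: (diam d U) => //= r; rewrite lee_fin => h1 h2; exact: le_trans h1.
Qed.

Lemma hterm_ge0 s U : (0 <= hterm d s U)%E.
Proof.
rewrite /hterm; case: ifPn => // /set0P U0.
by rewrite lee_fin mulr_ge0 ?(ltW (omega_gt0 _)) // exprn_ge0 // divr_ge0 // fine_diam_ge0.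
Qed.

Lemma hterm_le s U b : 0 <= b -> (forall x y, U x -> U y -> d x y <= b) ->
  (hterm d s U <= (omega R s * (b / 2) ^+ s)%:E)%E.
Proof.
move=> b0 h; rewrite /hterm; case: ifPn => [_|/set0P U0].
  by rewrite lee_fin mulr_ge0 ?(ltW (omega_gt0 _)) // exprn_ge0 // divr_ge0.
rewrite lee_fin ler_pM2l ?omega_gt0 // lerXn2r ?nnegrE ?divr_ge0 ?fine_diam_ge0 //.
rewrite ler_pM2r ?invr_gt0 //.
have := diam_le h; have := fine_diam_ge0 U0.
by case: (diam d U) => //=.
Qed.

Lemma haus_ge0 s A : (0 <= haus d s A)%E.
Proof.
apply: (@le_trans _ _ (haus_delta d s 1 A)).
  apply: le_ereal_inf_tmp => _ [F _ <-]; apply: nneseries_ge0 => i _ _; exact: hterm_ge0.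
by apply: ereal_sup_ubound; exists 1 => //=.
Qed.

Lemma le_haus s A B : A `<=` B -> (haus d s A <= haus d s B)%E.
Proof.
move=> AB; apply: ge_ereal_sup => _ [delta d0 <-].
apply: (@le_trans _ _ (haus_delta d s delta B)); last by apply: ereal_sup_ubound; exists delta.
apply: le_ereal_inf_tmp => _ [F [BF hF] <-]; apply: ereal_inf_lbound; exists F => //.
by split => //; exact: subset_trans BF.
Qed.

(** A finite cover becomes a sequence by adding empty sets, whose [hterm] is 0 by convention even in
    dimension 0. *)
Lemma haus_le_cover s A (V : R) :
  (forall delta, 0 < delta -> exists (J : finType) (F : J -> set T) (b : R),
     [/\ 0 <= b <= delta, A `<=` [set x | exists j, F j x],
         forall j x y, F j x -> F j y -> d x y <= b &
         omega R s * (b / 2) ^+ s * #|J|%:R <= V]) ->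
  (haus d s A <= V%:E)%E.
Proof.
move=> h; apply: ge_ereal_sup => _ [delta d0 <-].
have [J [F [b [/andP[b0 bd] AF hF hV]]]] := h delta d0.
pose F' i := if @idP (i < #|J|)%N is ReflectT H then F (enum_val (Ordinal H)) else set0.
have F'0 i : (#|J| <= i)%N -> F' i = set0.
  by rewrite /F'; case: {-}_ / idP => // ? ?; exfalso; lia.
have hF' i x y : F' i x -> F' i y -> d x y <= b.
  by rewrite /F'; case: {-}_ / idP => // ?; exact: hF.
apply: (@le_trans _ _ (\sum_(0 <= i <oo) hterm d s (F' i))%E).
  apply: ereal_inf_lbound; exists F' => //; split.
    move=> x /AF [j Fj]; exists (enum_rank j) => //; rewrite /F'.
    case: {-}_ / idP => [H|/negP]; last by rewrite ltn_ord.
    by rewrite (_ : Ordinal H = enum_rank j) ?enum_rankK //; apply: val_inj.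
  by move=> i; apply: (@le_trans _ _ b%:E); rewrite ?lee_fin //; apply: diam_le; exact: hF'.
apply: lime_le.
  by apply: is_cvg_nneseries => i _ _; exact: hterm_ge0.
apply: nearW => N.
apply: (@le_trans _ _ (\sum_(0 <= i < N | (i < #|J|)%N) (omega R s * (b / 2) ^+ s)%:E)%E).
  rewrite [leRHS]big_mkcond /=; apply: lee_sum => i _; case: ifPn => iJ.
    by apply: hterm_le => // x y; exact: hF'.
  by rewrite F'0 1?leqNgt // /hterm eqxx.
apply: (@le_trans _ _ (omega R s * (b / 2) ^+ s * #|J|%:R)%:E); last by rewrite lee_fin.
rewrite sumEFin lee_fin big_const_seq iter_addr_0 -[leLHS]mulr_natr ler_wpM2l //.
  by rewrite mulr_ge0 ?(ltW (omega_gt0 _)) // exprn_ge0 // divr_ge0.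
rewrite ler_nat -size_filter.
have -> : #|J| = size (iota 0 #|J|) by rewrite size_iota.
apply: uniq_leq_size; first by rewrite filter_uniq // iota_uniq.
by move=> i; rewrite mem_filter !mem_iota size_iota => /andP[iJ _].
Qed.

Lemma haus_ge_cover s A (c : \bar R) delta : 0 < delta ->
  (forall F : nat -> set T, A `<=` \bigcup_i F i -> (forall i, (diam d (F i) <= delta%:E)%E) ->
    (c <= \sum_(0 <= i <oo) hterm d s (F i))%E) -> (c <= haus d s A)%E.
Proof.
move=> d0 h; apply: (@le_trans _ _ (haus_delta d s delta A)).
  by apply: le_ereal_inf_tmp => _ [F [AF hF] <-]; exact: h.
by apply: ereal_sup_ubound; exists delta.
Qed.

Lemma haus_cover_exists s A delta (eta : R) : 0 < delta -> 0 < eta -> (haus d s A < +oo)%E ->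
  exists2 F : nat -> set T, A `<=` \bigcup_i F i /\ (forall i, (diam d (F i) <= delta%:E)%E) &
   (\sum_(0 <= i <oo) hterm d s (F i) <= haus d s A + eta%:E)%E.
Proof.
move=> d0 e0 hA.
have h1 : (haus_delta d s delta A <= haus d s A)%E by apply: ereal_sup_ubound; exists delta.
have h0 : (0 <= haus_delta d s delta A)%E.
  apply: le_ereal_inf_tmp => _ [F _ <-]; apply: nneseries_ge0 => i _ _; exact: hterm_ge0.
have hfin : haus_delta d s delta A \is a fin_num.
  by rewrite ge0_fin_numE //; exact: le_lt_trans hA.
have [_ [F hF <-] h] := lb_ereal_inf_adherent e0 hfin.
by exists F => //; apply: le_trans (ltW h) _; rewrite leeD2r.
Qed.
End Hausdorff.

Lemma modn_close u v w : u = v %[mod w] -> (u < v + w)%N -> (v < u + w)%N -> u = v.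
Proof.
wlog uv : u v / (u <= v)%N => [h|] em h1 h2.
  by have [/h|/ltnW/h] := leqP u v; [exact | move=> e; apply/esym/e].
have : (w %| v - u)%N by rewrite -eqn_mod_dvd // em.
have [->|vu] := eqVneq u v; first by [].
by rewrite gtnNdvd //; lia.
Qed.

(** * Volume bounds from boxes and coverings *)

Section Content.
Variables (R : realType) (n : nat).

Lemma edot_ge0 (x : 'rV[R]_n) : 0 <= edot x x.
Proof. by apply: sumr_ge0 => i _; rewrite -expr2 sqr_ge0. Qed.

Lemma eucl_dist_ge0 (x y : 'rV[R]_n) : 0 <= Defs.edist x y. Proof. exact: sqrtr_ge0. Qed.

Lemma coord_le_enorm (x : 'rV[R]_n) l : `|x ord0 l| <= enorm x.
Proof.
rewrite -sqrtr_sqr ler_wsqrtr // /edot (bigD1 l) //= expr2 lerDl.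
by apply: sumr_ge0 => i _; rewrite -expr2 sqr_ge0.
Qed.

Lemma enorm_le_coord (x : 'rV[R]_n) b : 0 <= b -> (forall l, `|x ord0 l| <= b) ->
  enorm x <= n%:R * b.
Proof.
move=> b0 h; have nb : 0 <= n%:R * b by rewrite mulr_ge0.
rewrite -[leRHS](ger0_norm nb) -sqrtr_sqr ler_wsqrtr //.
apply: (@le_trans _ _ (\sum_(i < n) b ^+ 2)).
  by apply: ler_sum => i _; rewrite -expr2 -real_normK ?num_real // lerXn2r ?nnegrE.
rewrite sumr_const card_ord exprMn -[leLHS]mulr_natl ler_wpM2r ?sqr_ge0 //.
by rewrite -natrX ler_nat; case: (n) => // k; rewrite -{1}(expn1 k.+1) leq_pexp2l.
Qed.

(** Subdividing each box makes the cover admissible for every [delta]. Bounding the Euclidean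
    diameter by [n] times the side gives the factor [(n / 2) ^+ n]. *)
Lemma vol_le_boxes (I : finType) (Z : {set I}) (c : I -> 'rV[R]_n) (h : R) (A : set 'rV[R]_n) :
  0 < h ->
  (forall x, A x -> exists2 i, i \in Z & forall l, c i ord0 l <= x ord0 l < c i ord0 l + h) ->
  (vol A <= (omega R n * (n%:R / 2) ^+ n * (#|Z|%:R * h ^+ n))%:E)%E.
Proof.
move=> h0 hA; apply: haus_le_cover => [x y|delta d0]; first exact: eucl_dist_ge0.
pose M := (Num.truncn (n%:R * h / delta)).+1.
have M0 : 0 < M%:R :> R by rewrite ltr0n.
have hM : n%:R * h / M%:R <= delta.
  have := truncnS_gt (n%:R * h / delta); rewrite ltr_pdivrMr // -/M => /ltW hh.
  by rewrite ler_pdivrMr // [leRHS]mulrC.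
exists ({i : I | i \in Z} * grid n M)%type.
exists (fun p : {i : I | i \in Z} * grid n M => [set x : 'rV[R]_n | forall l, c (val p.1) ord0 l + h * (p.2 l)%:R / M%:R <= x ord0 l
   < c (val p.1) ord0 l + h * (p.2 l).+1%:R / M%:R]).
exists (n%:R * h / M%:R); split.
- by rewrite hM andbT divr_ge0 ?mulr_ge0 ?(ltW h0).
- move=> x /hA [i iZ hi].
  have hl l : exists j : 'I_M, c i ord0 l + h * j%:R / M%:R <= x ord0 l
      < c i ord0 l + h * j.+1%:R / M%:R.
    pose t := (x ord0 l - c i ord0 l) / h * M%:R.
    have t0 : 0 <= t.
      by rewrite mulr_ge0 ?divr_ge0 ?subr_ge0 ?(ltW h0) //; case/andP: (hi l).
    have tM : t < M%:R.
      rewrite /t gtr_pMl // ltr_pdivrMr // mul1r ltrBlDl; by case/andP: (hi l).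
    have jM : (Num.truncn t < M)%N by rewrite truncn_lt_nat.
    exists (Ordinal jM) => /=.
    have := truncn_itv t0 => /andP[t1 t2].
    have xE : x ord0 l = c i ord0 l + h * t / M%:R by rewrite /t; field; rewrite !gt_eqF.
    rewrite {1 2}xE lerD2l ltrD2l ler_pM2r ?invr_gt0 // ltr_pM2r ?invr_gt0 //.
    by rewrite ler_pM2l // ltr_pM2l // t1 t2.
  have [j hj] := choice hl.
  by exists (Sub i iZ, [ffun l => j l]) => l /=; rewrite ffunE.
- move=> p x y hx hy; rewrite /Defs.edist -mulrA; apply: enorm_le_coord.
    by rewrite divr_ge0 ?(ltW h0).
  move=> l; rewrite !mxE ler_norml.
  have /andP[x1 x2] := hx l; have /andP[y1 y2] := hy l.
  have e : h * (p.2 l).+1%:R / M%:R = h * (p.2 l)%:R / M%:R + h / M%:R.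
    by rewrite -natr1; ring.
  by move: x1 x2 y1 y2; rewrite e; move: (h / M%:R) (h * _ / _) => a b; lra.
rewrite card_prod card_sig (_ : #|[pred x in Z]| = #|Z|) //.
rewrite card_ffun !card_ord natrM natrX le_eqVlt; apply/orP; left; apply/eqP.
have -> : n%:R * h / M%:R / 2 = (n%:R / 2) * (h / M%:R) :> R by ring.
rewrite exprMn -!mulrA; do 2!congr (_ * _); rewrite mulrCA; congr (_ * _).
by rewrite -exprMn mulfVK ?gt_eqF.
Qed.

(* A countable cover of finitely many grid cubes is reduced by compactness to a finite one,
   for which one counts the points of a much finer grid. *)
Lemma content_family N (m : cube_index n) (Z : {set grid n N}) (C : nat -> finType)
    (B : forall k, C k -> set 'rV[R]_n) (b : forall k, C k -> R) :
  (0 < N)%N -> (forall k c, 0 < b k c) ->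
  (forall k c (x y : 'rV[R]_n) l, B k c x -> B k c y -> `|x ord0 l - y ord0 l| <= b k c) ->
  (forall i (x : 'rV[R]_n), i \in Z ->
     (forall l, gpt R m i ord0 l <= x ord0 l < gpt R m i ord0 l + N%:R^-1) -> exists k c, B k c x) ->
  ((#|Z|%:R / N%:R ^+ n)%:E <= \sum_(0 <= k <oo) (\sum_(c : C k) (7 * b k c) ^+ n)%:E)%E.
Proof.
move=> N0 b0 hB hZ; have N0' : 0 < N%:R :> R by rewrite ltr0n.
pose O k c := \bigcup_(y in B k c) ball y (b k c).
have oO k c : open (O k c) by apply: bigcup_open => y _; exact: ball_open.
pose O' k := \bigcup_(c in [set: C k]) O k c.
have oO' k : open (O' k) by apply: bigcup_open => c _; exact: oO.
have hO k c (x y : 'rV[R]_n) l : O k c x -> O k c y -> `|x ord0 l - y ord0 l| < 3 * b k c.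
  move=> [x' Bx' hx] [y' By' hy].
  have h1 : `|x' ord0 l - x ord0 l| < b k c by exact: (hx.2 ord0 l).
  have h2 : `|y' ord0 l - y ord0 l| < b k c by exact: (hy.2 ord0 l).
  have h3 := hB k c x' y' l Bx' By'.
  move: h1 h2 h3; rewrite !ltr_norml !ler_norml; lra.
(* Closed cubes of half the side are compact and contained in the half-open cells. *)
have /choice[K hK] : forall i : grid n N, exists K : nat, i \in Z ->
   forall x : 'rV[R]_n, (forall l, gpt R m i ord0 l <= x ord0 l <= gpt R m i ord0 l + (2 * N%:R)^-1) ->
   exists2 k, (k < K)%N & O' k x.
  move=> i; case iZ : (i \in Z); last by exists 0%N.
  have cA : compact [set x : 'rV[R]_n | forall l,
      `[gpt R m i ord0 l, gpt R m i ord0 l + (2 * N%:R)^-1]%classic (x ord0 l)].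
    by apply: (@rV_compact _ _ (fun l => `[gpt R m i ord0 l, gpt R m i ord0 l + (2 * N%:R)^-1]%classic)) => l; exact: segment_compact.
  rewrite compact_cover in cA.
  have [|x Ax|D' _ hD'] := cA nat setT O'.
  - by move=> k _; exact: oO'.
  - have [|k [c Bk]] := hZ i x iZ.
      move=> l; have /= := Ax l; rewrite in_itv /= => /andP[-> h]; apply: le_lt_trans h _.
      rewrite ltrD2l ltf_pV2 ?posrE ?mulr_gt0 //; lra.
    by exists k => //; exists c => //; exists x => //; apply: ballxx.
  exists (\max_(k <- finmap.enum_fset D') k.+1)%N => _ x hx.
  have [|k kD Ok] := hD' x; first by move=> l /=; rewrite in_itv /=; exact: hx.
  by exists k => //; exact: (@leq_bigmax_seq _ _ xpredT (fun k => k.+1) k kD isT).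
pose KK := (\max_(i : grid n N) K i)%N.
pose M := (\sum_(k < KK) \sum_(c : C k) (Num.truncn (b k c)^-1).+1).+1.
have M0 : 0 < M%:R :> R by rewrite ltr0n.
have MN0 : 0 < M%:R * N%:R :> R by rewrite mulr_gt0.
have Mb k c : (k < KK)%N -> 1 <= b k c * (M%:R * N%:R).
  move=> kK; have h1 : (b k c)^-1 <= M%:R.
    apply: le_trans (ltW (truncnS_gt _)) _; rewrite ler_nat /M ltnS.
    rewrite (bigD1 (Ordinal kK)) //= (bigD1 c) //= -addnA; apply: leq_trans (leq_addr _ _); exact: leqnSn.
  have h2 : 1 <= b k c * M%:R.
    rewrite -[leLHS](@mulfV _ (b k c)) ?gt_eqF //; apply: ler_wpM2l => //; exact: ltW.
  by apply: le_trans h2 _; rewrite mulrA ler_peMr ?ler1n // mulr_ge0 // ltW.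
(* Each half cell receives [M ^ n] points of spacing [1 / (2 M N)]; [q] is the position of a point
   in that finer lattice. *)
pose q (p : grid n N * grid n M) l := (p.1 l * (2 * M) + p.2 l)%N.
pose pt (p : grid n N * grid n M) : 'rV[R]_n :=
  \row_l ((m l)%:~R + (q p l)%:R / (2 * (M%:R * N%:R))).
pose P := [set p : grid n N * grid n M | p.1 \in Z]%SET.
(* A set of width [3 b] contains lattice positions within [6 b M N]. As [b M N >= 1], rounding up
   costs at most one more unit of [b M N], whence the constant 7. *)
pose W k c := (Num.truncn (6 * (b k c * (M%:R * N%:R)))).+1.
pose Pk k c := [set p in P | `[< O k c (pt p) >]]%SET.
have cardP : #|P| = (#|Z| * M ^ n)%N.
  have -> : P = finset.setX Z [set: grid n M]%SET by apply/setP => p; rewrite !inE andbT.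
  by rewrite cardsX cardsT card_ffun !card_ord.
have cov p : p \in P -> exists (k : 'I_KK) (c : C k), p \in Pk k c.
  rewrite inE => pZ; have [|k kK [c _ Ok]] := hK p.1 pZ (pt p).
    move=> l; rewrite !mxE -!addrA !lerD2l /q natrD natrM natrM.
    have -> : ((p.1 l)%:R * (2 * M%:R) + (p.2 l)%:R) / (2 * (M%:R * N%:R)) =
       (p.1 l)%:R / N%:R + (p.2 l)%:R / M%:R / (2 * N%:R) :> R.
      by field; rewrite !gt_eqF.
    rewrite lerDl lerD2l divr_ge0 ?divr_ge0 ?mulr_ge0 ?(ltW N0') //=.
    rewrite ler_piMl ?invr_ge0 ?mulr_ge0 ?(ltW N0') // ler_pdivrMr // mul1r ler_nat.
    by rewrite ltnW.
  have kKK : (k < KK)%N by apply: leq_trans kK _; rewrite /KK (bigD1 p.1) //= leq_maxl.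
  by exists (Ordinal kKK), c; rewrite !inE pZ; apply/asboolP.
have cardPk k c : (#|Pk k c| <= W k c ^ n)%N.
  (* Positions in one set differ by less than [W k c], so they are determined by their residues. *)
  pose g (p : grid n N * grid n M) : {ffun 'I_n -> 'I_(W k c)} :=
    [ffun l => inord (q p l %% W k c)].
  have ginj : {in Pk k c &, injective g}.
    move=> p p'; rewrite !inE => /andP[_ /asboolP Op] /andP[_ /asboolP Op'] /ffunP e.
    have qe l : q p l = q p' l.
      have := congr1 val (e l); rewrite !ffunE /= !inordK ?ltn_pmod // => em.
      have := hO k c (pt p) (pt p') l Op Op'; rewrite !mxE opprD addrACA subrr add0r -mulrBl.
      rewrite normrM (gtr0_norm (_ : 0 < (2 * (M%:R * N%:R))^-1)) ?invr_gt0 ?mulr_gt0 //.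
      rewrite ltr_pdivrMr ?mulr_gt0 // => hd.
      have {}hd : `|(q p l)%:R - (q p' l)%:R| < (W k c)%:R :> R.
        apply: lt_trans (truncnS_gt _); apply: lt_le_trans hd _.
        by move: (b k c) (M%:R * N%:R) => u v; rewrite le_eqVlt; apply/orP; left; apply/eqP; ring.
      move: hd; rewrite ltr_norml ltrBlDr -natrD ltrNl opprB ltrBlDr -natrD !ltr_nat => /andP[h1 h2].
      apply: (modn_close em); rewrite addnC //.
    have [e1 e2] : p.1 = p'.1 /\ p.2 = p'.2.
      have jl (u : grid n M) l : (u l < 2 * M)%N by have := ltn_ord (u l); rewrite -/M; lia.
      split; apply/ffunP => l; apply: val_inj => /=; have := qe l; rewrite /q => {}qe.
        by have := congr1 (fun u => u %/ (2 * M))%N qe; rewrite !divnMDl ?muln_gt0 // !divn_small ?jl // !addn0.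
      by have := congr1 (fun u => u %% (2 * M))%N qe; rewrite !modnMDl !modn_small ?jl.
    by case: p p' e1 e2 {Op Op' e qe} => ? ? [? ?] /= -> ->.
  rewrite -(card_in_imset ginj); apply: leq_trans (max_card _) _.
  by rewrite card_ffun !card_ord.
have cnt : (#|Z| * M ^ n <= \sum_(k < KK) \sum_(c : C k) W k c ^ n)%N.
  rewrite -cardP.
  apply: (@leq_trans (\sum_(k < KK) \sum_(c : C k) #|Pk k c|)); last first.
    by apply: leq_sum => k _; apply: leq_sum => c _; exact: cardPk.
  apply: (@leq_trans (\sum_(p in P) \sum_(k < KK) \sum_(c : C k) (p \in Pk k c))).
    rewrite -sum1_card; apply: leq_sum => p /cov[k [c pk]].
    by rewrite (bigD1 k) //= (bigD1 c) //= pk.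
  rewrite exchange_big; apply: leq_sum => k _; rewrite exchange_big; apply: leq_sum => c _.
  rewrite -[leqRHS]sum1_card [leqLHS]big_mkcond [leqRHS]big_mkcond /=.
  by apply: leq_sum => p _; case: (p \in P); case: (p \in Pk k c).
apply: (@le_trans _ _ (\sum_(0 <= k < KK) (\sum_(c : C k) (7 * b k c) ^+ n)%:E)%E); last first.
  apply: nneseries_lim_ge => k _ _; rewrite lee_fin sumr_ge0 // => c _.
  by rewrite exprn_ge0 // mulr_ge0 // ltW.
rewrite sumEFin lee_fin big_mkord ler_pdivrMr ?exprn_gt0 // -(ler_pM2r (exprn_gt0 n M0)).
apply: (@le_trans _ _ (\sum_(k < KK) \sum_(c : C k) W k c ^ n)%:R); first by rewrite -natrX -natrM ler_nat.
rewrite natr_sum -mulrA -exprMn mulr_suml; apply: ler_sum => k _.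
rewrite natr_sum mulr_suml; apply: ler_sum => c _.
rewrite natrX -exprMn lerXn2r ?nnegrE ?mulr_ge0 ?(ltW (b0 _ _)) ?(ltW N0') //.
have u0 : 0 <= 6 * (b k c * (M%:R * N%:R)) by rewrite !mulr_ge0 // ltW.
have /andP[+ _] := truncn_itv u0; have := Mb k c (ltn_ord k); rewrite /W -natr1.
by rewrite [N%:R * M%:R]mulrC -mulrA; set u := b k c * _; set v := (Num.truncn _)%:R; lra.
Qed.

Lemma content_grid N (m : cube_index n) (Z : {set grid n N}) (B : nat -> set 'rV[R]_n) (b : nat -> R) :
  (0 < N)%N -> (forall k, 0 < b k) ->
  (forall k (x y : 'rV[R]_n) l, B k x -> B k y -> `|x ord0 l - y ord0 l| <= b k) ->
  (forall i (x : 'rV[R]_n), i \in Z ->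
     (forall l, gpt R m i ord0 l <= x ord0 l < gpt R m i ord0 l + N%:R^-1) -> exists k, B k x) ->
  ((#|Z|%:R / N%:R ^+ n)%:E <= \sum_(0 <= k <oo) ((7 * b k) ^+ n)%:E)%E.
Proof.
move=> N0 b0 hB hZ.
have := @content_family N m Z (fun=> unit) (fun k _ => B k) (fun k _ => b k) N0 (fun k _ => b0 k).
under eq_eseriesr => k _ do rewrite big_const card_unit /= addr0.
by apply => [k _|i x iZ /(hZ i x iZ) [k Bk]]; [exact: hB | exists k, tt].
Qed.

Lemma content_grid0 N (m : cube_index n) (Z : {set grid n N}) (B : nat -> set 'rV[R]_n) (b : nat -> R) :
  (0 < n)%N -> (0 < N)%N -> (forall k, 0 <= b k) ->
  (forall k (x y : 'rV[R]_n) l, B k x -> B k y -> `|x ord0 l - y ord0 l| <= b k) ->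
  (forall i (x : 'rV[R]_n), i \in Z ->
     (forall l, gpt R m i ord0 l <= x ord0 l < gpt R m i ord0 l + N%:R^-1) -> exists k, B k x) ->
  ((#|Z|%:R / N%:R ^+ n)%:E <= \sum_(0 <= k <oo) ((14 * b k) ^+ n)%:E)%E.
Proof.
move=> n0 N0 b0 hB hZ; apply/lee_addgt0Pr => e e0.
pose e' := Num.min e 1.
have e'0 : 0 < e' by rewrite lt_min e0 ltr01.
have e'1 : e' <= 1 by rewrite ge_min lexx orbT.
pose eta (k : nat) := e' / (2 ^ k.+1)%:R.
have eta0 k : 0 < eta k by rewrite divr_gt0 // ltr0n expn_gt0.
have eta1 k : eta k <= 1.
  rewrite ler_pdivrMr ?ltr0n ?expn_gt0 // mul1r; apply: le_trans e'1 _.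
  by rewrite ler1n expn_gt0.
apply: (@le_trans _ _ (\sum_(0 <= k <oo) ((7 * (b k + eta k / 14)) ^+ n)%:E)%E).
  apply: (@content_grid N m Z B) => // k; first by rewrite ltr_wpDl // divr_gt0.
  by move=> x y l Bx By; apply: le_trans (hB k x y l Bx By) _; rewrite lerDl divr_ge0 // ltW.
apply: (@le_trans _ _ (\sum_(0 <= k <oo) (((14 * b k) ^+ n)%:E + (e' / (2 ^ k.+1)%:R)%:E))%E).
  apply: lee_nneseries => [k _ _|k _].
    by rewrite lee_fin exprn_ge0 // mulr_ge0 // addr_ge0 // divr_ge0 // ltW.
  rewrite -EFinD lee_fin -/(eta k).
  have pe : eta k ^+ n <= eta k by rewrite -[leRHS]expr1 ler_wiXn2l // ltW.
  have b14 : 0 <= 14 * b k by rewrite mulr_ge0.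
  have [h|h] := leP (14 * b k) (eta k).
    apply: (@le_trans _ _ (eta k ^+ n)); last first.
      by apply: le_trans pe _; rewrite lerDr exprn_ge0.
    rewrite lerXn2r ?nnegrE ?(ltW (eta0 k)) ?mulr_ge0 ?addr_ge0 ?divr_ge0 ?(ltW (eta0 k)) //; lra.
  apply: (@le_trans _ _ ((14 * b k) ^+ n)); last by rewrite lerDl ltW.
  rewrite lerXn2r ?nnegrE ?mulr_ge0 ?addr_ge0 ?divr_ge0 ?(ltW (eta0 k)) //; lra.
apply: le_trans (epsilon_trick _ _ (ltW e'0)) _.
  by move=> k; rewrite lee_fin exprn_ge0 // mulr_ge0.
by rewrite leeD2l // lee_fin ge_min lexx.
Qed.
End Content.

Lemma dist_in_itv (R : realFieldType) (a b u v : R) : -1 + v <= a -> a <= -1 + (v + u) ->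
  -1 + v <= b -> b <= -1 + (v + u) -> `|a - b| <= u.
Proof. by move=> ? ? ? ?; rewrite ler_norml; lra. Qed.

(** * The Gram norm and the sphere of polynomials *)

Section GramNorm.
Variables (R : realType) (n k : nat) (G : mon n k -> mon n k -> R).
Hypothesis pdG : pos_def_gram G.
Local Notation I := (mon n k).
Implicit Types p q : poly_k R n k.

Definition gB p q : R := \sum_(a : I) \sum_(b : I) p a * G a b * q b.

Lemma gramE p : gram_form G p = gB p p. Proof. by []. Qed.

Lemma gBC p q : gB p q = gB q p.
Proof.
rewrite /gB exchange_big; apply: eq_bigr => a _; apply: eq_bigr => b _.
by rewrite (pdG.1 b a); ring.
Qed.

Lemma gBDl p p' q s t : gB (fun a => s * p a + t * p' a) q = s * gB p q + t * gB p' q.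
Proof.
rewrite /gB !mulr_sumr -big_split; apply: eq_bigr => a _ /=.
by rewrite !mulr_sumr -big_split; apply: eq_bigr => b _ /=; ring.
Qed.

Lemma gB_comb p q s t : gB (fun a => s * p a + t * q a) (fun a => s * p a + t * q a) =
  s ^+ 2 * gB p p + 2 * (s * t) * gB p q + t ^+ 2 * gB q q.
Proof. by rewrite gBDl !(gBC _ (fun a => _ + _)) !gBDl (gBC q p); ring. Qed.

Lemma gB_ge0 p : 0 <= gB p p.
Proof.
have [[a pa]|h] := pselect (exists a, p a != 0); first by apply/ltW/(pdG.2); exists a.
rewrite /gB big1 // => a _; rewrite big1 // => b _.
by have [->|pa] := eqVneq (p a) 0; [rewrite !mul0r | case: h; exists a].
Qed.

Lemma gB_CS p q : gB p q ^+ 2 <= gB p p * gB q q.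
Proof.
have [q0|q0] := eqVneq (gB q q) 0.
  have [pq|pq] := eqVneq (gB p q) 0; first by rewrite pq expr0n mulr_ge0 ?gB_ge0.
  (* If [q] has norm 0, this [t] makes the form at [p + t q] equal to -1. *)
  pose t := - (gB p p + 1) / (2 * gB p q).
  have := gB_ge0 (fun a => 1 * p a + t * q a); rewrite gB_comb q0.
  have -> : 1 ^+ 2 * gB p p + 2 * (1 * t) * gB p q + t ^+ 2 * 0 = - 1.
    by rewrite /t; field.
  lra.
have q1 : 0 < gB q q by rewrite lt0r q0 gB_ge0.
have := gB_ge0 (fun a => gB q q * p a + (- gB p q) * q a); rewrite gB_comb.
have -> : gB q q ^+ 2 * gB p p + 2 * (gB q q * - gB p q) * gB p q + (- gB p q) ^+ 2 * gB q q =
  gB q q * (gB p p * gB q q - gB p q ^+ 2) by ring.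
by rewrite pmulr_rge0 // subr_ge0.
Qed.

Lemma gnorm_ge0 p : 0 <= gnorm G p. Proof. exact: sqrtr_ge0. Qed.

Lemma gnorm_sqr p : gnorm G p ^+ 2 = gB p p.
Proof. by rewrite sqr_sqrtr // gramE gB_ge0. Qed.

Lemma gnormD p q : gnorm G (fun a => p a + q a) <= gnorm G p + gnorm G q.
Proof.
rewrite -(@ler_pXn2r _ 2) ?nnegrE ?addr_ge0 ?gnorm_ge0 // gnorm_sqr.
have -> : gB (fun a => p a + q a) (fun a => p a + q a) = gB p p + 2 * gB p q + gB q q.
  have -> : (fun a => p a + q a) = (fun a => 1 * p a + 1 * q a).
    by apply/funext => a; rewrite !mul1r.
  by rewrite gB_comb; ring.
have -> : (gnorm G p + gnorm G q) ^+ 2 = gB p p + 2 * (gnorm G p * gnorm G q) + gB q q.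
  by rewrite -!gnorm_sqr; ring.
suff : gB p q <= gnorm G p * gnorm G q by lra.
apply: le_trans (ler_norm _) _.
rewrite -(@ler_pXn2r _ 2) ?nnegrE ?mulr_ge0 ?gnorm_ge0 // exprMn !gnorm_sqr.
by rewrite real_normK ?num_real // gB_CS.
Qed.

Lemma gnormZ s p : gnorm G (fun a => s * p a) = `|s| * gnorm G p.
Proof.
rewrite -(sqrtr_sqr s) -sqrtrM ?sqr_ge0 //; congr Num.sqrt.
rewrite !gramE /gB mulr_sumr; apply: eq_bigr => a _; rewrite mulr_sumr.
by apply: eq_bigr => b _; ring.
Qed.

Lemma gdist_ge0 p q : 0 <= gdist G p q. Proof. exact: sqrtr_ge0. Qed.

(* Pairing with the dual basis and Cauchy-Schwarz bound every coefficient. *)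
Lemma coef_le_gnorm : exists2 c : R, 0 < c & forall p a, `|p a| <= c * gnorm G p.
Proof.
pose A : 'M[R]_#|{: I}| := \matrix_(i, j) G (enum_val i) (enum_val j).
have gBv (v : 'rV[R]_#|{: I}|) q : gB (fun a => v ord0 (enum_rank a)) q =
   \sum_j (v *m A) ord0 j * q (enum_val j).
  rewrite /gB exchange_big (reindex _ (onW_bij _ (@enum_val_bij _))) /=.
  apply: eq_bigr => j _; rewrite mxE mulr_suml (reindex _ (onW_bij _ (@enum_val_bij _))) /=.
  by apply: eq_bigr => i _; rewrite enum_valK mxE.
have uA : A \in unitmx.
  rewrite -row_free_unit -kermx_eq0; apply/negPn/negP => kA.
  have [v vA v0] : exists2 v : 'rV[R]_#|{: I}|, v *m A = 0 & v != 0.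
    move/rowV0Pn: kA => [v /sub_kermxP vA v0]; by exists v.
  have [a ha] : exists a, v ord0 (enum_rank a) != 0.
    apply: contrapT => h; case/negP: v0; apply/eqP/rowP => j; rewrite mxE.
    apply/eqP/negPn/negP => vj; apply: h; exists (enum_val j).
    by rewrite enum_valK.
  have := pdG.2 (fun a => v ord0 (enum_rank a)); rewrite gramE gBv vA.
  rewrite big1 ?ltxx => [/(_ _)|j _]; last by rewrite mxE mul0r.
  by move=> h; suff : false by []; apply: h; exists a.
pose g (a : I) : poly_k R n k := fun b => (invmx A) (enum_rank a) (enum_rank b).
have gg p a : gB (g a) p = p a.
  have -> : g a = fun b => (row (enum_rank a) (invmx A)) ord0 (enum_rank b).
    by apply/funext => b; rewrite mxE.
  rewrite gBv -row_mul mulVmx // (bigD1 (enum_rank a)) //= !mxE eqxx mul1r enum_rankK.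
  by rewrite big1 ?addr0 // => j /negbTE ja; rewrite !mxE eq_sym ja mul0r.
exists (1 + \sum_a gnorm G (g a)).
  by rewrite ltr_pwDl // sumr_ge0 // => a _; exact: gnorm_ge0.
move=> p a; apply: (@le_trans _ _ (gnorm G (g a) * gnorm G p)).
  rewrite -(@ler_pXn2r _ 2) ?nnegrE ?mulr_ge0 ?gnorm_ge0 // exprMn !gnorm_sqr.
  by rewrite real_normK ?num_real // -{1}(gg p a) gB_CS.
rewrite ler_wpM2r ?gnorm_ge0 // (bigD1 a) //= addrCA lerDl addr_ge0 // sumr_ge0 // => b _.
exact: gnorm_ge0.
Qed.

Lemma gnorm_le_coef : exists2 c : R, 0 < c & forall p t, 0 <= t -> (forall a, `|p a| <= t) ->
  gnorm G p <= c * t.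
Proof.
pose c := 1 + \sum_a \sum_b `|G a b|.
have c1 : 1 <= c by rewrite lerDl sumr_ge0 // => a _; rewrite sumr_ge0.
exists c; first exact: lt_le_trans c1.
move=> p t t0 hp; rewrite -(@ler_pXn2r _ 2) ?nnegrE ?mulr_ge0 ?gnorm_ge0 ?(le_trans _ c1) //.
rewrite gnorm_sqr; apply: (@le_trans _ _ (c * t ^+ 2)); last first.
  by rewrite exprMn ler_wpM2r ?sqr_ge0 // expr2 ler_peMl // (le_trans _ c1).
apply: (@le_trans _ _ ((\sum_a \sum_b `|G a b|) * t ^+ 2)); last first.
  by rewrite ler_wpM2r ?sqr_ge0 // lerDr.
rewrite /gB mulr_suml; apply: ler_sum => a _; rewrite mulr_suml; apply: ler_sum => b _.
apply: le_trans (ler_norm _) _; rewrite !normrM mulrAC mulrC ler_wpM2l //.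
by rewrite expr2 ler_pM.
Qed.

(** The difference is [(p - q) / s + (1 / s - 1 / t) q], and each of the two terms has norm at most
    [|p - q| / s]. *)
Lemma radial_lip p q s t : 0 < s -> 0 < t -> gnorm G p = s -> gnorm G q = t ->
  gnorm G (fun a => s^-1 * p a - t^-1 * q a) <= 2 / s * gnorm G (fun a => p a - q a).
Proof.
move=> s0 t0 ps qt.
have sd (u v : poly_k R n k) : gnorm G u - gnorm G v <= gnorm G (fun a => u a - v a).
  rewrite lerBlDr; apply: le_trans (gnormD _ _); rewrite le_eqVlt; apply/orP; left; apply/eqP.
  by congr gnorm; apply/funext => a; rewrite subrK.
have st : `|t - s| <= gnorm G (fun a => p a - q a).
  rewrite ler_norml -lerNl opprB -{1}ps -{1}qt sd /= -ps -qt.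
  apply: le_trans (sd q p) _; rewrite (_ : (fun a => q a - p a) = (fun a => -1 * (p a - q a))).
    by rewrite gnormZ normrN1 mul1r.
  by apply/funext => a; ring.
have -> : (fun a => s^-1 * p a - t^-1 * q a) =
    (fun a => s^-1 * (p a - q a) + (s^-1 - t^-1) * q a) by apply/funext => a; ring.
apply: le_trans (gnormD _ _) _; rewrite !gnormZ qt gtr0_norm ?invr_gt0 //.
have -> : s^-1 - t^-1 = (t - s) * (s^-1 * t^-1) by field; rewrite !gt_eqF.
rewrite normrM (gtr0_norm (_ : 0 < s^-1 * t^-1)) ?mulr_gt0 ?invr_gt0 //.
have -> : `|t - s| * (s^-1 * t^-1) * t = s^-1 * `|t - s| by field; rewrite !gt_eqF.
have : s^-1 * `|t - s| <= s^-1 * gnorm G (fun a => p a - q a) by rewrite ler_wpM2l // invr_ge0 ltW.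
by set y := gnorm _ _; set z := `|_|; set u := s^-1; lra.
Qed.

Local Notation D := #|{: mon n k}|.

(** The sphere is the radial image of the boundary of a cube in coefficient space. The face is given
    by the coefficient of largest modulus and its sign, and the ratios of the other coefficients to
    it are subdivided; [radial_lip] bounds the diameters. *)
Lemma sph_measure_fin p eps : (1 < D)%N -> (sph_measure G (sph_ball G p eps) < +oo)%E.
Proof.
move=> D1; have [c c0 hc] := coef_le_gnorm; have [C C0 hC] := gnorm_le_coef.
pose K := 4 * c * C.
have K0 : 0 <= K by rewrite !mulr_ge0 // ltW.
apply: (@le_lt_trans _ _ (omega R D.-1 * K ^+ D.-1 * (D * 2)%:R)%:E); last exact: ltry.
apply: haus_le_cover => [q q'|delta d0]; first exact: gdist_ge0.
pose M := (Num.truncn (2 * K / delta)).+1.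
have M0 : 0 < M%:R :> R by rewrite ltr0n.
exists ('I_D * bool * {ffun 'I_D.-1 -> 'I_M})%type.
exists (fun j : 'I_D * bool * {ffun 'I_D.-1 -> 'I_M} => [set q : poly_k R n k | gnorm G q = 1 /\ exists2 t, 0 < t &
   q (enum_val j.1.1) = (-1) ^+ j.1.2 * t /\ forall l : 'I_D.-1,
   t * (-1 + 2 * (j.2 l)%:R / M%:R) <= q (enum_val (lift j.1.1 l)) <= t * (-1 + 2 * (j.2 l).+1%:R / M%:R)]).
exists (2 * K / M%:R); split.
- apply/andP; split; first by rewrite divr_ge0 // mulr_ge0.
  rewrite ler_pdivrMr //.
  have := truncnS_gt (2 * K / delta); rewrite ltr_pdivrMr // -/M => /ltW hh.
  by rewrite [leRHS]mulrC.
- move=> q [q1 _]; rewrite /psphere /= in q1.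
  have D0 : (0 < D)%N by exact: ltn_trans D1.
  have [i0 _ hi0] := @arg_maxP _ R 'I_D (Ordinal D0) xpredT (fun i => `|q (enum_val i)|) isT.
  pose t := `|q (enum_val i0)|.
  have t0 : 0 < t.
    rewrite normr_gt0; apply/negP => /eqP qi0; have : gnorm G q <= C * 0.
      apply: hC => // a; rewrite -(enum_rankK a); apply: le_trans (hi0 (enum_rank a) isT) _.
      by rewrite qi0 normr0.
    by rewrite q1 mulr0; lra.
  have hl (l : 'I_D.-1) : exists j : 'I_M, t * (-1 + 2 * j%:R / M%:R) <= q (enum_val (lift i0 l))
       <= t * (-1 + 2 * j.+1%:R / M%:R).
    set x := q _; have xt : `|x| <= t by exact: hi0.
    pose y := (x / t + 1) / 2 * M%:R.
    have xE : x = t * (-1 + 2 * y / M%:R) by rewrite /y; field; rewrite !gt_eqF.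
    have /andP[x1 x2] : - t <= x <= t by rewrite -ler_norml.
    have y0 : 0 <= y.
      by rewrite mulr_ge0 // divr_ge0 // -lerBlDr sub0r ler_pdivlMr // mulN1r.
    have yM : y <= M%:R.
      by rewrite /y ger_pMl // ler_pdivrMr // mul1r -lerBrDr ler_pdivrMr //; lra.
    have [yM'|yM'] := ltP y M%:R.
      have jM : (Num.truncn y < M)%N by rewrite truncn_lt_nat.
      exists (Ordinal jM); have /andP[y1 /ltW y2] := truncn_itv y0.
      rewrite {1 2}xE !ler_pM2l // !lerD2l !ler_pM2r ?invr_gt0 // !ler_pM2l //.
      by rewrite y1 y2.
    have jM : (M.-1 < M)%N by [].
    exists (Ordinal jM); rewrite {1 2}xE !ler_pM2l // !lerD2l !ler_pM2r ?invr_gt0 // !ler_pM2l //.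
    by rewrite yM andbT; apply: le_trans yM'; rewrite ler_nat.
  have [j hj] := choice hl.
  exists (i0, q (enum_val i0) < 0, [ffun l => j l]) => /=; split => //.
  exists t => //; split; last by move=> l; rewrite ffunE.
  rewrite /t; case: ltP => [/ltr0_norm ->|/ger0_norm ->] /=.
    by rewrite expr1 mulrNN mul1r.
  by rewrite expr0 mul1r.
- move=> [[i0 sg] f] q q' [q1 [t t0 [qt hl]]] [q'1 [t' t'0 [qt' hl']]] /=.
  pose y : poly_k R n k := fun a => t^-1 * q a.
  pose y' : poly_k R n k := fun a => t'^-1 * q' a.
  have ny : gnorm G y = t^-1 by rewrite gnormZ q1 mulr1 gtr0_norm ?invr_gt0.
  have ny' : gnorm G y' = t'^-1 by rewrite gnormZ q'1 mulr1 gtr0_norm ?invr_gt0.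
  have := radial_lip (_ : 0 < t^-1) (_ : 0 < t'^-1) ny ny'; rewrite !invr_gt0 => /(_ t0 t'0).
  have -> : (fun a => t^-1^-1 * y a - t'^-1^-1 * y' a) = (fun a => q a - q' a).
    by apply/funext => a; rewrite /y /y'; field; rewrite !gt_eqF.
  rewrite /gdist => h; apply: le_trans h _; rewrite invrK.
  have tc : t <= c.
    have := hc q (enum_val i0); rewrite q1 mulr1 qt normrM normrX normrN1 expr1n mul1r.
    by rewrite gtr0_norm.
  have yy : gnorm G (fun a => y a - y' a) <= C * (2 / M%:R).
    apply: hC => [|a]; first by rewrite divr_ge0.
    rewrite -(enum_rankK a); have [l -> /=|-> /=] := unliftP i0 (enum_rank a).
      have /andP[a1 a2] := hl l; have /andP[b1 b2] := hl' l.
      have a1' : -1 + 2 * (f l)%:R / M%:R <= y (enum_val (lift i0 l)) by rewrite /y ler_pdivlMl.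
      have a2' : y (enum_val (lift i0 l)) <= -1 + 2 * (f l).+1%:R / M%:R by rewrite /y ler_pdivrMl.
      have b1' : -1 + 2 * (f l)%:R / M%:R <= y' (enum_val (lift i0 l)) by rewrite /y' ler_pdivlMl.
      have b2' : y' (enum_val (lift i0 l)) <= -1 + 2 * (f l).+1%:R / M%:R by rewrite /y' ler_pdivrMl.
      have e : 2 * (f l).+1%:R / M%:R = 2 * (f l)%:R / M%:R + 2 / M%:R :> R by rewrite -natr1; ring.
      by rewrite e in a2' b2'; exact: dist_in_itv a1' a2' b1' b2'.
    rewrite /y /y' qt qt' !mulrA ![_^-1 * _]mulrC -!mulrA !mulVf ?gt_eqF // subrr normr0.
    by rewrite divr_ge0.
  have -> : 2 * K / M%:R = 2 * c * (C * (2 / M%:R)) * 2 by rewrite /K; ring.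
  have := ler_pM (ltW t0) (gnorm_ge0 _) tc yy.
  have : 0 <= c * (C * (2 / M%:R)) by rewrite !mulr_ge0 ?(ltW c0) ?(ltW C0) // divr_ge0.
  by set gn := gnorm _ _; set CC := C * (2 / M%:R); lra.
rewrite !card_prod card_bool card_ffun !card_ord le_eqVlt; apply/orP; left; apply/eqP.
rewrite natrM natrX; have -> : 2 * K / M%:R / 2 = K / M%:R by field; rewrite gt_eqF.
have := expf_neq0 D.-1 (negbT (gt_eqF M0)); rewrite expr_div_n.
move: (M%:R ^+ D.-1) (K ^+ D.-1) (omega _ _) => u v o u0. by field.
Qed.

Lemma gnorm0 p : (forall a, p a = 0) -> gnorm G p = 0.
Proof.
move=> p0; have [C C0 hC] := gnorm_le_coef; apply/eqP; rewrite eq_le gnorm_ge0 andbT.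
by have := hC p 0 (lexx 0); rewrite mulr0; apply => a; rewrite p0 normr0.
Qed.

(* The central projection [q |-> (q a / q a0)_a] is Lipschitz near [p] and its image
   contains a cube. *)
Lemma sph_measure_gt0 p eps : (1 < D)%N -> psphere G p -> 0 < eps ->
  (0 < sph_measure G (sph_ball G p eps))%E.
Proof.
rewrite /psphere /= => D1 p1 e0.
have [c c0 hc] := coef_le_gnorm; have [C C0 hC] := gnorm_le_coef.
have d0 : (0 < D.-1)%N by rewrite -subn1 subn_gt0.
have [a0 pa0] : exists a, p a != 0.
  apply: contrapT => h; have : gnorm G p = 0.
    by apply: gnorm0 => a; apply: contrapT => /eqP pa; apply: h; exists a.
  by rewrite p1 => /eqP; rewrite oner_eq0.
set s0 := p a0 in pa0; pose i0 := enum_rank a0.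
have s0' : 0 < `|s0| by rewrite normr_gt0.
pose y0 l := p (enum_val (lift i0 l)) / s0.
pose z (y : 'rV[R]_D.-1) : poly_k R n k := fun a =>
  if unlift i0 (enum_rank a) is Some l then y0 l + y ord0 l else 1.
have za0 y : z y a0 = 1 by rewrite /z unlift_none.
have zl y l : z y (enum_val (lift i0 l)) = y0 l + y ord0 l by rewrite /z enum_valK liftK.
have z00 : z 0 = fun a => s0^-1 * p a.
  apply/funext => a; rewrite /z; case: unliftP => [l e|e].
    by rewrite mxE addr0 /y0 -e enum_rankK mulrC.
  by have /enum_rank_inj -> := e; rewrite mulVf.
have nz y : c^-1 <= gnorm G (z y).
  by rewrite -[c^-1]mulr1 ler_pdivrMl //; have := hc (z y) a0; rewrite za0 normr1.
have nz0 y : 0 < gnorm G (z y) by apply: lt_le_trans (nz y); rewrite invr_gt0.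
have nz00 : gnorm G (z 0) = `|s0|^-1 by rewrite z00 gnormZ p1 mulr1 normfV.
pose N := (Num.truncn (2 * `|s0| * C / eps)).+1.
have N0 : 0 < N%:R :> R by rewrite ltr0n.
have N1 : N%:R^-1 <= 1 :> R by rewrite invf_le1 // ler1n.
pose inc (y : 'rV[R]_D.-1) := forall l, 0 <= y ord0 l < N%:R^-1.
have dz y : inc y -> gnorm G (fun a => z 0 a - z y a) <= C * N%:R^-1.
  move=> iy; apply: hC => [|a]; first by rewrite invr_ge0 ltW.
  rewrite /z; case: unlift => [l|]; last by rewrite subrr normr0 invr_ge0 ltW.
  by rewrite mxE addr0 opprD addNKr normrN; have /andP[u v] := iy l; rewrite ger0_norm // ltW.
pose Zm := `|s0|^-1 + C.
have Zm0 : 0 < Zm by rewrite addr_gt0 ?invr_gt0.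
have zZm y : inc y -> gnorm G (z y) <= Zm.
  move=> iy; have -> : z y = fun a => z 0 a + (-1) * (z 0 a - z y a) by apply/funext => a; ring.
  apply: le_trans (gnormD _ _) _; rewrite gnormZ normrN1 mul1r nz00 lerD2l.
  by apply: le_trans (dz y iy) _; rewrite ler_piMr // ltW.
(* The point [z 0] is [p / s0]; the sign makes [q 0] equal to [p] and not to its opposite. *)
pose sg := s0 / `|s0|.
have sg1 : `|sg| = 1 by rewrite normrM normfV normr_id mulfV ?gt_eqF.
pose q y : poly_k R n k := fun a => sg * ((gnorm G (z y))^-1 * z y a).
have qb y : inc y -> sph_ball G p eps (q y).
  move=> iy; split; rewrite /=.
    by rewrite /psphere /= gnormZ sg1 mul1r gnormZ gtr0_norm ?invr_gt0 // mulVf ?gt_eqF.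
  have -> : gdist G (q y) p =
      gnorm G (fun a => - sg * (`|s0|^-1^-1 * z 0 a - (gnorm G (z y))^-1 * z y a)).
    congr gnorm; apply/funext => a; rewrite /q invrK z00 /sg.
    have [s1|s1] := ltP 0 s0.
      by rewrite (gtr0_norm s1); field; rewrite !gt_eqF // nz0.
    have s2 : s0 < 0 by rewrite lt_neqAle pa0 s1.
    by rewrite (ltr0_norm s2); field; rewrite pa0 gt_eqF // nz0.
  rewrite gnormZ normrN sg1 mul1r.
  apply: le_lt_trans (radial_lip _ _ nz00 erefl) _ => //; first by rewrite invr_gt0.
  rewrite invrK; apply: (@le_lt_trans _ _ (2 * `|s0| * (C * N%:R^-1))).
    by rewrite ler_wpM2l ?dz // mulr_ge0.
  have := truncnS_gt (2 * `|s0| * C / eps); rewrite -/N ltr_pdivrMr //.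
  by rewrite mulrA ltr_pdivrMr // [X in _ < X]mulrC.
pose L := Zm * (1 + c * Zm) * c.
have L0 : 0 <= L.
  have cZ : 0 <= c * Zm by rewrite mulr_ge0 ?(ltW Zm0) ?(ltW c0).
  by rewrite /L mulr_ge0 ?(ltW c0) // mulr_ge0 ?(ltW Zm0) // addr_ge0.
have lip y y' l : inc y -> inc y' -> `|y ord0 l - y' ord0 l| <= L * gdist G (q y) (q y').
  move=> iy iy'; set dd := gdist _ _ _.
  set a := enum_val (lift i0 l).
  have h1 : `|q y a - q y' a| <= c * dd by exact: (hc (fun a => q y a - q y' a)).
  have h2 : `|q y a0 - q y' a0| <= c * dd by exact: (hc (fun a => q y a - q y' a)).
  (* Up to a constant, [y l] is a quotient of two coefficients of [q y]; the identity writes a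
     difference of quotients through differences of coefficients. *)
  have e : y ord0 l - y' ord0 l =
      ((q y a - q y' a) - z y' a * (q y a0 - q y' a0)) * (gnorm G (z y) * sg).
    have sg2 : sg * sg = 1 by rewrite -expr2 -real_normK ?num_real // sg1 expr1n.
    have -> : y ord0 l - y' ord0 l = z y a - z y' a by rewrite !zl; ring.
    rewrite /q !za0; set u := gnorm G (z y); set v := gnorm G (z y').
    have -> : (sg * (u^-1 * z y a) - sg * (v^-1 * z y' a) - z y' a * (sg * (u^-1 * 1) - sg * (v^-1 * 1)))
      * (u * sg) = (sg * sg) * ((u^-1 * u) * (z y a - z y' a)) by ring.
    by rewrite sg2 mulVf ?gt_eqF ?nz0 // !mul1r.
  have hz : `|z y' a| <= c * Zm.
    by apply: le_trans (hc _ _) _; rewrite ler_wpM2l ?zZm // ltW.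
  rewrite e normrM [`|_ * sg|]normrM sg1 mulr1 (gtr0_norm (nz0 y)).
  have -> : L * dd = ((1 + c * Zm) * (c * dd)) * Zm by rewrite /L; ring.
  rewrite ler_pM ?zZm // ?(ltW (nz0 _)) //.
  apply: le_trans (ler_normB _ _) _; rewrite normrM mulrDl mul1r lerD //.
  by rewrite ler_pM.
have om := omega_gt0 R D.-1.
(* The constant 14 of [content_grid0], doubled because [hterm] contains half of the diameter. *)
pose K := (28 * L) ^+ D.-1 / omega R D.-1.
have K0 : 0 <= K by apply: divr_ge0; [rewrite exprn_ge0 // mulr_ge0 | exact: ltW].
have N0n : 0 < N%:R ^+ D.-1 :> R by rewrite exprn_gt0.
apply: (@lt_le_trans _ _ ((N%:R ^+ D.-1)^-1 / (K + 1))%:E).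
  by rewrite lte_fin divr_gt0 ?invr_gt0 // ltr_wpDl.
apply: (@haus_ge_cover _ _ _ _ _ _ 1) => // F FA dF.
pose B j := [set y : 'rV[R]_D.-1 | inc y /\ F j (q y)].
pose b j := if F j == set0 then 0 else L * fine (diam (gdist G) (F j)).
pose Z := [set [ffun=> ord0] : grid D.-1 N]%SET.
have hcont := @content_grid0 R D.-1 N [ffun=> 0] Z B b d0.
have key : ((N%:R ^+ D.-1)^-1%:E <= K%:E * \sum_(0 <= j <oo) hterm (gdist G) D.-1 (F j))%E.
  have -> : (N%:R ^+ D.-1)^-1 = #|Z|%:R / N%:R ^+ D.-1 :> R by rewrite cards1 mul1r.
  rewrite -nneseriesZl; last by move=> j _; exact: (hterm_ge0 (@gdist_ge0)).
  apply: le_trans (hcont _ _ _ _) _ => //.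
  - move=> j; rewrite /b; case: ifPn => // /set0P Fj.
    by rewrite mulr_ge0 // (fine_diam_ge0 (@gdist_ge0)).
  - move=> j y y' l [iy Fy] [iy' Fy']; rewrite /b ifF; last first.
      by apply/negP => /eqP Fj; rewrite Fj in Fy.
    apply: le_trans (lip y y' l iy iy') _; rewrite ler_wpM2l //.
    exact: diam_fine (dF j) Fy Fy'.
  - move=> i y; rewrite inE => /eqP -> iy.
    have iy' : inc y.
      by move=> l; have := iy l; rewrite !mxE !ffunE /= mul0r addr0 add0r.
    by have [j _ Fj] := FA _ (qb y iy'); exists j.
  apply: lee_nneseries => [j _ _|j _].
    rewrite lee_fin exprn_ge0 // mulr_ge0 // /b; case: ifPn => // /set0P Fj.
    by rewrite mulr_ge0 // (fine_diam_ge0 (@gdist_ge0)).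
  rewrite /b /hterm; case: ifPn => _; first by rewrite mulr0 mule0 expr0n -leqn0 leqNgt d0.
  rewrite -EFinM lee_fin /K le_eqVlt; apply/orP; left; apply/eqP.
  set r := fine _; have -> : 14 * (L * r) = (28 * L) * (r / 2) by field.
  rewrite (exprMn _ (28 * L)) -mulrA; congr (_ * _).
  by rewrite mulrA mulVf ?mul1r // gt_eqF.
move: key; set S := (\sum_(0 <= j <oo) _)%E.
have S0 : (0 <= S)%E by apply: nneseries_ge0 => j _ _; exact: (hterm_ge0 (@gdist_ge0)).
case: S S0 => [r|_ _|//]; last by rewrite leey.
rewrite -EFinM !lee_fin => r0 h; rewrite ler_pdivrMr ?ltr_wpDl //.
by apply: le_trans h _; rewrite mulrC ler_wpM2l // lerDl.
Qed.
End GramNorm.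

(** * Quantitative Taylor bounds *)

Section C2bounds.
Variables (R : realType) (n : nat).
Local Notation V := 'rV[R]_n.

Definition inbox (rho : R) (x : V) := forall l, `|x ord0 l| <= rho.

(* [g] is the gradient of [f], with Lipschitz bounds on the box of radius [rho]. *)
Definition c2on (rho L : R) (f : V -> R) (g : 'I_n -> V -> R) := forall x y d, 0 <= d ->
  inbox rho x -> inbox rho y -> (forall l, `|y ord0 l - x ord0 l| <= d) ->
  [/\ `|f x| <= L /\ (forall i, `|g i x| <= L),
      `|f y - f x| <= L * d, (forall i, `|g i y - g i x| <= L * d) &
      `|f y - f x - \sum_i (y ord0 i - x ord0 i) * g i x| <= L * d ^+ 2].

Definition c2 (f : V -> R) := exists g, forall rho, exists2 L, 0 <= L & c2on rho L f g.

Lemma c2_cst c : c2 (fun=> c).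
Proof.
exists (fun _ _ => 0) => rho; exists `|c| => // x y d d0 _ _ h.
split.
- by split => // i; rewrite normr0.
- by rewrite subrr normr0 mulr_ge0.
- by move=> i; rewrite subrr normr0 mulr_ge0.
rewrite big1 => [|i _]; last by rewrite mulr0.
by rewrite !subrr normr0 mulr_ge0 // sqr_ge0.
Qed.

Lemma c2_coord i0 : c2 (fun x => x ord0 i0).
Proof.
exists (fun i _ => (i == i0)%:R) => rho; exists (`|rho| + 1); first by rewrite addr_ge0.
move=> x y d d0 hx hy h; have r1 : 1 <= `|rho| + 1 by rewrite lerDr.
have r0 : 0 <= `|rho| + 1 by exact: le_trans r1.
split.
- split; first by apply: le_trans (hx i0) (le_trans (ler_norm _) _); rewrite lerDl.
  by move=> i; apply: le_trans r1; case: (_ == _); rewrite ?normr1 ?normr0.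
- by apply: le_trans (h i0) _; rewrite ler_peMl.
- by move=> i; rewrite subrr normr0 mulr_ge0.
rewrite (bigD1 i0) //= eqxx mulr1 big1 => [|i /negbTE ->]; last by rewrite mulr0.
by rewrite addr0 subrr normr0 mulr_ge0 // sqr_ge0.
Qed.

Lemma prod_diff_le (a b a' b' A B da db : R) : `|a'| <= A -> `|b| <= B -> `|b' - b| <= db -> `|a' - a| <= da ->
  `|a' * b' - a * b| <= A * db + B * da.
Proof.
move=> hA hB hb ha; have -> : a' * b' - a * b = a' * (b' - b) + b * (a' - a) by ring.
by apply: le_trans (ler_normD _ _) _; rewrite !normrM lerD // ler_pM.
Qed.

Lemma c2M f1 f2 : c2 f1 -> c2 f2 -> c2 (fun x => f1 x * f2 x).
Proof.
move=> [g1 h1] [g2 h2]; exists (fun i x => f1 x * g2 i x + f2 x * g1 i x) => rho.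
have [L1 L10 c1] := h1 rho; have [L2 L20 c2'] := h2 rho.
exists (4 * (L1 * L2)); first by rewrite !mulr_ge0.
move=> x y d d0 hx hy h.
have [[a1 a2] a3 a4 a5] := c1 x y d d0 hx hy h.
have [[b1 b2] b3 b4 b5] := c2' x y d d0 hx hy h.
have h' l : `|x ord0 l - y ord0 l| <= d by rewrite distrC.
have [[a1' a2'] _ _ _] := c1 y x d d0 hy hx h'.
have [[b1' b2'] _ _ _] := c2' y x d d0 hy hx h'.
have LL : 0 <= L1 * L2 by rewrite mulr_ge0.
have LLd : 0 <= L1 * L2 * d by rewrite mulr_ge0.
have LLd2 : 0 <= L1 * L2 * d ^+ 2 by rewrite mulr_ge0 // sqr_ge0.
split.
- split; first by rewrite normrM; apply: le_trans (ler_pM _ _ a1 b1) _ => //; lra.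
  move=> i; apply: le_trans (ler_normD _ _) _; rewrite !normrM.
  have := ler_pM (normr_ge0 _) (normr_ge0 _) a1 (b2 i).
  have := ler_pM (normr_ge0 _) (normr_ge0 _) b1 (a2 i); lra.
- by have := prod_diff_le a1' b1 b3 a3; lra.
- move=> i; rewrite opprD addrACA; apply: le_trans (ler_normD _ _) _.
  have := prod_diff_le a1' (b2 i) (b4 i) a3; have := prod_diff_le b1' (a2 i) (a4 i) b3; lra.
have -> : f1 y * f2 y - f1 x * f2 x - \sum_i (y ord0 i - x ord0 i) * (f1 x * g2 i x + f2 x * g1 i x) =
  f1 x * (f2 y - f2 x - \sum_i (y ord0 i - x ord0 i) * g2 i x) +
  f2 x * (f1 y - f1 x - \sum_i (y ord0 i - x ord0 i) * g1 i x) +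
  (f1 y - f1 x) * (f2 y - f2 x).
  have -> : \sum_i (y ord0 i - x ord0 i) * (f1 x * g2 i x + f2 x * g1 i x) =
    f1 x * (\sum_i (y ord0 i - x ord0 i) * g2 i x) + f2 x * (\sum_i (y ord0 i - x ord0 i) * g1 i x).
    by rewrite !mulr_sumr -big_split; apply: eq_bigr => i _ /=; ring.
  ring.
apply: le_trans (ler_normD _ _) _; apply: le_trans (lerD (ler_normD _ _) (lexx _)) _.
rewrite !normrM.
have := ler_pM (normr_ge0 _) (normr_ge0 _) a1 b5.
have := ler_pM (normr_ge0 _) (normr_ge0 _) b1 a5.
have := ler_pM (normr_ge0 _) (normr_ge0 _) a3 b3.
set u := _ * _ in LLd2 *; nra.
Qed.

Lemma c2_prod (I : Type) (s : seq I) (F : I -> V -> R) :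
  (forall i, c2 (F i)) -> c2 (fun x => \prod_(i <- s) F i x).
Proof.
move=> h; elim: s => [|i s IH].
  by rewrite (_ : (fun x => _) = fun=> 1); [exact: c2_cst | apply/funext => x; rewrite big_nil].
rewrite (_ : (fun x => _) = fun x => F i x * \prod_(j <- s) F j x); first exact: c2M.
by apply/funext => x; rewrite big_cons.
Qed.

Lemma c2X f m : c2 f -> c2 (fun x => f x ^+ m).
Proof.
move=> h; elim: m => [|m IH].
  by rewrite (_ : (fun x => _) = fun=> 1); [exact: c2_cst | apply/funext => x; rewrite expr0].
rewrite (_ : (fun x => _) = fun x => f x * f x ^+ m); first exact: c2M.
by apply/funext => x; rewrite exprS.
Qed.
End C2bounds.

(** * Gradients of polynomials *)

Section PolyDerivative.
Variables (R : realType) (n k : nat).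
Local Notation V := 'rV[R]_n.

Definition monom (a : mon n k) (x : V) : R := \prod_(i < n) x ord0 i ^+ val (val a i).

Lemma c2_monom a : c2 (monom a).
Proof. by apply: c2_prod => i; apply: c2X; exact: c2_coord. Qed.

Definition gmon (a : mon n k) : 'I_n -> V -> R := projT1 (cid (c2_monom a)).

(** The gradient extends linearly a choice of gradients of the monomials, so its bounds scale with
    the coefficients and apply to the difference of two polynomials. *)
Definition pder (p : poly_k R n k) i (x : V) : R := \sum_a p a * gmon a i x.

Lemma peval_c2 rho : exists2 L, 0 <= L & forall (p : poly_k R n k) t, (forall a, `|p a| <= t) -> 0 <= t ->
  c2on rho (L * t) (peval p) (pder p).
Proof.
have /choice[La hLa] a : exists L, 0 <= L /\ c2on rho L (monom a) (gmon a).
  by rewrite /gmon; case: cid => g /= /(_ rho) [L L0 hL]; exists L.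
exists (\sum_a La a); first by apply: sumr_ge0 => a _; case: (hLa a).
move=> p t hp t0 x y d d0 hx hy h.
have sumle (F : mon n k -> R) (e : R) : (forall a, `|F a| <= La a * e) -> 0 <= e ->
    `|\sum_a p a * F a| <= (\sum_a La a) * t * e.
  move=> hF e0; apply: le_trans (ler_norm_sum _ _ _) _; rewrite mulr_suml mulr_suml.
  apply: ler_sum => a _; rewrite normrM mulrAC mulrC.
  by rewrite ler_pM.
have sumle1 (F : mon n k -> R) : (forall a, `|F a| <= La a) -> `|\sum_a p a * F a| <= (\sum_a La a) * t.
  by move=> hF; have := sumle F 1; rewrite mulr1; apply => // a; rewrite mulr1.
have hm a := (hLa a).2 x y d d0 hx hy h.
split.
- split; first by apply: sumle1 => a; case: (hm a) => [[]].
  by move=> i; apply: sumle1 => a; case: (hm a) => [[_ ?]].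
- rewrite /peval -sumrB (eq_bigr (fun a => p a * (monom a y - monom a x))); last by move=> a _; rewrite mulrBr.
  by apply: sumle => // a; case: (hm a).
- move=> i; rewrite /pder -sumrB (eq_bigr (fun a => p a * (gmon a i y - gmon a i x))); last by move=> a _; rewrite mulrBr.
  by apply: sumle => // a; case: (hm a).
rewrite (_ : _ - _ = \sum_a p a * (monom a y - monom a x - \sum_i (y ord0 i - x ord0 i) * gmon a i x)).
  by apply: sumle => [a|]; [case: (hm a) | exact: sqr_ge0].
rewrite /peval /pder -sumrB; under [X in _ - X]eq_bigr => i _ do rewrite mulr_sumr.
rewrite exchange_big -sumrB; apply: eq_bigr => a _ /=.
rewrite !mulrBr mulr_sumr; congr (_ - _); apply: eq_bigr => i _; ring.
Qed.

Definition lform (c : 'I_n -> R) (v : V) : R := \sum_i v ord0 i * c i.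

Fact lform_is_linear c : linear (lform c : V -> R^o).
Proof.
move=> a u v; rewrite /lform scaler_sumr -big_split; apply: eq_bigr => i _ /=.
by rewrite !mxE mulrDl [a *: _]/GRing.scale /= mulrA.
Qed.
HB.instance Definition _ c := GRing.isLinear.Build R V R^o _ (lform c) (lform_is_linear c).
End PolyDerivative.

Section Differential.
Variables (R : realType) (n : nat).
Local Notation V := 'rV[R]_n.

Lemma coord_le_norm (x : V) l : `|x ord0 l| <= `|x|.
Proof.
rewrite -[leRHS]/(mx_norm x) mx_normrE.
exact: (le_bigmax _ (fun ij : 'I_1 * 'I_n => `|x ij.1 ij.2|) (ord0, l)).
Qed.

Lemma lip_at_cvg (f : V -> R) x L : 0 <= L ->
  (forall y, `|y - x| <= 1 -> `|f y - f x| <= L * `|y - x|) -> f y @[y --> x] --> f x.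
Proof.
move=> L0 h; apply/(@cvgrPdist_le _ _ _ (nbhs x) _ f) => e e0; near=> y.
have y1 : `|y - x| <= 1 by rewrite distrC; near: y; apply: cvgr_dist_le.
have ye : `|y - x| <= e / (L + 1).
  by rewrite distrC; near: y; apply: cvgr_dist_le => //; rewrite divr_gt0 // ltr_wpDl.
rewrite distrC; apply: le_trans (h y y1) _; apply: (@le_trans _ _ ((L + 1) * (e / (L + 1)))).
  by rewrite ler_pM // lerDl.
by rewrite mulrCA mulfV ?mulr1 // gt_eqF // ltr_wpDl.
Unshelve. all: by end_near. Qed.

Lemma lform_continuous (c : 'I_n -> R) : continuous (lform c : V -> R).
Proof.
move=> x; apply: (@lip_at_cvg _ _ (\sum_i `|c i|)) => [|y _]; first by apply: sumr_ge0.
rewrite /lform -sumrB; apply: le_trans (ler_norm_sum _ _ _) _; rewrite mulr_suml.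
apply: ler_sum => i _; rewrite -mulrBl normrM mulrC ler_wpM2l //.
by have := coord_le_norm (y - x) i; rewrite !mxE.
Qed.

Variable k : nat.
Implicit Types p : poly_k R n k.

Lemma peval_c2' p rho : exists2 L, 0 <= L & c2on rho L (peval p) (pder p).
Proof.
have [L L0 h] := peval_c2 n k rho; pose t := \sum_a `|p a|.
have t0 : 0 <= t by apply: sumr_ge0.
exists (L * t); first by rewrite mulr_ge0.
by apply: h => // a; rewrite /t (bigD1 a) //= lerDl sumr_ge0.
Qed.

Lemma inbox_near (x y : V) : `|y - x| <= 1 -> inbox (`|x| + 1) y.
Proof.
move=> h l; have -> : y = x + (y - x) by rewrite addrC subrK.
rewrite mxE; apply: le_trans (ler_normD _ _) _; rewrite lerD ?coord_le_norm //.
exact: le_trans (coord_le_norm _ _) h.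
Qed.

Lemma peval_near p x : exists2 L, 0 <= L & forall y, `|y - x| <= 1 ->
  [/\ `|peval p y - peval p x| <= L * `|y - x|,
      forall i, `|pder p i y - pder p i x| <= L * `|y - x| &
      `|peval p y - peval p x - lform (fun i => pder p i x) (y - x)| <= L * `|y - x| ^+ 2].
Proof.
have [L L0 h] := peval_c2' p (`|x| + 1); exists L => // y y1.
have [|||_ a b c] := h x y `|y - x| (normr_ge0 _).
- by apply: inbox_near; rewrite subrr normr0.
- exact: inbox_near.
- by move=> l; have := coord_le_norm (y - x) l; rewrite !mxE.
split => //; move: c; rewrite /lform; congr (`| _ - _ | <= _).
by apply: eq_bigr => i _; rewrite !mxE.
Qed.

Lemma peval_littleo p x :
  (peval p : V -> R) \o shift x = cst (peval p x) + lform (fun i => pder p i x) +o_ (0 : V) id.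
Proof.
have [L L0 h] := peval_near p x; apply/eqaddoP => e e0 /=; near=> z.
have z1 : `|z| <= 1 by rewrite -[z]subr0 -[_ - _]opprB normrN; near: z; apply: cvgr_dist_le.
have ze : `|z| <= e / (L + 1).
  rewrite -[z]subr0 -[_ - _]opprB normrN; near: z; apply: cvgr_dist_le => //.
  by rewrite divr_gt0 // ltr_wpDl.
have [|_ _] := h (z + x); first by rewrite addrK.
rewrite addrK => hz.
have -> : ((peval p : V -> R) \o shift x - (cst (peval p x) + lform (fun i => pder p i x))) z =
   peval p (z + x) - peval p x - lform (fun i => pder p i x) z.
  by rewrite -[LHS]/(peval p (z + x) - (peval p x + lform (fun i => pder p i x) z)) opprD addrA.
apply: le_trans hz _; rewrite expr2 mulrA ler_wpM2r //.
apply: (@le_trans _ _ ((L + 1) * (e / (L + 1)))); first by rewrite ler_pM // lerDl.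
by rewrite mulrCA mulfV ?mulr1 // gt_eqF // ltr_wpDl.
Unshelve. all: by end_near. Qed.

Lemma diff_peval p x : 'd (peval p : V -> R^o) x = lform (fun i => pder p i x) :> (V -> R).
Proof. by apply: diff_unique; [exact: lform_continuous | exact: peval_littleo]. Qed.

Lemma differentiable_peval p x : differentiable (peval p : V -> R^o) x.
Proof.
apply/diff_locallyP; rewrite diff_peval; split; first exact: lform_continuous.
exact: peval_littleo.
Qed.

Lemma lform_delta (c : 'I_n -> R) i : lform c (delta_mx ord0 i) = c i.
Proof.
rewrite /lform (bigD1 i) //= mxE !eqxx mul1r big1 ?addr0 // => j /negbTE ji.
by rewrite mxE ji andbF mul0r.
Qed.

Lemma regular_peval p x v : lform (fun i => pder p i x) v != 0 -> peval p x = 0 ->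
  regular_defining (zero_set p) x (peval p, setT).
Proof.
move=> pv px; split => /=.
- by split => //; exact: openT.
- by move=> y _; exact: differentiable_peval.
- move=> w y _; have [L L0 h] := peval_near p y.
  have dE : (fun z => 'd (peval p : V -> R^o) z w) = (fun z => lform (fun i => pder p i z) w).
    by apply/funext => z; rewrite diff_peval.
  have dEy : 'd (peval p : V -> R^o) y w = lform (fun i => pder p i y) w by rewrite diff_peval.
  rewrite dE dEy; apply: (@lip_at_cvg _ y (L * \sum_i `|w ord0 i|)); first by rewrite mulr_ge0 ?sumr_ge0.
  move=> z z1; rewrite /lform -sumrB; apply: le_trans (ler_norm_sum _ _ _) _.
  rewrite mulrAC mulr_sumr; apply: ler_sum => i _; rewrite -mulrBr normrM mulrC.
  by rewrite ler_wpM2r //; have [] := h z z1.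
- by exists v; rewrite diff_peval.
- by apply/seteqP; split => y /=; rewrite /zero_set /= => -[].
Qed.
End Differential.

(** * Unit normals of zero sets *)

Section Normals.
Variables (R : realType) (n k : nat) (p : poly_k R n k).
Local Notation V := 'rV[R]_n.

Lemma ispol_peval : ispol k (peval p). Proof. by exists p. Qed.

Lemma peval_ivt (x v : V) a b : a <= b -> peval p (x + a *: v) <= 0 -> 0 <= peval p (x + b *: v) ->
  exists2 s, a <= s <= b & peval p (x + s *: v) = 0.
Proof.
move=> ab ha hb; have [r _ hr] := ispol_line x v ispol_peval.
have [|s sab /rootP rs] := @poly_ivt R r a b ab; first by rewrite -!hr ha hb.
by exists s; rewrite ?hr.
Qed.

Lemma lformB (c : 'I_n -> R) (u v : V) : lform c (u - v) = lform c u - lform c v.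
Proof. by rewrite (raddfB (lform c : {linear V -> R^o})). Qed.
Lemma lformD (c : 'I_n -> R) (u v : V) : lform c (u + v) = lform c u + lform c v.
Proof. by rewrite (raddfD (lform c : {linear V -> R^o})). Qed.
Lemma lformZ (c : 'I_n -> R) s (u : V) : lform c (s *: u) = s * lform c u.
Proof. by rewrite /lform mulr_sumr; apply: eq_bigr => i _; rewrite mxE mulrA. Qed.

Variables (x : V) (px : peval p x = 0).
Local Notation A := (lform (fun i => pder p i x)).

(* Moving from [x] by [t v], with [A v = 0], a zero of [p] is found at distance [o(t)]
   by the intermediate value theorem; hence every other defining function has a
   differential that vanishes on [v]. *)
Lemma regular_ker gU (a v : V) : regular_defining (zero_set p) x gU -> A a = 1 -> A v = 0 ->
  ('d (gU.1) x) v = 0.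
Proof.
case: gU => g U /= [[oU Ux] dg _ _ ZU] Aa Av.
have gx : g x = 0.
  by have : [set y | U y /\ g y = 0] x; [rewrite -ZU | case].
apply: contrapT => Bv; pose B := 'd g x.
have B0 : 0 < `|B v| by rewrite normr_gt0; apply/eqP.
pose m := `|v| + `|a| + 1.
have m1 : 1 <= m by rewrite lerDr addr_ge0.
(* The correction along [a] changes [B] by at most a quarter of [t |B v|]; [eta] gives another
   quarter to the remainder of [g], so that [t |B v|] would be at most half of itself. *)
pose kap := Num.min 1 (`|B v| / (4 * (`|B a| + 1))).
have kap0 : 0 < kap by rewrite lt_min ltr01 divr_gt0 // mulr_gt0 // ltr_wpDl.
have kap1 : kap <= 1 by rewrite ge_min lexx.
have kapB : kap * `|B a| <= `|B v| / 4.
  apply: (@le_trans _ _ (`|B v| / (4 * (`|B a| + 1)) * (`|B a| + 1))).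
    by rewrite ler_pM ?(ltW kap0) ?lerDl // ge_min lexx orbT.
  rewrite le_eqVlt; apply/orP; left; apply/eqP; field.
  by rewrite gt_eqF // ltr_wpDl.
pose eta := `|B v| / (4 * m).
have m0 : 0 < m by exact: lt_le_trans m1.
have eta0 : 0 < eta by rewrite divr_gt0 // mulr_gt0.
have [del del0 hdel] : exists2 del, 0 < del & forall z, `|z| < del ->
    U (z + x) /\ `|g (z + x) - B z| <= eta * `|z|.
  have /nbhs_normP[d1 /= d10 hU] : nbhs x U by apply: open_nbhs_nbhs.
  have /eqaddoP /(_ _ eta0) /nbhs_normP[d2 /= d20 h2] := diff_locally (dg x Ux).
  exists (Num.min d1 d2); first by rewrite lt_min d10.
  move=> z; rewrite lt_min => /andP[z1 z2]; split.
    by apply: hU; rewrite /ball_ /= opprD addrCA subrr addr0 normrN.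
  have := h2 z; rewrite /ball_ /= sub0r normrN => /(_ z2).
  by rewrite -[X in `|X|]/(g (z + x) - (g x + B z)) gx add0r.
have [L L0 hL] := peval_near p x.
pose t := Num.min (Num.min (del / (2 * m)) (2 * m)^-1) (kap / (2 * (L + 1) * m ^+ 2)).
have L1 : 0 < L + 1 by rewrite ltr_wpDl.
have t0 : 0 < t.
  rewrite !lt_min; apply/andP; split; first apply/andP; first split.
  - by rewrite divr_gt0 // mulr_gt0.
  - by rewrite invr_gt0 mulr_gt0.
  - by rewrite divr_gt0 // mulr_gt0 ?exprn_gt0 // mulr_gt0.
have td : t * m < del.
  apply: (@le_lt_trans _ _ (del / (2 * m) * m)); first by rewrite ler_wpM2r ?(ltW m0) // !ge_min lexx.
  have -> : del / (2 * m) * m = del / 2 by field; rewrite gt_eqF.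
  lra.
have t1 : t * m <= 1.
  apply: (@le_trans _ _ ((2 * m)^-1 * m)); first by rewrite ler_wpM2r ?(ltW m0) // !ge_min lexx orbT.
  have -> : (2 * m)^-1 * m = 2^-1 by field; rewrite gt_eqF.
  lra.
have tk : L * (t * m) ^+ 2 <= kap * t.
  have h : t * (2 * (L + 1) * m ^+ 2) <= kap.
    by rewrite -ler_pdivlMr ?mulr_gt0 // !ge_min lexx !orbT.
  have := mulr_ge0 (ltW t0) (mulr_ge0 (ltW L1) (sqr_ge0 m)).
  have := ler_wpM2l (ltW t0) h.
  have := mulr_ge0 (mulr_ge0 (ltW t0) (ltW t0)) (sqr_ge0 m).
  have := mulr_ge0 L0 (mulr_ge0 (mulr_ge0 (ltW t0) (ltW t0)) (sqr_ge0 m)).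
  by move: (kap) (L) (m) (t) => ? ? ? ?; lra.
have nw s : `|s| <= kap * t -> `|t *: v + s *: a| <= t * m.
  move=> hs; apply: le_trans (ler_normD _ _) _; rewrite !normrZ gtr0_norm //.
  have : `|s| * `|a| <= t * `|a|.
    by rewrite ler_wpM2r // (le_trans hs) // ler_piMl // ltW.
  by rewrite /m !mulrDr; lra.
have pw s : `|s| <= kap * t -> `|peval p (x + t *: v + s *: a) - s| <= kap * t.
  move=> hs; have nws := nw s hs.
  have e : x + t *: v + s *: a - x = t *: v + s *: a by rewrite addrAC [x + _ - x]addrAC subrr add0r.
  have [|_ _] := hL (x + t *: v + s *: a); first by rewrite e; exact: le_trans t1.
  rewrite px subr0 e lformD !lformZ Av Aa mulr0 add0r mulr1.
  move=> h; apply: le_trans h _; apply: le_trans tk; rewrite ler_wpM2l // lerXn2r ?nnegrE //.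
  by rewrite mulr_ge0 // ltW.
have kt : 0 <= kap * t by rewrite mulr_ge0 // ltW.
have [s sI ps] : exists2 s, - (kap * t) <= s <= kap * t & peval p (x + t *: v + s *: a) = 0.
  apply: peval_ivt; first by lra.
    have := pw (- (kap * t)); rewrite normrN ger0_norm // => /(_ (lexx _)).
    by rewrite ler_norml; lra.
  have := pw (kap * t); rewrite ger0_norm // => /(_ (lexx _)).
  by rewrite ler_norml; lra.
have {}sI : `|s| <= kap * t by rewrite ler_norml.
pose w := t *: v + s *: a.
have [|Uw gw] := hdel w; first exact: le_lt_trans (nw s sI) td.
have gw0 : g (w + x) = 0.
  have : [set y | U y /\ g y = 0] (w + x); last by case.
  by rewrite -ZU; split => //; rewrite /zero_set /= /w addrC addrA.
move: gw; rewrite gw0 sub0r normrN => hB.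
have e1 : B w = t * B v + s * B a by rewrite /B /w linearD !linearZ.
have : t * `|B v| <= `|s| * `|B a| + eta * `|w|.
  have -> : t * `|B v| = `|B w - s * B a| by rewrite e1 addrK normrM gtr0_norm.
  by apply: le_trans (ler_normB _ _) _; rewrite normrM addrC lerD2l.
have : `|s| * `|B a| <= t * (`|B v| / 4).
  apply: (@le_trans _ _ (kap * t * `|B a|)); first by rewrite ler_wpM2r.
  by rewrite mulrAC mulrC ler_wpM2l // ltW.
have : eta * `|w| <= t * (`|B v| / 4).
  apply: (@le_trans _ _ (eta * (t * m))); first by rewrite ler_wpM2l ?nw // ltW.
  rewrite le_eqVlt; apply/orP; left; apply/eqP; rewrite /eta; field; by rewrite gt_eqF.
have := mulr_gt0 t0 B0; lra.
Qed.

(** The normal is computed from an arbitrary defining function. By [regular_ker] its differential is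
    a nonzero multiple of that of [p], and the multiple cancels in the quotient. *)
Lemma abs_normal_peval e v : A v != 0 ->
  abs_normal_comp e (zero_set p) x = `|A e| / Num.sqrt (\sum_i pder p i x ^+ 2).
Proof.
move=> Av; rewrite /abs_normal_comp; case: pselect => [P|]; last first.
  by case; exists (peval p, setT); apply: regular_peval Av px.
case: (cid P) => -[g U] reg /=.
pose a := (A v)^-1 *: v; have Aa : A a = 1 by rewrite lformZ mulVf.
have Bk := @regular_ker (g, U) a _ reg Aa.
pose B := 'd g x; have BA w : B w = B a * A w.
  have : B (w - A w *: a) = 0 by apply: Bk; rewrite lformB lformZ Aa mulr1 subrr.
  by rewrite /B linearB linearZ /= => /eqP; rewrite subr_eq0 => /eqP ->; rewrite mulrC.
have Ba : B a != 0.
  case: reg => _ _ _ [w Bw] _; apply: contraNneq Bw => Ba0.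
  by rewrite -[X in X == 0]/(B w) BA Ba0 mul0r.
rewrite -/B BA normrM.
have -> : \sum_(i < n) B (delta_mx ord0 i) ^+ 2 = B a ^+ 2 * \sum_i pder p i x ^+ 2.
  by rewrite mulr_sumr; apply: eq_bigr => i _; rewrite BA lform_delta exprMn.
rewrite sqrtrM ?sqr_ge0 // sqrtr_sqr invfM mulrACA mulfV ?mul1r //.
by rewrite normr_eq0.
Qed.
End Normals.

(** * Covering tubes around nearly flat pieces *)

Section Tubes.
Variables (R : realType) (n : nat).
Local Notation V := 'rV[R]_n.

(** The factors come from the [4 om / r] slabs, the [(5 / th) ^ (n - 1)] cells in each slab, and the
    side [n (n + 3) th r] of a cell multiplied by the 7 of [content_family]. *)
Definition tubeK : R := 4 * 5 ^+ n.-1 * (7 * n%:R * (n%:R + 3)) ^+ n.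

Lemma big_coord (nu : 'I_n -> R) : \sum_i nu i ^+ 2 = 1 -> exists i, n%:R^-1 <= `|nu i|.
Proof.
move=> nu1; apply: contrapT => h.
have nu_lt i : `|nu i| < n%:R^-1 by rewrite ltNge; apply/negP => hi; apply: h; exists i.
have [n0|n0] := posnP n.
  by move: nu1; rewrite big1 => [/eqP|i]; [rewrite eq_sym oner_eq0 | exfalso; have := ltn_ord i; rewrite {2}n0].
have n1 : n%:R^-1 <= 1 :> R by rewrite invf_le1 ?ltr0n // ler1n.
have : \sum_i nu i ^+ 2 < \sum_(i < n) n%:R^-1.
  apply: ltr_sum; first by apply/hasP; exists (Ordinal n0) => //; rewrite mem_index_enum.
  move=> i _; rewrite -real_normK ?num_real // expr2.
  apply: (@le_lt_trans _ _ (`|nu i| * 1)); last by rewrite mulr1.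
  by rewrite ler_wpM2l // (le_trans (ltW (nu_lt i))).
by rewrite nu1 sumr_const card_ord -[X in _ < X]mulr_natl mulfV ?ltxx // pnatr_eq0 -lt0n.
Qed.

(* The tube is cut in pieces of length [r]; each piece is a slab of width comparable to
   [theta r], which is cut in cells of that size. *)
Lemma tube_cover (U : set V) (y0 w : V) (nu : 'I_n -> R) (om th r : R) :
  0 < th <= 1 -> 0 < r <= om -> \sum_i nu i ^+ 2 = 1 ->
  (forall y l, U y -> `|y ord0 l - y0 ord0 l| <= r) ->
  (forall y, U y -> `|lform nu (y - y0)| <= th * r) ->
  `|lform nu w| <= th * om -> (forall l, `|w ord0 l| <= om) ->
  exists (C : finType) (B : C -> set V) (b : R),
  [/\ 0 < b, forall c (x x' : V) l, B c x -> B c x' -> `|x ord0 l - x' ord0 l| <= b,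
      forall x s, -1 <= s <= 2 -> U (x + s *: w) -> exists c, B c x &
      #|C|%:R * (7 * b) ^+ n <= tubeK * om * th * r ^+ n.-1].
Proof.
move=> /andP[th0 th1] /andP[r0 rom] nu1 hU hnu hw wom.
have om0 : 0 < om by exact: lt_le_trans rom.
have [i0 hi0] := big_coord nu1.
have n0 : (0 < n)%N by apply: leq_ltn_trans (ltn_ord i0).
have n0' : 0 < n%:R :> R by rewrite ltr0n.
have nu_le i : `|nu i| <= 1.
  rewrite -(@ler_pXn2r _ 2) ?nnegrE // expr1n real_normK ?num_real // -nu1.
  by rewrite (bigD1 i) //= lerDl sumr_ge0 // => j _; exact: sqr_ge0.
(* The parameter [s] runs over an interval of length 3 cut in steps [r / om]; within a slab every
   coordinate varies in an interval of length [4 r], cut in steps [th r]. *)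
pose P := (Num.truncn (3 * om / r)).+1.
pose Wd := (Num.truncn (4 / th)).+1.
pose xb (p : nat) : V := y0 - (-1 + p%:R * r / om) *: w.
pose b := n%:R * (n%:R + 3) * th * r.
have b0 : 0 < b by rewrite !mulr_gt0 // addr_gt0.
pose B (c : 'I_P * {ffun 'I_n.-1 -> 'I_Wd}) : set V := [set x | exists s,
  [/\ U (x + s *: w), -1 + c.1%:R * r / om <= s <= -1 + (c.1%:R + 1) * r / om &
      forall l, (c.2 l)%:R * (th * r) <= x ord0 (lift i0 l) - xb c.1 ord0 (lift i0 l) + 2 * r
          <= ((c.2 l)%:R + 1) * (th * r)]].
have tr0 : 0 < th * r by rewrite mulr_gt0.
have dxb x s (p : nat) l : U (x + s *: w) -> -1 + p%:R * r / om <= s <= -1 + (p%:R + 1) * r / om ->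
    `|x ord0 l - xb p ord0 l| <= 2 * r.
  move=> Ux hs; have := hU _ l Ux; rewrite /xb !mxE.
  set sp := -1 + _; have hsp : `|s - sp| <= r / om.
    have e : -1 + (p%:R + 1) * r / om = sp + r / om by rewrite /sp; ring.
    have ro : 0 <= r / om by rewrite divr_ge0 // ltW.
    by move: hs; rewrite e -/sp ler_norml; lra.
  move=> h1; have -> : x ord0 l - (y0 ord0 l - sp * w ord0 l) =
     (x ord0 l + s * w ord0 l - y0 ord0 l) - (s - sp) * w ord0 l by ring.
  apply: le_trans (ler_normB _ _) _; rewrite normrM.
  have : `|s - sp| * `|w ord0 l| <= r / om * om by rewrite ler_pM.
  by rewrite mulfVK ?gt_eqF //; lra.
exists ('I_P * {ffun 'I_n.-1 -> 'I_Wd})%type, B, b; split => //.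
- move=> [p g] x x' l [s [Us hs hg]] [s' [Us' hs' hg']] /=.
  have hlift (l' : 'I_n.-1) : `|x ord0 (lift i0 l') - x' ord0 (lift i0 l')| <= th * r.
    have := hg l'; have := hg' l'; rewrite /= ler_norml; lra.
  have trb : th * r <= b.
    rewrite /b -mulrA; apply: ler_peMl; first exact: ltW.
    by have : 1 <= n%:R :> R; [rewrite ler1n | nra].
  have [l' ->|->] := unliftP i0 l; first by apply: le_trans (hlift l') trb.
  (* The coordinate [i0] is not subdivided: it is recovered from the others and the component along
     [nu], because [nu i0] is at least [1 / n] in modulus. *)
  have hnn : `|lform nu (x - x')| <= 3 * (th * r).
    have -> : x - x' = ((x + s *: w) - y0) - ((x' + s' *: w) - y0) - (s - s') *: w.
      by apply/rowP => i; rewrite !mxE; ring.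
    rewrite 2!lformB lformZ; apply: le_trans (ler_normB _ _) _.
    apply: le_trans (lerD (ler_normB _ _) (lexx _)) _.
    have := hnu _ Us; have := hnu _ Us'; rewrite normrM.
    have hss : `|s - s'| <= r / om.
      have e : -1 + (p%:R + 1) * r / om = -1 + p%:R * r / om + r / om by ring.
      by move: hs hs'; rewrite /= e ler_norml; move: (p%:R * r / om) (r / om) => ? ?; lra.
    have : `|s - s'| * `|lform nu w| <= r / om * (th * om) by rewrite ler_pM.
    have -> : r / om * (th * om) = th * r by field; rewrite gt_eqF.
    by lra.
  have hsum : `|\sum_(l' < n.-1) (x ord0 (lift i0 l') - x' ord0 (lift i0 l')) * nu (lift i0 l')| <= n%:R * (th * r).
    apply: le_trans (ler_norm_sum _ _ _) _; apply: (@le_trans _ _ (\sum_(l' < n.-1) th * r)).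
      apply: ler_sum => l' _; rewrite normrM -[leRHS]mulr1 ler_pM //.
    rewrite sumr_const card_ord -[leLHS]mulr_natl ler_wpM2r ?(ltW tr0) // ler_nat leq_pred.
    by [].
  have hmain : `|(x ord0 i0 - x' ord0 i0) * nu i0| <= (n%:R + 3) * (th * r).
    have e : lform nu (x - x') = (x ord0 i0 - x' ord0 i0) * nu i0 +
       \sum_(l' < n.-1) (x ord0 (lift i0 l') - x' ord0 (lift i0 l')) * nu (lift i0 l').
      rewrite /lform (bigD1_ord i0) //= !mxE; congr (_ + _).
      by apply: eq_bigr => l' _; rewrite !mxE.
    have -> : (x ord0 i0 - x' ord0 i0) * nu i0 = lform nu (x - x') -
       \sum_(l' < n.-1) (x ord0 (lift i0 l') - x' ord0 (lift i0 l')) * nu (lift i0 l').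
      by rewrite e addrK.
    by apply: le_trans (ler_normB _ _) _; lra.
  move: hmain; rewrite normrM => hmain.
  have : `|x ord0 i0 - x' ord0 i0| * n%:R^-1 <= (n%:R + 3) * (th * r).
    by apply: le_trans hmain; rewrite ler_wpM2l.
  by rewrite ler_pdivrMr // /b; move: (`|_|) => u; lra.
- move=> x s hs Us.
  pose t := (s + 1) * om / r.
  have t0 : 0 <= t by rewrite !mulr_ge0 ?invr_ge0 ?(ltW om0) ?(ltW r0) //; lra.
  have tP : (Num.truncn t < P)%N.
    rewrite /P ltnS le_truncn // ler_pM2r ?invr_gt0 // ler_pM2r //; lra.
  have /andP[t1 t2] := truncn_itv t0.
  have sE : s = -1 + t * r / om by rewrite /t; field; rewrite !gt_eqF.
  have hp : -1 + (Num.truncn t)%:R * r / om <= s <= -1 + ((Num.truncn t)%:R + 1) * r / om.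
    rewrite {1 2}sE !lerD2l !ler_pM2r ?invr_gt0 // t1 /=; apply: ltW.
    by rewrite natr1.
  have /choice[g hg] : forall l : 'I_n.-1, exists g : 'I_Wd, g%:R * (th * r) <=
      x ord0 (lift i0 l) - xb (Num.truncn t) ord0 (lift i0 l) + 2 * r <= (g%:R + 1) * (th * r).
    move=> l; set v := _ + _; have hv : 0 <= v <= 4 * r.
      by have := dxb _ _ _ (lift i0 l) Us hp; rewrite /v ler_norml; lra.
    have v0 : 0 <= v / (th * r) by rewrite divr_ge0 ?(ltW tr0) //; lra.
    have vW : (Num.truncn (v / (th * r)) < Wd)%N.
      rewrite /Wd ltnS le_truncn // ler_pdivrMr //.
      have -> : 4 / th * (th * r) = 4 * r by field; rewrite gt_eqF.
      lra.
    exists (Ordinal vW) => /=; have /andP[u1 /ltW u2] := truncn_itv v0.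
    by rewrite -ler_pdivlMr // u1 /= -ler_pdivrMr // natr1.
  by exists (Ordinal tP, [ffun l => g l]); exists s; split => //= l; rewrite ffunE.
rewrite card_prod card_ffun !card_ord natrM natrX.
have P4 : P%:R <= 4 * om / r.
  have u0 : 0 <= 3 * om / r by rewrite divr_ge0 ?mulr_ge0 ?ltW.
  have /andP[u1 _] := truncn_itv u0; rewrite /P -natr1.
  have : 1 <= om / r by rewrite ler_pdivlMr // mul1r.
  by move: u1; rewrite -![_ * om / r]mulrA; move: (om / r) (_%:R) => ? ?; lra.
have W5 : Wd%:R <= 5 / th.
  have u0 : 0 <= 4 / th by rewrite divr_ge0 ?ltW.
  have /andP[u1 _] := truncn_itv u0; rewrite /Wd -natr1.
  have : 1 <= th^-1 by rewrite invf_ge1.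
  by move: u1; move: (th^-1) (_%:R) => ? ?; lra.
apply: (@le_trans _ _ (4 * om / r * (5 / th) ^+ n.-1 * (7 * b) ^+ n)).
  apply: ler_wpM2r; first by rewrite exprn_ge0 // mulr_ge0 // ltW.
  apply: ler_pM => //.
  by apply: lerXn2r; rewrite ?nnegrE // divr_ge0 // ltW.
rewrite le_eqVlt; apply/orP; left; apply/eqP.
have bE : 7 * b = (7 * n%:R * (n%:R + 3)) * th * r by rewrite /b; ring.
have powS (u : R) : u ^+ n = u * u ^+ n.-1 by rewrite -exprS prednK.
rewrite bE /tubeK; set a := 7 * n%:R * _.
rewrite (exprMn n (a * th)) (exprMn n a) (powS th) (powS r) expr_div_n.
have := expf_neq0 n.-1 (negbT (gt_eqF th0)).
move: (th ^+ n.-1) (r ^+ n.-1) (a ^+ n) (5 ^+ n.-1) => t rr aa f t0.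
by field; rewrite t0 !gt_eqF.
Qed.
End Tubes.

(** * Lower bounds for layer-cake integrals *)

Section LayerCake.
Variables (R : realType).
Local Notation D := [set t : R | (0 <= t)%R].

(** The integral of a nonnegative function is a supremum over the simple functions below it, which
    gives monotonicity for arbitrary integrands. *)
Lemma le_integral_ge0 (f g : R -> \bar R) :
  (forall t, D t -> 0 <= f t)%E -> (forall t, D t -> f t <= g t)%E ->
  (\int[lebesgue_measure]_(t in D) f t <= \int[lebesgue_measure]_(t in D) g t)%E.
Proof.
move=> f0 fg; rewrite !ge0_integralE //; last by move=> t Dt; apply: le_trans (fg t Dt); exact: f0.
apply: ereal_sup_le => _ [h hf <-]; exists h => // t.
apply: le_trans (hf t) _; rewrite /patch; case: ifPn => //.
by rewrite inE; exact: fg.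
Qed.

Lemma measurable_halfline : measurable D.
Proof.
rewrite (_ : D = `[0, +oo[%classic) //; apply/seteqP; split => t /=; rewrite in_itv /= ?andbT //.
Qed.

Lemma hint_ge_step (T : Type) (mu : set T -> \bar R) (f : T -> \bar R) (A : set T)
    (J : nat) (a b c : nat -> R) :
  (forall X, 0 <= mu X)%E -> (forall j, 0 <= c j) -> (forall j, 0 <= a j <= b j) ->
  (forall i j t, a i < t < b i -> a j < t < b j -> i = j) ->
  (forall j t, (j < J)%N -> a j < t < b j -> ((c j)%:E <= mu [set x | A x /\ (t%:E < f x)%E])%E) ->
  ((\sum_(j < J) c j * (b j - a j))%:E <= hint mu f A)%E.
Proof.
move=> mu0 c0 ab dis hc.
pose h t : \bar R := (\sum_(j <- iota 0 J) (c j)%:E * (\1_(`]a j, b j[%classic) t)%:E)%E.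
have h0 t : (0 <= h t)%E.
  by apply: sume_ge0 => j _; rewrite mule_ge0 // lee_fin.
apply: (@le_trans _ _ (\int[lebesgue_measure]_(t in D) h t)%E); last first.
  apply: le_integral_ge0 => // t t0; rewrite /h.
  have [[j [jJ tj]]|nj] := pselect (exists j, (j < J)%N /\ a j < t < b j).
    rewrite (bigD1_seq j) ?iota_uniq ?mem_iota //= big1 ?adde0; last first.
      move=> i ij; rewrite indicE memNset ?mule0 //= in_itv /= => ti.
      by move/eqP: ij; apply; exact: dis ti tj.
    rewrite indicE mem_set /= ?mule1; last by rewrite in_itv.
    exact: hc.
  rewrite big1_seq // => j /andP[_]; rewrite mem_iota /= add0n => jJ.
  rewrite indicE memNset ?mule0 //= in_itv /= => tj.
  by apply: nj; exists j.
rewrite /h ge0_integral_sum //; last 3 first.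
- exact: measurable_halfline.
- move=> j; apply: measurable_funeM; apply/measurable_realfun.measurable_EFinP.
  by apply: measurable_realfun.measurable_indic; exact: measurable_itv.
- by move=> j t _; rewrite mule_ge0 // lee_fin.
rewrite -sumEFin -(big_mkord xpredT (fun j => (c j * (b j - a j))%:E)) /index_iota subn0.
rewrite le_eqVlt; apply/orP; left; apply/eqP; apply: eq_bigr => j _.
have mI : measurable_fun D (EFin \o (\1_(`]a j, b j[%classic) : R -> R)).
  apply/measurable_realfun.measurable_EFinP.
  by apply: measurable_realfun.measurable_indic; exact: measurable_itv.
rewrite (@ge0_integralZl_EFin _ _ _ lebesgue_measure D measurable_halfline) //.
rewrite integral_indic //; last exact: measurable_halfline.
rewrite (_ : `]a j, b j[%classic `&` D = `]a j, b j[%classic); last first.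
  apply/seteqP; split => t /=; [by case|]; rewrite in_itv /= => tj; split => //.
  by have := ab j; move/andP: tj => [+ _]; lra.
have := @lebesgue_measure_itv R `]a j, b j[; rewrite /= lte_fin => ->.
case: ltP => h1; first by rewrite -EFinB -EFinM.
have -> : b j = a j by apply/eqP; rewrite eq_le h1; case/andP: (ab j).
by rewrite subrr mulr0 mule0.
Qed.
End LayerCake.

(** * A Crofton type inequality *)

Section Crofton.
Variables (R : realType) (n k : nat) (q : poly_k R n k).
Local Notation V := 'rV[R]_n.
Local Notation A y := (lform (fun i => pder q i y)).
Local Notation Hn := (haus (@Defs.edist R n) n.-1).

(** The first 4 is lost in the dyadic layers of the angle; [4 ^+ n.-1] combines the halved diameters
    of [hterm] with the loss in [pow_add_le]. *)
Definition crK : R := 4 * @tubeK R n * 4 ^+ n.-1 / omega R n.-1.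

Lemma tubeK_gt0 : (0 < n)%N -> 0 < @tubeK R n.
Proof.
move=> n0; rewrite /tubeK mulr_gt0 ?mulr_gt0 ?exprn_gt0 // !mulr_gt0 ?ltr0n //.
Qed.

Lemma lform_CS (c : 'I_n -> R) (e : V) : edot e e = 1 ->
  `|lform c e| <= Num.sqrt (\sum_i c i ^+ 2).
Proof.
move=> e1; set g := \sum_i _; have g0 : 0 <= g by apply: sumr_ge0 => i _; exact: sqr_ge0.
rewrite -sqrtr_sqr ler_wsqrtr //; set s := lform c e.
have : 0 <= \sum_i (g * e ord0 i - s * c i) ^+ 2 by apply: sumr_ge0 => i _; exact: sqr_ge0.
have expand (a b : R) : \sum_i (a * e ord0 i - b * c i) ^+ 2 =
    a ^+ 2 * (\sum_i e ord0 i * e ord0 i) - 2 * a * b * (\sum_i e ord0 i * c i) + b ^+ 2 * (\sum_i c i ^+ 2).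
  by rewrite !mulr_sumr -sumrB -big_split; apply: eq_bigr => i _ /=; ring.
rewrite expand -/g -/(lform c e) -/s -/(edot e e).
rewrite e1; have -> : g ^+ 2 * 1 - 2 * g * s * s + s ^+ 2 * g = g * (g - s ^+ 2) by ring.
have [g00|g00] := eqVneq g 0; last by rewrite pmulr_rge0 ?subr_ge0 // lt0r g00.
move=> _; suff -> : s = 0 by rewrite expr0n g00.
apply: big1 => i _; have : c i ^+ 2 <= g.
  by rewrite /g (bigD1 i) //= lerDl; apply: sumr_ge0 => j _; exact: sqr_ge0.
rewrite g00 => h; have : c i ^+ 2 == 0 by rewrite eq_le h sqr_ge0.
by rewrite sqrf_eq0 => /eqP ->; rewrite mulr0.
Qed.

(** Pieces of diameter 0 have to be thickened by some [rh > 0]; the excess enters linearly, hence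
    can be summed. *)
Lemma pow_add_le (r rh : R) p : 0 <= r -> 0 <= rh <= 1 -> (r + rh) ^+ p <= 2 ^+ p * (r ^+ p + rh).
Proof.
move=> r0 /andP[h0 h1]; case: p => [|p]; first by rewrite !expr0; lra.
have hp : rh ^+ p.+1 <= rh by rewrite exprS ler_piMr // exprn_ile1.
have [h|h] := leP r rh.
  apply: (@le_trans _ _ ((2 * rh) ^+ p.+1)).
    by rewrite lerXn2r ?nnegrE ?addr_ge0 ?mulr_ge0 //; lra.
  by rewrite exprMn ler_wpM2l ?exprn_ge0 //; have := exprn_ge0 p.+1 r0; lra.
apply: (@le_trans _ _ ((2 * r) ^+ p.+1)).
  by rewrite lerXn2r ?nnegrE ?addr_ge0 ?mulr_ge0 //; lra.
by rewrite exprMn ler_wpM2l ?exprn_ge0 //; lra.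
Qed.

Lemma half_lt (x : R) : 0 < x -> exists j : nat, (2^-1 : R) ^+ j < x.
Proof.
move=> x0; have q01 : `|2^-1 : R| < 1 by rewrite ger0_norm; lra.
have := cvg_expr q01 => /(@cvgr_dist_lt _ R^o) /(_ x x0) [N _ hN].
by exists N; have := hN N (leqnn N); rewrite /= sub0r normrN => /(le_lt_trans (ler_norm _)).
Qed.

Lemma cube_inbox (m : cube_index n) : exists2 rho : R, 0 <= rho & forall y, cube m y -> inbox rho y.
Proof.
exists (\sum_l (`|(m l)%:~R| + 1)); first by apply: sumr_ge0 => l _; rewrite addr_ge0.
move=> y hy l; rewrite (bigD1 l) //=; apply: (@le_trans _ _ (`|(m l)%:~R| + 1)).
  have := hy l; have := ler_norm ((m l)%:~R : R); have := ler_norm (- (m l)%:~R : R).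
  by rewrite normrN ler_norml; lra.
by rewrite lerDl; apply: sumr_ge0 => j _; rewrite addr_ge0.
Qed.

Section Main.
Variables (m : cube_index n) (w e : V) (om tau : R).
Hypotheses (n0 : (0 < n)%N) (om0 : 0 < om) (tau0 : 0 < tau).
Hypotheses (we : w = om *: e) (e1 : edot e e = 1).

Let gam y := Num.sqrt (\sum_i pder q i y ^+ 2).
Let theta y := `|A y e| / gam y.
(** Dyadic layers of the cosine between [e] and the normal. The threshold [tau] excludes singular
    points and bounds the cosine below, so finitely many layers suffice. *)
Let Sl j : set V := [set y | [/\ peval q y = 0, cube m y, tau <= `|A y w| &
   (2^-1) ^+ j.+1 < theta y <= (2^-1) ^+ j]].

Let Aw y : A y w = om * A y e. Proof. by rewrite we lformZ. Qed.

Let Ae_ge y : tau <= `|A y w| -> tau / om <= `|A y e|.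
Proof. by rewrite Aw normrM (gtr0_norm om0) mulrC ler_pdivrMr. Qed.

Let gam_ge y : tau <= `|A y w| -> tau / om <= gam y.
Proof. by move=> h; apply: le_trans (Ae_ge h) _; exact: lform_CS. Qed.

Let tom0 : 0 < tau / om. Proof. by rewrite divr_gt0. Qed.

(** The values of [t] between [2 ^ - (j + 2)] and [2 ^ - (j + 1)] lie below the integrand on layer
    [j]. These intervals are disjoint, so the layers add up in the layer-cake integral. *)
Lemma surf_ge_levels (J : nat) (c : nat -> R) : (forall j, 0 <= c j) ->
  (forall j, (j < J)%N -> ((c j)%:E <= Hn (Sl j))%E) ->
  ((\sum_(j < J) c j * (2^-1) ^+ j.+2)%:E <= surf e (zero_set q) (cube m))%E.
Proof.
move=> c0 hc; rewrite /surf.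
have h2 j : 0 < (2^-1 : R) ^+ j by rewrite exprn_gt0 // invr_gt0.
have -> : \sum_(j < J) c j * (2^-1) ^+ j.+2 = \sum_(j < J) c j * ((2^-1) ^+ j.+1 - (2^-1) ^+ j.+2).
  by apply: eq_bigr => j _; congr (_ * _); rewrite !exprS; lra.
apply: (@hint_ge_step _ _ _ _ _ J (fun j => (2^-1) ^+ j.+2) (fun j => (2^-1) ^+ j.+1)) => //.
- by move=> X; apply: haus_ge0; exact: eucl_dist_ge0.
- by move=> j; rewrite ltW // ler_wiXn2l // ?invr_ge0 //; lra.
- have mono i j : (i < j)%N -> (2^-1 : R) ^+ j.+1 <= (2^-1) ^+ i.+2.
    by move=> ij; rewrite ler_wiXn2l // ?invr_ge0 //; lra.
  move=> i j t /andP[i1 i2] /andP[j1 j2].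
  case: (ltngtP i j) => // ij; exfalso.
    by have := lt_le_trans j2 (mono _ _ ij); rewrite ltNge ltW.
  by have := lt_le_trans i2 (mono _ _ ij); rewrite ltNge ltW.
move=> j t jJ /andP[t1 t2]; apply: le_trans (hc j jJ) _; apply: le_haus => y [qy cy tw /andP[th1 th2]].
split => //; rewrite lte_fin (@abs_normal_peval _ _ _ q y qy e w); last first.
  by rewrite -normr_gt0; exact: lt_le_trans tw.
by apply: lt_trans th1.
Qed.

(* On a small piece of the zero set, the remainder of the Taylor expansion is negligible
   with respect to the angle between [e] and the tangent plane. *)
Lemma flat_pieces : exists2 del : R, 0 < del & exists2 th0 : R, 0 < th0 &
  (forall y, cube m y -> tau <= `|A y w| -> th0 <= theta y <= 1) /\
  forall j (U : set V) rh, (diam (@Defs.edist R n) U <= (del / 2)%:E)%E -> 0 < rh <= del / 2 -> rh <= 1 ->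
  exists (C : finType) (B : C -> set V) (b : R),
  [/\ 0 < b, forall c (x x' : V) l, B c x -> B c x' -> `|x ord0 l - x' ord0 l| <= b,
      forall x s, -1 <= s <= 2 -> U (x + s *: w) -> Sl j (x + s *: w) -> exists c, B c x &
      #|C|%:R * (7 * b) ^+ n <= @tubeK R n * om * (2^-1) ^+ j *
        (2 ^+ n.-1 * (2 ^+ n.-1 / omega R n.-1 * fine (hterm (@Defs.edist R n) n.-1 U) + rh))].
Proof.
have [rho rho0 hrho] := cube_inbox m; have [L L0 hL] := peval_c2' q rho.
pose th0 := tau / om / (n%:R * L + 1).
have nL0 : 0 < n%:R * L + 1 by rewrite ltr_wpDl // mulr_ge0.
have th00 : 0 < th0 by rewrite divr_gt0.
(* For pieces smaller than [del] the quadratic remainder [L r ^ 2] is at most [th0 (tau / om) r],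
   which is below the cosine times the gradient times [r]. *)
pose del := Num.min (Num.min om 1) (th0 * (tau / om) / (L + 1)).
have L1 : 0 < L + 1 by rewrite ltr_wpDl.
have del0 : 0 < del by rewrite !lt_min om0 ltr01 /= divr_gt0 // mulr_gt0.
have delom : del <= om by rewrite !ge_min lexx.
have delL : del * L <= th0 * (tau / om).
  apply: (@le_trans _ _ (del * (L + 1))); first by rewrite ler_wpM2l ?lerDl // ltW.
  by rewrite -ler_pdivlMr // !ge_min lexx orbT.
have gam_le y : cube m y -> gam y <= n%:R * L.
  move=> cy; have [|[_ hg] _ _ _] := hL y y 0 (lexx 0) (hrho y cy) (hrho y cy).
    by move=> l; rewrite subrr normr0.
  have nL : 0 <= n%:R * L by rewrite mulr_ge0.
  rewrite -[leRHS](ger0_norm nL) -sqrtr_sqr ler_wsqrtr //.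
  apply: (@le_trans _ _ (\sum_(i < n) L ^+ 2)).
    by apply: ler_sum => i _; rewrite -real_normK ?num_real // lerXn2r ?nnegrE.
  rewrite sumr_const card_ord exprMn -[leLHS]mulr_natl ler_wpM2r ?sqr_ge0 //.
  by rewrite -natrX ler_nat -{1}(expn1 n) leq_pexp2l.
have th0gam y : cube m y -> tau <= `|A y w| -> th0 * gam y <= `|A y e|.
  move=> cy tw; apply: le_trans (Ae_ge tw); rewrite /th0 mulrAC ler_pdivrMr //.
  apply: ler_wpM2l; first exact: ltW.
  by apply: le_trans (gam_le y cy) _; rewrite lerDl.
exists del => //; exists th0 => //; split.
  move=> y cy tw; have g0 : 0 < gam y by apply: lt_le_trans (gam_ge tw).
  apply/andP; split; first by rewrite /theta ler_pdivlMr //; exact: th0gam.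
  by rewrite /theta ler_pdivrMr // mul1r lform_CS.
move=> j U rh dU /andP[rh0 rhd] rh1.
set r := fine (diam (@Defs.edist R n) U).
have om_ : 0 < omega R n.-1 := omega_gt0 R n.-1.
have [[y0 [Uy0 Sy0]]|nU] := pselect (exists y0, U y0 /\ Sl j y0); last first.
  exists void, (fun=> set0), 1; split => //.
  - by move=> x s _ Ux Sx; case: nU; exists (x + s *: w).
  rewrite card_void mul0r mulr_ge0 ?mulr_ge0 ?(ltW (tubeK_gt0 n0)) ?(ltW om0) ?exprn_ge0 ?invr_ge0 //.
  rewrite addr_ge0 ?(ltW rh0) // mulr_ge0 ?divr_ge0 ?exprn_ge0 ?(ltW om_) //.
  by rewrite fine_ge0 // hterm_ge0 //; exact: eucl_dist_ge0.
have [qy0 cy0 tw0 /andP[ty1 ty2]] := Sy0.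
have g0 : 0 < gam y0 by apply: lt_le_trans (gam_ge tw0).
have r0 : 0 <= r by apply: fine_diam_ge0; [exact: eucl_dist_ge0 | exists y0].
have rd : r <= del / 2.
  move: dU; rewrite /r; have := @fine_diam_ge0 _ _ _ (@eucl_dist_ge0 R n) U (ex_intro _ y0 Uy0).
  by case: (diam _ U) => [d||] //= _; rewrite ?lee_fin // => _; rewrite divr_ge0 // ltW.
pose nu i := pder q i y0 / gam y0.
have nuE v : lform nu v = A y0 v / gam y0.
  by rewrite /lform mulr_suml; apply: eq_bigr => i _; rewrite /nu mulrA.
pose r' := r + rh.
have r'0 : 0 < r' by rewrite ltr_wpDl.
have r'd : r' <= del by rewrite /r'; lra.
have th1 : 0 < (2^-1 : R) ^+ j <= 1 by rewrite exprn_gt0 ?invr_gt0 // exprn_ile1 ?invr_ge0 //; lra.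
have th0j : th0 <= (2^-1) ^+ j.
  apply: le_trans ty2; rewrite /theta ler_pdivlMr //.
  exact: th0gam.
have dUl y l : U y -> `|y ord0 l - y0 ord0 l| <= r.
  move=> Uy; apply: le_trans (diam_fine dU Uy Uy0).
  by have := coord_le_enorm (y - y0) l; rewrite !mxE.
have [||||||C [B [b [b0 hB cov cnt]]]] :=
    @tube_cover R n (U `&` Sl j) y0 w nu om ((2^-1) ^+ j) r' th1.
- by rewrite r'0 (le_trans r'd).
- under eq_bigr => i _ do rewrite expr_div_n.
  rewrite -mulr_suml -[X in X / _]sqr_sqrtr; last by apply: sumr_ge0 => i _; exact: sqr_ge0.
  by rewrite mulfV // expf_neq0 // gt_eqF.
- by move=> y l [Uy _]; apply: le_trans (dUl y l Uy) _; rewrite lerDl ltW.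
- move=> y [Uy [qy cy _ _]]; rewrite nuE normrM (gtr0_norm (_ : 0 < (gam y0)^-1)) ?invr_gt0 //.
  rewrite ler_pdivrMr //.
  have [|_ _ _] := hL y0 y r r0 (hrho _ cy0) (hrho _ cy); first by move=> l; exact: dUl.
  rewrite qy qy0 subrr sub0r normrN.
  have -> : \sum_i (y ord0 i - y0 ord0 i) * pder q i y0 = A y0 (y - y0).
    by apply: eq_bigr => i _; rewrite !mxE.
  move=> h; apply: le_trans h _; apply: (@le_trans _ _ (th0 * (tau / om) * r')).
    apply: (@le_trans _ _ (del * L * r')); last by rewrite ler_wpM2r // ltW.
    have rr' : r <= r' by rewrite lerDl ltW.
    rewrite expr2 [del * L]mulrC -mulrA ler_wpM2l // ler_pM //; lra.
  rewrite -mulrA [tau / om * r']mulrC mulrA.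
  apply: ler_pM; last exact: gam_ge.
  - by rewrite mulr_ge0 ?(ltW th00) ?(ltW r'0).
  - exact: ltW.
  - by apply: ler_wpM2r => //; exact: ltW.
- rewrite nuE Aw normrM (gtr0_norm (_ : 0 < (gam y0)^-1)) ?invr_gt0 // normrM (gtr0_norm om0).
  by rewrite -mulrA mulrC ler_wpM2r // ltW.
- move=> l; rewrite we mxE normrM (gtr0_norm om0) ler_piMr ?(ltW om0) //.
  by have := coord_le_enorm e l; rewrite /enorm e1 sqrtr1.
exists C, B, b; split => //.
  by move=> x s hs Ux Sx; apply: (cov x s hs).
apply: le_trans cnt _; rewrite ler_wpM2l //.
  by rewrite !mulr_ge0 ?(ltW (tubeK_gt0 n0)) ?(ltW om0) //; case/andP: th1 => /ltW.
apply: le_trans (pow_add_le _ r0 _) _; first by rewrite (ltW rh0).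
rewrite ler_wpM2l ?exprn_ge0 // lerD2r /hterm ifF /=; last first.
  by apply/negP => /eqP U0; rewrite U0 in Uy0.
rewrite -/r expr_div_n le_eqVlt; apply/orP; left; apply/eqP; field.
by rewrite expf_neq0 // gt_eqF.
Qed.

Lemma level_of y : peval q y = 0 -> cube m y -> tau <= `|A y w| ->
  forall J th0, (2^-1 : R) ^+ J < th0 -> th0 <= theta y <= 1 -> exists2 j, (j < J)%N & Sl j y.
Proof.
move=> qy cy tw J th0 hJ /andP[h1 h2].
case: J hJ => [|J] hJ.
  by move: hJ; rewrite expr0 => /lt_le_trans/(_ h1)/lt_le_trans/(_ h2); rewrite ltxx.
have ex : exists j, (2^-1 : R) ^+ j.+1 < theta y by exists J; exact: lt_le_trans h1.
case: (ex_minnP ex) => j hj jmin; exists j.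
  by rewrite ltnS; apply: jmin; exact: lt_le_trans h1.
split => //; rewrite hj /=; case: j {hj} jmin => [|j] jmin; first by rewrite expr0.
by rewrite leNgt; apply/negP => /jmin; rewrite ltnn.
Qed.

Lemma level_finite j (S : R) : surf e (zero_set q) (cube m) = S%:E -> (Hn (Sl j) < +oo)%E.
Proof.
move=> eS; rewrite ltNge; apply/negP; rewrite leye_eq => /eqP Hj.
pose X := (`|S| + 1) * 2 ^+ j.+2.
have X0 : 0 <= X by rewrite mulr_ge0 ?exprn_ge0 ?addr_ge0.
pose c i := if i == j then X else 0.
have c0 i : 0 <= c i by rewrite /c; case: ifP.
have cH i : (i < j.+1)%N -> ((c i)%:E <= Hn (Sl i))%E.
  by move=> _; rewrite /c; case: eqP => [->|_]; [rewrite Hj leey | apply: haus_ge0; exact: eucl_dist_ge0].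
have := surf_ge_levels c0 cH; rewrite /c.
rewrite eS lee_fin (bigD1 ord_max) //= eqxx big1 ?addr0; last first.
  by move=> i; rewrite -val_eqE /= => /negbTE ->; rewrite mul0r.
rewrite /X -mulrA -exprMn mulfV // expr1n mulr1 => h.
by have := ler_norm S; lra.
Qed.

Lemma sum_half_lt2 J : \sum_(j < J) (2^-1 : R) ^+ j <= 2.
Proof.
suff -> : \sum_(j < J) (2^-1 : R) ^+ j = 2 - 2 * 2^-1 ^+ J.
  by have : 0 <= (2^-1 : R) ^+ J; [rewrite exprn_ge0 // invr_ge0 | lra].
elim: J => [|J IH]; first by rewrite big_ord0 expr0; lra.
by rewrite big_ord_recr /= IH exprS; lra.
Qed.

(** The points of the cells lie in tubes swept along [w] by pieces of the zero set. Over a piece of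
    diameter [r] in layer [j], the tube is covered by cells of total volume
    [O(om 2 ^ - j r ^ (n - 1))], which is [om] times the contribution of the piece to [surf];
    [content_family] adds these volumes up. *)
Lemma crofton N (Zs : {set grid n N}) : (0 < N)%N ->
  (forall i (x : V), i \in Zs ->
     (forall l, gpt R m i ord0 l <= x ord0 l < gpt R m i ord0 l + N%:R^-1) ->
     exists s, [/\ -1 <= s <= 2, cube m (x + s *: w), peval q (x + s *: w) = 0 &
                   tau <= `|A (x + s *: w) w|]) ->
  ((#|Zs|%:R / N%:R ^+ n)%:E <= (crK * om)%:E * surf e (zero_set q) (cube m))%E.
Proof.
move=> N0 hZ; have om_ : 0 < omega R n.-1 := omega_gt0 R n.-1.
have K0 := tubeK_gt0 n0.
have crK0 : 0 < crK * om by rewrite mulr_gt0 // /crK divr_gt0 // mulr_gt0 ?exprn_gt0 // mulr_gt0.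
have sf0 : (0 <= surf e (zero_set q) (cube m))%E.
  by apply: integral_ge0 => t _; apply: haus_ge0; exact: eucl_dist_ge0.
case eS : (surf e (zero_set q) (cube m)) sf0 => [S| |] // S0; last first.
  by rewrite gt0_muley ?lte_fin // leey.
rewrite -EFinM lee_fin; move: S0; rewrite lee_fin => S0.
have Hfin j := level_finite j eS.
have hd0 := @eucl_dist_ge0 R n.
have H0 j : (0 <= Hn (Sl j))%E by apply: haus_ge0.
pose H j := fine (Hn (Sl j)).
have HE j : Hn (Sl j) = (H j)%:E by rewrite fineK // ge0_fin_numE.
have [del del0 [th0 th00 [hth flat]]] := flat_pieces.
have [J hJ] := half_lt th00.
have hsum : \sum_(j < J) H j * (2^-1) ^+ j <= 4 * S.
  have Hj0 j : 0 <= H j by rewrite fine_ge0.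
  have HH j : (j < J)%N -> ((H j)%:E <= Hn (Sl j))%E by rewrite HE.
  have := surf_ge_levels Hj0 HH.
  rewrite eS lee_fin => h; apply: le_trans (ler_wpM2l (ler0n _ 4) h).
  rewrite mulr_sumr le_eqVlt; apply/orP; left; apply/eqP.
  by apply: eq_bigr => j _; rewrite !exprS; field.
pose kap := @tubeK R n * om * (4 ^+ n.-1 / omega R n.-1).
have kap0 : 0 <= kap by rewrite !mulr_ge0 ?invr_ge0 ?exprn_ge0 ?(ltW om_) ?(ltW K0) ?(ltW om0).
pose kap2 := @tubeK R n * om * 2 ^+ n.-1.
have kap20 : 0 <= kap2 by rewrite !mulr_ge0 ?exprn_ge0 ?(ltW K0) ?(ltW om0).
have crKE : crK * om = 4 * kap by rewrite /crK /kap; ring.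
apply/ler_addgt0Pr => ep ep0.
pose eta := Num.min (Num.min (del / 2) 1) (ep / (2 * kap + 2 * kap2 + 1)).
have cst0 : 0 < 2 * kap + 2 * kap2 + 1 by rewrite ltr_wpDl // addr_ge0 // mulr_ge0.
have eta0 : 0 < eta by rewrite !lt_min ltr01 !divr_gt0.
have eta1 : eta <= 1 by rewrite !ge_min lexx orbT.
have etad : eta <= del / 2 by rewrite !ge_min lexx.
have etae : (2 * kap + 2 * kap2) * eta <= ep.
  apply: (@le_trans _ _ ((2 * kap + 2 * kap2 + 1) * eta)); first by rewrite ler_wpM2r ?lerDl // ltW.
  by rewrite mulrC -ler_pdivlMr // !ge_min lexx orbT.
have /choice[F hF] : forall j, exists F : nat -> set V, (Sl j `<=` \bigcup_i F i /\
    (forall i, (diam (@Defs.edist R n) (F i) <= (del / 2)%:E)%E)) /\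
    (\sum_(0 <= i <oo) hterm (@Defs.edist R n) n.-1 (F i) <= Hn (Sl j) + eta%:E)%E.
  move=> j; have [|F h1 h2] := haus_cover_exists hd0 (_ : 0 < del / 2) eta0 (Hfin j).
    by rewrite divr_gt0.
  by exists F.
pose rh i : R := eta * (2^-1) ^+ i.+1.
have hi (i : nat) : 0 < (2^-1 : R) ^+ i <= 1.
  by rewrite exprn_gt0 ?invr_gt0 // exprn_ile1 ?invr_ge0 //; lra.
have rh0 i : 0 < rh i by rewrite mulr_gt0 //; case/andP: (hi i.+1).
have rhe i : rh i <= eta by rewrite ler_piMr ?(ltW eta0) //; case/andP: (hi i.+1).
have /choice[X hX] : forall ji : nat * nat, exists X : {C : finType & ((C -> set V) * R)%type},
  [/\ 0 < (tagged X).2,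
      forall c (x x' : V) l, (tagged X).1 c x -> (tagged X).1 c x' -> `|x ord0 l - x' ord0 l| <= (tagged X).2,
      forall x s, -1 <= s <= 2 -> F ji.1 ji.2 (x + s *: w) -> Sl ji.1 (x + s *: w) ->
        exists c, (tagged X).1 c x &
      #|tag X|%:R * (7 * (tagged X).2) ^+ n <= @tubeK R n * om * (2^-1) ^+ ji.1 *
        (2 ^+ n.-1 * (2 ^+ n.-1 / omega R n.-1 * fine (hterm (@Defs.edist R n) n.-1 (F ji.1 ji.2)) + rh ji.2))].
  move=> [j i] /=; have [|||C [B [b hb]]] := flat j (F j i) (rh i).
  - exact: (hF j).1.2.
  - by rewrite rh0 (le_trans (rhe i)).
  - exact: le_trans (rhe i) _.
  by exists (existT _ C (B, b)).
have h0 j i : 0 <= fine (hterm (@Defs.edist R n) n.-1 (F j i)) by rewrite fine_ge0 // hterm_ge0.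
have hE j i : hterm (@Defs.edist R n) n.-1 (F j i) = (fine (hterm (@Defs.edist R n) n.-1 (F j i)))%:E.
  by rewrite fineK // /hterm; case: ifP.
(* [content_family] takes one sequence of finite families: the cells of the pieces of index [i] are
   collected from all layers. *)
pose C i : finType := {j : 'I_J & tag (X (val j, i))}.
pose B i (c : C i) := (tagged (X (val (tag c), i))).1 (tagged c).
pose b i (c : C i) := (tagged (X (val (tag c), i))).2.
have b0 i (c : C i) : 0 < b i c by case: (hX (val (tag c), i)).
have hcon : ((#|Zs|%:R / N%:R ^+ n)%:E <= \sum_(0 <= i <oo) (\sum_(c : C i) (7 * b i c) ^+ n)%:E)%E.
  apply: (@content_family R n N m Zs C B b N0) => //.
    by move=> i c x x' l; case: (hX (val (tag c), i)) => _ + _ _; exact.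
  move=> i x iZ hx; have [s [hs cs qs ts]] := hZ i x iZ hx.
  have [j jJ Sj] := level_of qs cs ts hJ (hth _ cs ts).
  have [i' _ Fi'] := (hF j).1.1 _ Sj.
  have [_ _ /(_ x s hs Fi' Sj) [c hc] _] := hX (j, i').
  by exists i', (existT _ (Ordinal jJ) c).
rewrite -lee_fin; apply: le_trans hcon _.
apply: lime_le.
  apply: is_cvg_nneseries => i _ _; rewrite lee_fin; apply: sumr_ge0 => c _.
  by rewrite exprn_ge0 // mulr_ge0 // ltW.
apply: nearW => M; rewrite sumEFin lee_fin.
pose a j i := fine (hterm (@Defs.edist R n) n.-1 (F j i)).
apply: (@le_trans _ _ (\sum_(0 <= i < M) \sum_(j < J) (2^-1) ^+ j * (kap * a j i + kap2 * rh i))).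
  apply: ler_sum => i _.
  rewrite -(@sig_big_dep _ _ +%R 'I_J (fun j => tag (X (val j, i))) xpredT (fun _ _ => true)
     (fun j c => (7 * (tagged (X (val j, i))).2) ^+ n)) /=.
  apply: ler_sum => j _; rewrite sumr_const -[leLHS]mulr_natl.
  have [_ _ _ h] := hX (val j, i); apply: le_trans h _.
  rewrite le_eqVlt; apply/orP; left; apply/eqP => /=.
  rewrite /kap /kap2 /a; have -> : (4 : R) ^+ n.-1 = 2 ^+ n.-1 * 2 ^+ n.-1.
    by rewrite -exprMn; congr (_ ^+ _); lra.
  by ring.
rewrite exchange_big /=.
have hh j : \sum_(0 <= i < M) a j i <= H j + eta.
  rewrite -lee_fin EFinD -HE; apply: le_trans (hF j).2; rewrite -sumEFin.
  under eq_bigr do rewrite /a -hE.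
  by apply: nneseries_lim_ge => i _ _; exact: hterm_ge0.
have hr : \sum_(0 <= i < M) rh i <= eta.
  rewrite -mulr_sumr ler_piMr ?(ltW eta0) //.
  under eq_bigr do rewrite exprS; rewrite -mulr_sumr big_mkord.
  by have := sum_half_lt2 M; lra.
apply: (@le_trans _ _ (\sum_(j < J) (2^-1) ^+ j * (kap * (H j + eta) + kap2 * eta))).
  apply: ler_sum => j _; rewrite -mulr_sumr.
  have -> : \sum_(0 <= i < M) (kap * a j i + kap2 * rh i) =
     kap * (\sum_(0 <= i < M) a j i) + kap2 * (\sum_(0 <= i < M) rh i).
    by rewrite big_split /= [in RHS]mulr_sumr [X in _ = _ + X]mulr_sumr.
  apply: ler_wpM2l; first by case/andP: (hi j) => /ltW.
  by apply: lerD; apply: ler_wpM2l; rewrite ?hh.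
rewrite crKE; have -> : \sum_(j < J) 2^-1 ^+ j * (kap * (H j + eta) + kap2 * eta) =
   kap * (\sum_(j < J) H j * 2^-1 ^+ j) + (\sum_(j < J) 2^-1 ^+ j) * ((kap + kap2) * eta).
  by rewrite mulr_sumr mulr_suml -big_split /=; apply: eq_bigr => j _; ring.
have := ler_wpM2l kap0 hsum.
have : (\sum_(j < J) (2^-1 : R) ^+ j) * ((kap + kap2) * eta) <= 2 * ((kap + kap2) * eta).
  by apply: ler_wpM2r (sum_half_lt2 J); rewrite mulr_ge0 ?addr_ge0 // ltW.
by lra.
Qed.
End Main.
End Crofton.

(** * Stability of transversal crossings *)

Section Robust.
Variables (R : realType) (n k : nat) (p : poly_k R n k).
Local Notation V := 'rV[R]_n.
Local Notation A y := (lform (fun i => pder p i y)).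

Lemma lform_le (c : 'I_n -> R) (v : V) B D : (forall i, `|c i| <= B) ->
  (forall i, `|v ord0 i| <= D) -> `|lform c v| <= n%:R * (D * B).
Proof.
move=> hc hv; apply: le_trans (ler_norm_sum _ _ _) _.
apply: (@le_trans _ _ (\sum_(i < n) D * B)).
  by apply: ler_sum => i _; rewrite normrM ler_pM.
by rewrite sumr_const card_ord -[leLHS]mulr_natl.
Qed.

Lemma lform_subl (c c' : 'I_n -> R) (v : V) : lform c v - lform c' v = lform (fun i => c i - c' i) v.
Proof. by rewrite /lform -sumrB; apply: eq_bigr => i _; rewrite mulrBr. Qed.

Lemma pder_subcst (q : poly_k R n k) b : (forall x, peval q x = peval p x - b) ->
  forall i x, pder q i x = pder p i x.
Proof.
move=> h i x; rewrite -(lform_delta (fun j => pder q j x)) -(lform_delta (fun j => pder p j x)).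
rewrite -!diff_peval.
have -> : (peval q : V -> R^o) = (peval p : V -> R^o) - cst b by apply/funext => y; rewrite h.
rewrite diffB; do ?[exact: differentiable_cst | exact: differentiable_peval].
by rewrite /= diff_cst subr0.
Qed.

(** Along the segment, [q] equals [(s - s0) al] up to [tau h / 2], while [|al| >= tau]: its signs at
    [s0 - h] and [s0 + h] are opposite. The value of [h] keeps the variation of the derivative, at
    most [2 n Lam h], below [tau / 8]. *)
Lemma robust_zero k' (q : poly_k R n k') rho Lam b tau d ep h (x w z w' : V) s0 :
  (0 < n)%N -> 1 <= Lam -> c2on rho Lam (peval p) (pder p) -> 0 < tau ->
  h = tau / (16 * n%:R * Lam) -> 0 <= d <= h / 2 -> h <= 1 -> 3 * n%:R * Lam * d <= tau * h / 8 ->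
  ep <= tau * h / 8 -> n%:R * ep <= tau / 8 -> 0 <= s0 <= 1 ->
  inbox rho (z + s0 *: w') -> (forall s, s0 - h <= s <= s0 + h -> inbox rho (x + s *: w)) ->
  (forall l, `|x ord0 l - z ord0 l| <= d) -> (forall l, `|w ord0 l - w' ord0 l| <= d) ->
  (forall l, `|w ord0 l| <= 1) ->
  peval p (z + s0 *: w') = b -> tau <= `|A (z + s0 *: w') w'| ->
  (forall y, inbox rho y -> `|peval q y - (peval p y - b)| <= ep /\
     forall i, `|pder q i y - pder p i y| <= ep) ->
  exists2 s, s0 - h <= s <= s0 + h & peval q (x + s *: w) = 0 /\
    tau / 2 <= `|lform (fun i => pder q i (x + s *: w)) w|.
Proof.
move=> n0 Lam1 cp tau0 hE /andP[d0 dh] h1 hd hep hnep s01 iy0 iy hx hw w1 py0 tA hq.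
have n1 : 1 <= n%:R :> R by rewrite ler1n.
have nL0 : 0 < n%:R * Lam by nra.
have h0 : 0 < h by rewrite hE divr_gt0 // -mulrA mulr_gt0.
have hL : n%:R * Lam * h = tau / 16.
  have Lam0 : 0 < Lam by lra.
  have n0' : 0 < n%:R :> R by lra.
  by rewrite hE; field; rewrite !gt_eqF.
set y0 := z + s0 *: w' in iy0 py0 tA.
pose y s := x + s *: w.
have dy s l : s0 - h <= s <= s0 + h -> `|y s ord0 l - y0 ord0 l| <= 2 * h.
  move=> hs; rewrite /y /y0 !mxE.
  have -> : x ord0 l + s * w ord0 l - (z ord0 l + s0 * w' ord0 l) =
    (x ord0 l - z ord0 l) + s0 * (w ord0 l - w' ord0 l) + (s - s0) * w ord0 l by ring.
  apply: le_trans (ler_normD _ _) _; apply: le_trans (lerD (ler_normD _ _) (lexx _)) _.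
  rewrite !normrM.
  have u1 : `|s0| * `|w ord0 l - w' ord0 l| <= 1 * d.
    by apply: ler_pM => //; rewrite ger0_norm; case/andP: s01.
  have u2 : `|s - s0| * `|w ord0 l| <= h * 1.
    by apply: ler_pM => //; rewrite ler_norml; lra.
  by have := hx l; lra.
set al := A y0 w' in tA.
have [[_ hg] _ _ _] := cp y0 y0 0 (lexx 0) iy0 iy0 (fun l => ltac:(rewrite subrr normr0; exact: lexx)).
have key s : s0 - h <= s <= s0 + h -> `|peval q (y s) - (s - s0) * al| <= tau * h / 2.
  move=> hs; have iys := iy s hs; have [hq1 _] := hq _ iys.
  have h20 : 0 <= 2 * h by rewrite mulr_ge0 // ltW.
  have [_ _ _ hT] := cp y0 (y s) (2 * h) h20 iy0 iys (fun l => dy s l hs).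
  have e1 : \sum_i ((y s) ord0 i - y0 ord0 i) * pder p i y0 =
     A y0 (x - z) + s0 * A y0 (w - w') + (s - s0) * A y0 (w - w') + (s - s0) * al.
    transitivity (A y0 (y s - y0)); first by apply: eq_bigr => i _; rewrite !mxE.
    have -> : y s - y0 = (x - z) + s0 *: (w - w') + (s - s0) *: (w - w') + (s - s0) *: w'.
      by apply/rowP => i; rewrite /y /y0 !mxE; ring.
    by rewrite !lformD !lformZ !lformD.
  rewrite e1 py0 in hT.
  have a1 : `|A y0 (x - z)| <= n%:R * (d * Lam) by apply: lform_le => // i; rewrite !mxE.
  have a2 : `|A y0 (w - w')| <= n%:R * (d * Lam) by apply: lform_le => // i; rewrite !mxE.
  have a3 : `|s0 * A y0 (w - w')| <= n%:R * (d * Lam).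
    rewrite normrM -[leRHS]mul1r; apply: ler_pM => //.
    by rewrite ger0_norm; case/andP: s01.
  have a4 : `|(s - s0) * A y0 (w - w')| <= n%:R * (d * Lam).
    rewrite normrM -[leRHS]mul1r; apply: ler_pM => //.
    by rewrite ler_norml; lra.
  have a5 : Lam * (2 * h) ^+ 2 <= tau * h / 4.
    have : n%:R * Lam * h * (4 * h) = tau / 16 * (4 * h) by rewrite hL.
    have : Lam * (4 * h * h) <= n%:R * (Lam * (4 * h * h)) by rewrite ler_peMl // !mulr_ge0 ?(ltW h0) //; lra.
    by rewrite expr2; move: (n%:R) => u; nra.
  move: hT hq1 a1 a3 a4 a5 hd hep.
  have -> : 3 * n%:R * Lam * d = 3 * (n%:R * (d * Lam)) by ring.
  set t1 := A y0 (x - z); set t2 := s0 * _; set t3 := (s - s0) * A y0 _; set t4 := (s - s0) * al.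
  set P := peval p (y s); set Q := peval q (y s).
  rewrite !ler_norml; move: (n%:R * _) (Lam * _) (tau * h) => *; lra.
have hA s : s0 - h <= s <= s0 + h -> tau / 2 <= `|lform (fun i => pder q i (y s)) w|.
  move=> hs; have iys := iy s hs; have [_ hq2] := hq _ iys.
  have h20 : 0 <= 2 * h by rewrite mulr_ge0 // ltW.
  have [_ _ hG _] := cp y0 (y s) (2 * h) h20 iy0 iys (fun l => dy s l hs).
  have b1 : `|lform (fun i => pder q i (y s)) w - A (y s) w| <= n%:R * (1 * ep).
    by rewrite lform_subl; exact: lform_le.
  have b2 : `|A (y s) w - A y0 w| <= n%:R * (1 * (Lam * (2 * h))).
    by rewrite lform_subl; exact: lform_le.
  have b3 : `|A y0 w - al| <= n%:R * (d * Lam).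
    by rewrite /al -lformB; apply: lform_le => // i; rewrite !mxE.
  have b4 : n%:R * (1 * (Lam * (2 * h))) = tau / 8.
    by transitivity (2 * (n%:R * Lam * h)); [ring | rewrite hL; field].
  have b5 : n%:R * (d * Lam) <= tau / 8.
    have : n%:R * Lam * d <= n%:R * Lam * h by rewrite ler_wpM2l ?(ltW nL0) //; lra.
    have -> : n%:R * Lam * d = n%:R * (d * Lam) by ring.
    by rewrite hL; move: (n%:R * _) => *; lra.
  rewrite b4 in b2; rewrite mul1r in b1.
  move: b1; set X := lform _ w => b1.
  have e1 : `|al| <= `|X| + `|al - X|.
    by have := ler_normD X (al - X); rewrite [X + _]addrC subrK.
  have e2 : `|al - X| <= 3 * (tau / 8).
    move: b1 b2 b3 b5 hnep; rewrite !ler_norml.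
    by move: X {e1} (A (y s) w) (A y0 w) (n%:R * ep) (n%:R * (d * Lam)) => *; lra.
  by move: e1 e2 tA; move: (`|X|) (`|al - X|) (`|al|) => *; lra.
have hth : 0 < tau * h by rewrite mulr_gt0.
have kp : s0 - h <= s0 + h <= s0 + h by lra.
have km : s0 - h <= s0 - h <= s0 + h by lra.
have := key _ kp; have := key _ km.
have -> : s0 + h - s0 = h by ring. have -> : s0 - h - s0 = - h by ring.
rewrite !ler_norml => /andP[m1 m2] /andP[p1 p2].
have [a0|a0] := leP 0 al.
  have ha : tau * h <= h * al by rewrite mulrC ler_pM2l //; move: tA; rewrite ger0_norm.
  have [||| s hs qs] := @peval_ivt _ _ _ q x w (s0 - h) (s0 + h).
  - by lra.
  - by move: m2; rewrite -/(y _) mulNr; lra.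
  - by move: p1; rewrite -/(y _); lra.
  by exists s => //; split => //; exact: hA.
have ha : tau * h <= h * (- al) by rewrite mulrC ler_pM2l //; move: tA; rewrite ltr0_norm.
have [||| s hs qs] := @peval_ivt _ _ _ q x (- w) (- (s0 + h)) (- (s0 - h)).
- by lra.
- by rewrite scaleNr scalerN opprK; move: p2 ha; rewrite -/(y _) mulrN; lra.
- by rewrite scaleNr scalerN opprK; move: m1 ha; rewrite -/(y _) mulNr mulrN; lra.
exists (- s); first by lra.
have e : x + s *: - w = x + - s *: w by rewrite scalerN scaleNr.
by split; [rewrite -e | apply: hA; lra].
Qed.

Lemma card_spread J (B : {set 'I_J}) (X : R) : 0 <= X ->
  (forall i j, i \in B -> j \in B -> i%:R - j%:R <= X) -> #|B|%:R <= X + 1.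
Proof.
move=> X0 hB; have [->|/set0Pn[j0 j0B]] := eqVneq B finset.set0.
  by rewrite cards0 addr_ge0.
case: (arg_minnP (fun j : 'I_J => val j) j0B) => j jB jmin.
have hi (i : 'I_J) : i \in B -> (i - j <= Num.truncn X)%N.
  move=> iB; rewrite truncn_ge_nat // natrB; [exact: hB | exact: jmin].
have inj : {in B &, injective (fun i : 'I_J => inord (i - j) : 'I_(Num.truncn X).+1)}.
  move=> i i' iB i'B /(congr1 val); rewrite /= !inordK ?ltnS ?hi // => e; apply: val_inj => /=.
  by have := jmin _ iB; have := jmin _ i'B; move: e => /=; lia.
apply: (@le_trans _ _ (Num.truncn X).+1%:R).
  by rewrite ler_nat -(card_in_imset inj) -[leqRHS]card_ord max_card.
by rewrite -natr1 lerD2r; case/andP: (truncn_itv X0).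
Qed.

(* On a short interval containing a nearly critical point, [p] is nearly constant. *)
Lemma few_critical_levels rho Lam tau r0 (z w' : V) I J : (0 < n)%N ->
  1 <= Lam -> c2on rho Lam (peval p) (pder p) -> 0 < tau -> 0 < r0 -> (0 < I)%N -> (0 < J)%N ->
  Lam / I%:R <= tau -> (forall s, 0 <= s <= 1 -> inbox rho (z + s *: w')) ->
  (forall l, `|w' ord0 l| <= 1) ->
  #|[set j : 'I_J | `[< exists s, [/\ 0 <= s <= 1, peval p (z + s *: w') = r0 * j.+1%:R / J.+1%:R &
      `|A (z + s *: w') w'| < tau] >]]%SET|%:R <= 4 * tau * J%:R / r0 + I%:R.
Proof.
move=> n0 Lam1 cp tau0 r00 I0 J0 hI iz w1.
set Bd : {set 'I_J} := finset _.
have I0' : 0 < I%:R :> R by rewrite ltr0n.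
(* Between two nearly critical points of one subinterval of length [1 / I], [p] varies by at most
   [tau / I + Lam / I ^ 2 <= 2 tau / I]. *)
pose Bi (i : 'I_I) : {set 'I_J} := [set j : 'I_J | `[< exists s, [/\ i%:R / I%:R <= s <= (i%:R + 1) / I%:R /\ 0 <= s <= 1,
   peval p (z + s *: w') = r0 * j.+1%:R / J.+1%:R & `|A (z + s *: w') w'| < tau] >]]%SET.
have sub : Bd \subset (\bigcup_i Bi i)%SET.
  apply/fintype.subsetP => j; rewrite inE => /asboolP[s [/andP[s0 s1] ps As]].
  have sI0 : 0 <= s * I%:R by rewrite mulr_ge0.
  have /andP[t1 t2] := truncn_itv sI0.
  (* The minimum puts [s = 1] in the last subinterval. *)
  pose i := minn (Num.truncn (s * I%:R)) I.-1.
  have iI : (i < I)%N by rewrite /i gtn_min ltn_predL I0 orbT.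
  apply/finset.bigcupP; exists (Ordinal iI) => //; rewrite inE; apply/asboolP; exists s; split => //.
  rewrite s0 s1; split => //=; rewrite ler_pdivrMr // ler_pdivlMr //; apply/andP; split.
    by apply: le_trans t1; rewrite ler_nat geq_minl.
  rewrite natr1; have [tI|tI] := leqP (Num.truncn (s * I%:R)) I.-1.
    by rewrite /i (minn_idPl tI); exact: ltW.
  rewrite /i (minn_idPr (ltnW tI)) prednK //.
  by rewrite ler_piMl.
have J1 : 0 < J.+1%:R :> R by rewrite ltr0n.
have cBi i : #|Bi i|%:R <= 2 * tau * J.+1%:R / (I%:R * r0) + 1.
  apply: card_spread; first by rewrite divr_ge0 ?mulr_ge0 // ltW.
  move=> j j'; rewrite 2!finset.in_set => /asboolP[s [[si s01] ps As]] /asboolP[s' [[si' s01'] ps' As']].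
  have ds : `|s - s'| <= I%:R^-1.
    by move: si si'; rewrite mulrDl mul1r ler_norml; lra.
  have dd l : `|(z + s *: w') ord0 l - (z + s' *: w') ord0 l| <= I%:R^-1.
    rewrite !mxE; have -> : z ord0 l + s * w' ord0 l - (z ord0 l + s' * w' ord0 l) =
      (s - s') * w' ord0 l by ring.
    by rewrite normrM -[leRHS]mulr1 ler_pM.
  have Ii0 : 0 <= I%:R^-1 :> R by rewrite invr_ge0 ltW.
  have [_ _ _] := cp (z + s' *: w') (z + s *: w') I%:R^-1 Ii0 (iz _ s01') (iz _ s01) dd.
  have -> : \sum_i0 ((z + s *: w') ord0 i0 - (z + s' *: w') ord0 i0) * pder p i0 (z + s' *: w') =
     (s - s') * A (z + s' *: w') w'.
    by rewrite /lform mulr_sumr; apply: eq_bigr => l _; rewrite !mxE; ring.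
  have : `|(s - s') * A (z + s' *: w') w'| <= I%:R^-1 * tau.
    by rewrite normrM ler_pM // ltW.
  have : Lam * I%:R^-1 ^+ 2 <= tau * I%:R^-1.
    by rewrite expr2 mulrA ler_wpM2r // invr_ge0 ltW.
  rewrite ps ps' => h1 h2 h3.
  have h4 : r0 * j.+1%:R / J.+1%:R - r0 * j'.+1%:R / J.+1%:R <= 2 * tau / I%:R.
    move: h1 h2 h3; rewrite !ler_norml.
    by move: (I%:R^-1) (_ / J.+1%:R) (r0 * j'.+1%:R / _) ((s - s') * _) (_ ^+ 2) => *; lra.
  have -> : 2 * tau * J.+1%:R / (I%:R * r0) = (2 * tau / I%:R) * (J.+1%:R / r0).
    by field; rewrite !gt_eqF.
  have -> : j%:R - j'%:R = (r0 * j.+1%:R / J.+1%:R - r0 * j'.+1%:R / J.+1%:R) * (J.+1%:R / r0) :> R.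
    rewrite -(natr1 j) -(natr1 j'); field; rewrite gt_eqF //; rewrite gt_eqF //.
  by apply: ler_wpM2r h4; rewrite divr_ge0 // ltW.
apply: (@le_trans _ _ (\sum_(i < I) #|Bi i|%:R)).
  rewrite -natr_sum ler_nat; apply: leq_trans (subset_leq_card sub) _.
  elim/big_rec2: _ => [|i a B _ h]; first by rewrite cards0.
  by apply: leq_trans (leq_card_setU _ _) _; rewrite leq_add2l.
apply: le_trans (ler_sum _ (fun i _ => cBi i)) _.
rewrite sumr_const card_ord -[leLHS]mulr_natl mulrDr mulr1 lerD2r.
have -> : I%:R * (2 * tau * J.+1%:R / (I%:R * r0)) = 2 * tau * J.+1%:R / r0.
  by field; rewrite !gt_eqF.
rewrite ler_pM2r ?invr_gt0 // -natr1.
have hJ : 1 <= J%:R :> R by rewrite ler1n.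
by have := ler_wpM2l (ltW tau0) hJ; lra.
Qed.
End Robust.

Lemma allProp_nth (X : Type) (P : X -> Prop) x0 L i : allProp P L -> (i < size L)%N -> P (nth x0 L i).
Proof. by elim: L i => [|x L IH] [|i] //= [Px PL]; [|rewrite ltnS; exact: IH]. Qed.

Lemma ispol_ivt (R : realType) n k (f : 'rV[R]_n -> R) x v : ispol k f ->
  f x * f (x + v) <= 0 -> exists2 s, 0 <= s <= 1 & f (x + s *: v) = 0.
Proof.
move=> pf h; have [r _ hr] := ispol_line x v pf.
have e0 : f x = r.[0] by rewrite -hr scale0r addr0.
have e1 : f (x + v) = r.[1] by rewrite -hr scale1r.
rewrite e0 e1 in h.
have [r0|r0] := leP r.[0] 0.
  have [r1|r1] := leP 0 r.[1].
    have [|s hs /rootP rs] := @poly_ivt _ r 0 1 ler01; first by rewrite r0 r1.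
    by exists s; rewrite // hr.
  move: h; rewrite nmulr_lle0 // => r0'; exists 0; rewrite ?lexx ?ler01 // hr.
  by apply/eqP; rewrite eq_le r0.
have [|s hs /rootP rs] := @poly_ivt _ (- r) 0 1 ler01.
  by rewrite !hornerN oppr_le0 oppr_ge0 (ltW r0) /=; move: h; rewrite pmulr_rle0.
by exists s => //; rewrite hr; move: rs; rewrite hornerN => /eqP; rewrite oppr_eq0 => /eqP.
Qed.

Lemma mid_valid_range (N z v : nat) : (16 < N)%N -> (N = N./2 + N./2)%N ->
  (N <= 4 * z)%N && (4 * z < 3 * N)%N -> (3 * N <= 8 * v.+1)%N && (8 * v <= 5 * N)%N ->
  (N./2 <= z + v < N + N./2)%N.
Proof. move: (N./2) => H; lia. Qed.

Lemma near01 (R : realFieldType) (s s0 h : R) : s0 - h <= s <= s0 + h -> 0 <= s0 <= 1 -> h <= 16^-1 ->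
  `|s| <= 17 / 16 /\ -1 <= s <= 2.
Proof. by move=> ? ? ?; rewrite ler_norml; split; lra. Qed.

(** * Crossings in one cube *)

Section Cube.
Variables (R : realType) (n k T T' : nat).
Hypotheses (n0 : (0 < n)%N) (T0 : (0 < T)%N) (T'0 : (0 < T')%N).
Local Notation N := (T * T')%N.
Hypotheses (N4 : (4 %| N)%N) (N16 : (16 < N)%N).
Variables (Q : cube_index n) (L : seq (nat * ('rV[R]_n -> R))).
Variables (F pb : poly_k R n k) (b rho Lam tau h : R).
Hypothesis okL : allProp (okpair T) L.
Hypothesis FE : forall x, peval F x = (\prod_(kf <- L) kf.2 x) ^+ 2.
Hypothesis b0 : 0 < b.
Hypothesis pbE : forall x, peval pb x = peval F x - b.
Hypothesis bF : forall x : grid n T, peval F (gpt R Q x) != 0 -> b < peval F (gpt R Q x).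
Hypotheses (Lam1 : 1 <= Lam) (cF : c2on rho Lam (peval F) (pder F)) (tau0 : 0 < tau).
Hypotheses (hE : h = tau / (16 * n%:R * Lam)) (h16 : h <= 16^-1).
Hypotheses (hN : N%:R^-1 <= h / 2) (hN2 : 3 * n%:R * Lam * N%:R^-1 <= tau * h / 8).
Hypothesis Qbox : forall y, cube Q y -> inbox rho y.
Local Notation A p y := (lform (fun i => pder p i y)).
Local Notation fl := (fl T'0).
Local Notation sh := (sh T0 T'0).
Local Notation wv := (@wv R n T T').

Let N0 : 0 < N%:R :> R. Proof. by rewrite ltr0n muln_gt0 T0. Qed.
Let N116 : N%:R^-1 < 16^-1 :> R.
Proof. by rewrite ltf_pV2 ?posrE // (_ : 16 = 16%:R :> R) // ltr_nat. Qed.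

(** [mid] keeps the middle half of the cube in each coordinate; [valid] keeps the cells of
    directions that meet [[-1/8, 1/8]]. As [1 / N < 1 / 16], the segments stay in the cube. *)
Definition mid (z : grid n N) := [forall l, (N <= 4 * z l) && (4 * z l < 3 * N)]%N.
Definition valid (v : grid n N) := [forall l, (3 * N <= 8 * (v l).+1) && (8 * v l <= 5 * N)]%N.
(* The exceptional pairs: rounding changes the sign of a member of [L] ([chg]) or of [F - b]
   ([chb]), a member of [L] vanishes at the rounded point ([van]), or the segment from [z] with
   direction [v] is nearly tangent to the level set [F = b] ([crit]). *)
Definition chg (z : grid n N) :=
  has (fun kf => (0 < kf.2 (gpt R Q z)) != (0 < kf.2 (gpt R Q (fl z)))) L.
Definition van (z : grid n N) := has (fun kf => kf.2 (gpt R Q (fl z)) == 0) L.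
Definition chb (z : grid n N) := (0 < peval pb (gpt R Q z)) != (0 < peval pb (gpt R Q (fl z))).
Definition crit (v z : grid n N) := [&& mid z, valid v & `[< exists s, [/\ 0 <= s <= 1, peval F (gpt R Q z + s *: wv v) = b &
  `|A F (gpt R Q z + s *: wv v) (wv v)| < tau] >]].
Definition bad v z := [|| chg z, chg (sh v z), van z, chb z | crit v z].
Definition agree v z := (fl z, fl (sh v z)) \in agrL T L Q.

(** Some member of [L] changes sign between the two ends, so [F] vanishes on the segment. At [z]
    itself [F > b]: this holds at the rounded point, and rounding preserves the sign of [F - b]. A
    point with [F = b] lies in between. *)
Lemma segment_zero v z : mid z -> valid v -> ~~ bad v z -> ~~ agree v z ->
  exists2 s, 0 <= s <= 1 & peval F (gpt R Q z + s *: wv v) = b /\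
    tau <= `|A F (gpt R Q z + s *: wv v) (wv v)|.
Proof.
move=> mz' vv'; have /forallP mz := mz'; have /forallP vv := vv'; rewrite /bad 4!negb_or => /and5P[c1 c2 va cb cr].
have oN : odd N = false by have /dvdnP[c ->] := N4; rewrite oddM andbF.
have N2 : (N = N./2 + N./2)%N by rewrite addnn -[LHS]odd_double_half oN.
have shE : gpt R Q (sh v z) = gpt R Q z + wv v.
  apply: gpt_sh; first by rewrite oN.
  by move=> l; apply: mid_valid_range N16 N2 (mz l) (vv l).
pose kf0 : nat * ('rV[R]_n -> R) := (0%N, fun=> 0).
rewrite /agree inE -has_predC => /(has_nthP kf0)[i iL].
rewrite /= /agr /= => ag.
set f := (nth kf0 L i).2 in ag.
have nthc z' : ~~ chg z' -> (0 < f (gpt R Q z')) = (0 < f (gpt R Q (fl z'))).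
  by rewrite /chg -all_predC => /(all_nthP kf0)/(_ i iL) /=; rewrite negbK => /eqP.
have ag' : (0 < f (gpt R Q z)) != (0 < f (gpt R Q z + wv v)).
  by rewrite -shE nthc // nthc.
have okf : ispol (nth kf0 L i).1 f by have [] := allProp_nth kf0 okL iL.
have [s1 s101 fs1] : exists2 s, 0 <= s <= 1 & f (gpt R Q z + s *: wv v) = 0.
  apply: (ispol_ivt okf); move: ag'; case: ltP => h1; case: ltP => h2 // _.
    by rewrite pmulr_rle0.
  by rewrite pmulr_lle0.
have Fs1 : peval F (gpt R Q z + s1 *: wv v) = 0.
  by rewrite FE (big_nth kf0) big_mkord (bigD1 (Ordinal iL)) //= -/f fs1 mul0r expr0n.
have Fz : peval F (gpt R Q (fl z)) != 0.
  rewrite FE expf_neq0 // (big_nth kf0) big_mkord; apply/prodf_neq0 => j _.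
  by move: va; rewrite /van -all_predC => /(all_nthP kf0)/(_ j (ltn_ord j)).
have pz : 0 < peval pb (gpt R Q z).
  by move: cb; rewrite /chb negbK => /eqP ->; rewrite pbE subr_gt0; exact: bF.
have [s2 /andP[s20 s21]] : exists2 s, 0 <= s <= 1 & peval pb (gpt R Q z + s *: (s1 *: wv v)) = 0.
  apply: (ispol_ivt (ispol_peval pb)).
  by rewrite pmulr_rle0 // pbE Fs1 sub0r oppr_le0 ltW.
rewrite scalerA pbE => /eqP; rewrite subr_eq0 => /eqP e.
have s01 : 0 <= s2 * s1 <= 1.
  by case/andP: s101 => u1 u2; rewrite mulr_ge0 //= -[leRHS]mul1r ler_pM.
exists (s2 * s1) => //; split => //; rewrite leNgt; apply/negP => ht.
by move: cr; rewrite /crit mz' vv' /= => /asboolPn ncr; apply: ncr; exists (s2 * s1); split.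
Qed.

Lemma mid_cube z (x y : 'rV[R]_n) : mid z ->
  (forall l, gpt R Q z ord0 l <= x ord0 l < gpt R Q z ord0 l + N%:R^-1) ->
  (forall l, `|y ord0 l| <= 3 / 16) -> cube Q (x + y).
Proof.
move=> /forallP mz hx hy l; have := hx l; have := hy l; rewrite !mxE ler_norml.
have /andP[z1 z2] := mz l.
have z1' : 4^-1 <= (z l)%:R / N%:R :> R.
  by rewrite ler_pdivlMr // mulrC ler_pdivrMr // -natrM ler_nat [(z l * 4)%N]mulnC.
have z2' : (z l)%:R / N%:R < 3 / 4 :> R.
  by rewrite ltr_pdivrMr // mulrAC ltr_pdivlMr // -!natrM ltr_nat [(z l * 4)%N]mulnC.
move: N116 z1' z2'; move: (N%:R^-1) (_ / N%:R) (_%:~R) => u t m; lra.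
Qed.

Lemma wv_le v l : valid v -> `|wv v ord0 l| <= 3 / 16.
Proof.
move=> /forallP vv; have /andP[v1 v2] := vv l; rewrite mxE ler_norml.
have v1' : 3 / 8 <= (v l)%:R / N%:R + N%:R^-1 :> R.
  rewrite -{2}[N%:R^-1]mul1r -mulrDl natr1 ler_pdivlMr // mulrAC ler_pdivrMr // -!natrM ler_nat.
  by rewrite [(_ * 8)%N]mulnC.
have v2' : (v l)%:R / N%:R <= 5 / 8 :> R.
  by rewrite ler_pdivrMr // mulrAC ler_pdivlMr // -!natrM ler_nat [(_ * 8)%N]mulnC.
move: N116 v1' v2'; move: (N%:R^-1) (_ / N%:R) => u t; lra.
Qed.

Lemma robust_cell k' (q : poly_k R n k') ep v z (x w : 'rV[R]_n) :
  mid z -> valid v -> ~~ bad v z -> ~~ agree v z ->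
  ep <= tau * h / 8 -> n%:R * ep <= tau / 8 ->
  (forall y, inbox rho y -> `|peval q y - (peval F y - b)| <= ep /\
     forall i, `|pder q i y - pder F i y| <= ep) ->
  (forall l, gpt R Q z ord0 l <= x ord0 l < gpt R Q z ord0 l + N%:R^-1) ->
  (forall l, wv v ord0 l <= w ord0 l < wv v ord0 l + N%:R^-1) ->
  (forall l, `|w ord0 l| <= 8^-1) ->
  exists s, [/\ -1 <= s <= 2, cube Q (x + s *: w), peval q (x + s *: w) = 0 &
     tau / 2 <= `|A q (x + s *: w) w|].
Proof.
move=> mz vv nb na e1 e2 hq hx hw w8.
have [s0 s01 [Fs0 As0]] := segment_zero mz vv nb na.
have Nn : 0 <= N%:R^-1 :> R by rewrite invr_ge0 ltW.
have Lam0 : 0 < Lam by apply: lt_le_trans Lam1.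
have h0 : 0 < h by rewrite hE divr_gt0 // mulr_gt0 // mulr_gt0 // ltr0n.
have xs s : s0 - h <= s <= s0 + h -> cube Q (x + s *: w).
  move=> hs; apply: (mid_cube mz hx) => l; rewrite mxE normrM.
  apply: (@le_trans _ _ (17 / 16 * 8^-1)); last by lra.
  by apply: ler_pM => //; have [] := near01 hs s01 h16.
have [||||||s hs [qs As]] := @robust_zero R n k F k' q rho Lam b tau N%:R^-1 ep h x w (gpt R Q z) (wv v) s0
  n0 Lam1 cF tau0 hE _ _ hN2 e1 e2 s01 _ (fun s hs => Qbox (xs s hs)) _ _ _ Fs0 As0 hq.
- by rewrite Nn hN.
- by apply: le_trans h16 _; lra.
- apply/Qbox/(mid_cube mz) => [l|l]; first by rewrite lexx ltrDl invr_gt0.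
  rewrite mxE normrM -[leRHS]mul1r ler_pM // ?wv_le //.
  by rewrite ger0_norm; lra.
- by move=> l; have := hx l; rewrite ler_norml; lra.
- by move=> l; have := hw l; rewrite ler_norml; lra.
- by move=> l; apply: le_trans (w8 l) _; lra.
exists s; split => //; first by have [] := near01 hs s01 h16.
exact: xs.
Qed.
End Cube.

(** * Lower bounds for mollified surface area *)

Section Moll.
Variables (R : realType) (n : nat).

Lemma enorm_gt0 (u : 'rV[R]_n) : u != 0 -> 0 < enorm u.
Proof.
move=> u0; have [l ul] : exists l, u ord0 l != 0.
  apply: contrapT => h; move/eqP: u0; apply; apply/rowP => l; rewrite mxE.
  by apply: contrapT => /eqP ul; apply: h; exists l.
by apply: lt_le_trans (coord_le_enorm u l); rewrite normr_gt0.
Qed.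

Lemma unit_dir (u : 'rV[R]_n) : u != 0 -> edot ((enorm u)^-1 *: u) ((enorm u)^-1 *: u) = 1.
Proof.
move=> u0; have := enorm_gt0 u0 => e0.
have -> : edot ((enorm u)^-1 *: u) ((enorm u)^-1 *: u) = (enorm u)^-1 ^+ 2 * edot u u.
  by rewrite /edot mulr_sumr; apply: eq_bigr => i _; rewrite !mxE; ring.
have -> : edot u u = enorm u ^+ 2 by rewrite sqr_sqrtr // edot_ge0.
by rewrite -exprMn mulVf ?expr1n // gt_eqF.
Qed.

Variables (k : nat) (G : mon n k -> mon n k -> R).
Hypotheses (pdG : pos_def_gram G) (D1 : (1 < #|{: mon n k}|)%N).

(** An average is at least any lower bound of its integrand. The step function has a single step,
    and the measure of the ball is positive and finite. *)
Lemma Kset_surf_le p eps (Qc : set 'rV[R]_n) u t0 : psphere G p -> 0 < eps -> 0 <= t0 ->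
  Kset G eps p Qc u -> u != 0 ->
  (forall q, sph_ball G p eps q -> (t0%:E <= surf ((enorm u)^-1 *: u) (zero_set q) Qc)%E) ->
  t0 <= (enorm u)^-1.
Proof.
move=> p1 eps0 t00 [_ [->|]]; first by rewrite eqxx.
move=> hu u0 hq; rewrite -lee_fin; apply: le_trans hu; rewrite /surf_moll.
have m0 := sph_measure_gt0 pdG D1 p1 eps0.
have mf := sph_measure_fin pdG p eps D1.
set mu := sph_measure G _ in m0 mf *.
have mE : mu = (fine mu)%:E by rewrite fineK // ge0_fin_numE // ltW.
have f0 : 0 < fine mu by rewrite -lte_fin -mE.
have step : ((\sum_(j < 1) fine mu * ((if val j == 0%N then t0 else 0) - 0))%:E <=
   hint (sph_measure G) (fun q => surf ((enorm u)^-1 *: u) (zero_set q) Qc) (sph_ball G p eps))%E.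
  apply: (@hint_ge_step _ _ _ _ _ 1 (fun=> 0) (fun j => if j == 0%N then t0 else 0) (fun=> fine mu)).
  - by move=> X; apply: haus_ge0; exact: gdist_ge0.
  - by move=> j; exact: ltW.
  - by move=> j; rewrite lexx /=; case: ifP.
  - have no t : (0 : R) < t < 0 -> False by move=> /andP[h1 h2]; have := lt_trans h1 h2; rewrite ltxx.
    move=> i j t; case: eqP => [->|_]; last by move/no.
    by move=> _; case: eqP => [->|_] // /no.
  move=> j t; rewrite ltnS leqn0 => -> /andP[_ tt0]; rewrite -mE /mu.
  apply: le_haus => q qb; split => //; apply: lt_le_trans (hq q qb).
  by rewrite lte_fin.
apply: le_trans (lee_wpmul2l _ step); last by rewrite lee_fin invr_ge0 ltW.
by rewrite big_ord1 /= subr0 -EFinM mulrA mulVf ?gt_eqF // mul1r.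
Qed.
End Moll.

Lemma pevalZ (R : realType) n k (c : R) (p : poly_k R n k) x : peval (fun a => c * p a) x = c * peval p x.
Proof. by rewrite /peval mulr_sumr; apply: eq_bigr => a _; rewrite mulrA. Qed.

Lemma pderZ (R : realType) n k (c : R) (p : poly_k R n k) i x :
  pder (fun a => c * p a) i x = c * pder p i x.
Proof. by rewrite /pder mulr_sumr; apply: eq_bigr => a _; rewrite mulrA. Qed.

Lemma quarter_shift (N c t : nat) : (N = c * 4 -> t < 2 * c ->
  [/\ c + t < N, N <= 4 * (c + t) & 4 * (c + t) < 3 * N])%N.
Proof. by move=> -> ?; split; lia. Qed.

Lemma half_of_four (N : nat) : (4 %| N -> 16 < N -> [/\ N./2 < N, 0 < N./2 & N = N./2 * 2])%N.
Proof.
move=> /dvdnP[c ->]; have -> : (c * 4 = (c * 2).*2)%N by rewrite -muln2 -mulnA.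
by rewrite doubleK -muln2 => ?; split; lia.
Qed.

(** * Volume of the convex set attached to one cube *)

Section CubeVolume.
Variables (R : realType) (n k T T' : nat).
Hypotheses (n0 : (0 < n)%N) (T0 : (0 < T)%N) (T'0 : (0 < T')%N).
Local Notation N := (T * T')%N.
Hypotheses (N4 : (4 %| N)%N) (N16 : (16 < N)%N).
Variables (Q : cube_index n) (L : seq (nat * ('rV[R]_n -> R))).
Variables (F pb : poly_k R n k) (b rho Lam tau h : R).
Hypothesis okL : allProp (okpair T) L.
Hypothesis FE : forall x, peval F x = (\prod_(kf <- L) kf.2 x) ^+ 2.
Hypothesis b0 : 0 < b.
Hypothesis pbE : forall x, peval pb x = peval F x - b.
Hypothesis bF : forall x : grid n T, peval F (gpt R Q x) != 0 -> b < peval F (gpt R Q x).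
Hypotheses (Lam1 : 1 <= Lam) (cF : c2on rho Lam (peval F) (pder F)) (tau0 : 0 < tau).
Hypotheses (hE : h = tau / (16 * n%:R * Lam)) (h16 : h <= 16^-1).
Hypotheses (hN : N%:R^-1 <= h / 2) (hN2 : 3 * n%:R * Lam * N%:R^-1 <= tau * h / 8).
Hypothesis Qbox : forall y, cube Q y -> inbox rho y.
Variables (G : mon n k -> mon n k -> R) (p : poly_k R n k) (eps ep nu : R).
Hypotheses (pdG : pos_def_gram G) (D1 : (1 < #|{: mon n k}|)%N).
Hypotheses (p1 : psphere G p) (eps0 : 0 < eps) (nu0 : 0 < nu).
Hypotheses (ep1 : ep <= tau * h / 8) (ep2 : n%:R * ep <= tau / 8).
Hypothesis close : forall q, sph_ball G p eps q -> forall y, inbox rho y ->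
  `|peval (fun a => nu * q a) y - (peval F y - b)| <= ep /\
  forall i, `|pder (fun a => nu * q a) i y - pder F i y| <= ep.
Variable del : R.
Hypotheses (del0 : 0 < del) (del8 : del <= 8^-1) (delK : crK R n * del <= 2^-1 ^+ n / 2).
Local Notation bad := (bad T0 T'0 Q L F pb b tau).
Local Notation agree := (agree T0 T'0 Q L).
Local Notation K := (Kset G eps p (cube Q)).
Local Notation wv := (@wv R n T T').

Let N0 : 0 < N%:R :> R. Proof. by rewrite ltr0n muln_gt0 T0. Qed.

Let incell v (w : 'rV[R]_n) := forall l, wv v ord0 l <= w ord0 l < wv v ord0 l + N%:R^-1.

Lemma del_coord u l : K u -> `|(del *: u) ord0 l| <= 8^-1.
Proof.
move=> [u1 _]; rewrite mxE normrM (gtr0_norm del0) -[leRHS]mulr1.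
by apply: ler_pM => //; [exact: ltW | exact: le_trans (coord_le_enorm u l) _].
Qed.

Lemma cell_exists u : K u -> exists2 v, valid v & incell v (del *: u).
Proof.
move=> Ku; pose t l := ((del *: u) ord0 l + 2^-1) * N%:R.
have hw l := del_coord l Ku.
have t0 l : 0 <= t l by rewrite mulr_ge0 ?(ltW N0) //; have := hw l; rewrite ler_norml; lra.
have t38 l : 3 * N%:R <= 8 * t l.
  by rewrite /t mulrA ler_pM2r //; have := hw l; rewrite ler_norml; lra.
have t58 l : 8 * t l <= 5 * N%:R.
  by rewrite /t mulrA ler_pM2r //; have := hw l; rewrite ler_norml; lra.
have tN l : (Num.truncn (t l) < N)%N.
  rewrite -(ltr_nat R); have /andP[a1 _] := truncn_itv (t0 l).
  apply: le_lt_trans a1 _; have := t58 l; move: N0; move: (N%:R) (t l) => *; lra.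
exists [ffun l => Ordinal (tN l)].
  apply/forallP => l; rewrite ffunE /=; have /andP[a1 a2] := truncn_itv (t0 l).
  rewrite -!(ler_nat R) ![(_ * N)%:R]natrM ![(8 * _)%:R]natrM; apply/andP; split.
    by apply: le_trans (t38 l) _; rewrite ler_pM2l // ltW.
  by apply: le_trans _ (t58 l); rewrite ler_pM2l.
move=> l; rewrite [X in X <= _ < X + _]mxE ffunE /=; have /andP[a1 a2] := truncn_itv (t0 l).
have e : (del *: u) ord0 l = t l / N%:R - 2^-1 by rewrite /t mulfK ?gt_eqF // addrK.
rewrite e lerD2r ler_pM2r ?invr_gt0 // a1 /= -addrAC ltrD2r.
by rewrite -[X in _ < _ + X]mul1r -mulrDl ltr_pM2r ?invr_gt0 // natr1.
Qed.

(** The Crofton inequality for the segment [del *: u] has the factor [del * enorm u], and membership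
    in [K] bounds the surface by the inverse of [enorm u]: the length of [u] cancels. Division by
    [nu] undoes the normalisation of the polynomial. *)
Lemma Zs_le u v : K u -> u != 0 -> valid v -> incell v (del *: u) ->
  #|[set z | [&& mid z, ~~ bad v z & ~~ agree v z]]%SET|%:R <= crK R n * del * N%:R ^+ n.
Proof.
move=> Ku u0 vv hw; set Zs : {set grid n N} := finset _.
have eu := enorm_gt0 u0.
have om0 : 0 < del * enorm u by rewrite mulr_gt0.
have crK0 : 0 < crK R n.
  by rewrite /crK divr_gt0 ?omega_gt0 // mulr_gt0 ?exprn_gt0 // mulr_gt0 // tubeK_gt0.
have Nn : 0 < N%:R ^+ n :> R by rewrite exprn_gt0.
pose t0 := #|Zs|%:R / N%:R ^+ n / (crK R n * (del * enorm u)).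
have t00 : 0 <= t0.
  apply: divr_ge0; first by apply: divr_ge0 => //; exact: ltW.
  by rewrite ltW // mulr_gt0.
have : t0 <= (enorm u)^-1.
  apply: (Kset_surf_le pdG D1 p1 eps0 t00 Ku u0) => q qb.
  have tq : 0 < tau / 2 / nu by rewrite !divr_gt0.
  have N0' : (0 < N)%N by rewrite muln_gt0 T0.
  have we : del *: u = (del * enorm u) *: ((enorm u)^-1 *: u).
    by rewrite scalerA -mulrA mulfV ?mulr1 // gt_eqF.
  have hcr : forall i (x : 'rV[R]_n), i \in Zs ->
     (forall l, gpt R Q i ord0 l <= x ord0 l < gpt R Q i ord0 l + N%:R^-1) ->
     exists s, [/\ -1 <= s <= 2, cube Q (x + s *: (del *: u)), peval q (x + s *: (del *: u)) = 0 &
                   tau / 2 / nu <= `|lform (fun i => pder q i (x + s *: (del *: u))) (del *: u)|].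
    move=> z x; rewrite finset.in_set => /and3P[mz nb na] hx.
    have [s [hs cs qs As]] := robust_cell n0 N4 N16 okL FE b0 pbE bF Lam1 cF tau0 hE h16 hN hN2 Qbox
      mz vv nb na ep1 ep2 (close qb) hx hw (fun l => del_coord l Ku).
    exists s; split => //.
      by move: qs; rewrite pevalZ => /eqP; rewrite mulf_eq0 gt_eqF //= => /eqP.
    rewrite ler_pdivrMr //; apply: le_trans As _.
    rewrite -[X in _ * X](gtr0_norm nu0) -normrM mulrC -[X in _ <= `|X|](_ : lform (fun i => nu * pder q i (x + s *: (del *: u))) (del *: u) = _).
      by under eq_fun do rewrite pderZ.
    by rewrite /lform mulr_sumr; apply: eq_bigr => i _; ring.
  have := crofton n0 om0 tq we (unit_dir u0) N0' hcr.
  case: (surf _ _ _) => [S| |].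
  - rewrite -EFinM !lee_fin => hS; rewrite /t0 ler_pdivrMr; last by rewrite mulr_gt0.
    by rewrite [leRHS]mulrC.
  - by rewrite leey.
  - by rewrite gt0_muleNy // lte_fin mulr_gt0.
have cd0 : 0 < crK R n * (del * enorm u) by rewrite mulr_gt0.
rewrite /t0 (ler_pdivrMr _ _ cd0).
have -> : (enorm u)^-1 * (crK R n * (del * enorm u)) = crK R n * del by field; rewrite gt_eqF.
by rewrite (ler_pdivrMr _ _ Nn).
Qed.

Lemma card_mid : (N%:R / 2) ^+ n <= #|[set z : grid n N | mid z]%SET|%:R :> R.
Proof.
have [c Nc] := dvdnP N4.
have fP (t : 'I_(2 * c)) : (c + t < N)%N by have [] := quarter_shift Nc (ltn_ord t).
pose f (y : grid n (2 * c)) : grid n N := [ffun l => Ordinal (fP (y l))].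
have finj : injective f.
  move=> y y' /ffunP e; apply/ffunP => l; apply: val_inj.
  by have /(congr1 val) := e l; rewrite !ffunE /= => /addnI.
have -> : N%:R / 2 = (2 * c)%:R :> R by rewrite Nc !natrM; field.
rewrite -natrX ler_nat -card_grid -cardsT -(card_imset _ finj).
apply: subset_leq_card; apply/fintype.subsetP => _ /imsetP[y _ ->]; rewrite inE.
by apply/forallP => l; rewrite ffunE /=; have [_ -> ->] := quarter_shift Nc (ltn_ord (y l)).
Qed.

(** Pairs made of a direction and a point are mapped injectively to pairs of endpoints, where the
    count for the coarse grid applies. *)
Lemma card_agree : (#|[set vz : grid n N * grid n N | agree vz.1 vz.2]%SET| <=
  #|agrL T L Q| * (T' ^ n * T' ^ n))%N.
Proof.
apply: leq_trans (card_fl_pair T'0 (agrL T L Q)).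
pose g (vz : grid n N * grid n N) := (vz.2, sh T0 T'0 vz.1 vz.2).
have ginj : injective g.
  by move=> [v z] [v' z'] [/= -> /shl_inj ->].
rewrite -(card_imset _ ginj); apply: subset_leq_card; apply/fintype.subsetP => _ /imsetP[vz + ->].
by rewrite finset.in_set => hvz; rewrite finset.in_set.
Qed.

Variables (r S : nat) (K2 : R).
Hypotheses (r0 : (0 < r)%N) (rS : (r <= S)%N) (SN : (S <= N)%N).
Hypothesis hagr : r%:R * #|agrL T L Q|%:R <= K2 * T%:R ^+ n * T%:R ^+ n.
Hypothesis hbad : #|[set vz : grid n N * grid n N | bad vz.1 vz.2]%SET|%:R * S%:R <= N%:R ^+ n * N%:R ^+ n :> R.

Let Zv : {set grid n N} := [set v | `[< exists u, [/\ K u, u != 0, valid v & incell v (del *: u)] >]]%SET.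

Let sum_fib (P : grid n N -> grid n N -> bool) :
  \sum_(v : grid n N) #|[set z | P v z]%SET|%:R = #|[set vz : grid n N * grid n N | P vz.1 vz.2]%SET|%:R :> R.
Proof.
rewrite -natr_sum; congr (_%:R); rewrite -[RHS]sum1_card.
under eq_bigr do rewrite -sum1_card.
rewrite (pair_big_dep xpredT (fun v z => z \in [set z | P v z]%SET) (fun _ _ => 1%N)) /=.
by apply: eq_bigl => vz; rewrite !inE.
Qed.

(** For a direction met by [del *: K], the choice of [del] lets [Zs_le] exclude at most half of the
    [(N / 2) ^ n] middle points; each of the others gives an agreeing or bad pair. There are at most
    [(K2 + 1) N ^ (2 n) / r] such pairs. *)
Lemma card_Zv : #|Zv|%:R * r%:R <= 2 ^+ n.+1 * (K2 + 1) * N%:R ^+ n :> R.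
Proof.
have Nn : 0 < N%:R ^+ n :> R by rewrite exprn_gt0.
have r0' : 0 < r%:R :> R by rewrite ltr0n.
have step v : v \in Zv -> 2^-1 ^+ n.+1 * N%:R ^+ n <=
   #|[set z | agree v z]%SET|%:R + #|[set z | bad v z]%SET|%:R :> R.
  rewrite finset.in_set => /asboolP[u [Ku u0 vv hw]].
  have h1 := Zs_le Ku u0 vv hw; have h2 := card_mid.
  set Zs : {set grid n N} := finset _ in h1.
  have h3 : (#|[set z : grid n N | mid z]%SET| <= #|[set z | agree v z]%SET| + #|[set z | bad v z]%SET| + #|Zs|)%N.
    apply: leq_trans (leq_trans (leq_card_setU _ _) (leq_add (leq_card_setU _ _) (leqnn _))).
    apply: subset_leq_card; apply/fintype.subsetP => z; rewrite !inE => ->.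
    by case: (agree v z); case: (bad v z).
  move: h3; rewrite -(ler_nat R) !natrD => h3.
  have h4 : crK R n * del * N%:R ^+ n <= 2^-1 ^+ n / 2 * N%:R ^+ n by rewrite ler_pM2r.
  move: h2; rewrite exprMn => h2.
  rewrite exprSr; move: h1 h2 h3 h4; set NN := N%:R ^+ n; set tt := 2^-1 ^+ n; set cd := _ * NN.
  by lra.
have tot : #|Zv|%:R * (2^-1 ^+ n.+1 * N%:R ^+ n) <=
    #|[set vz : grid n N * grid n N | agree vz.1 vz.2]%SET|%:R +
    #|[set vz : grid n N * grid n N | bad vz.1 vz.2]%SET|%:R :> R.
  rewrite -!sum_fib -big_split /=.
  apply: (@le_trans _ _ (\sum_(v in Zv) (2^-1 ^+ n.+1 * N%:R ^+ n))).
    by rewrite sumr_const -[leRHS]mulr_natl.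
  rewrite [leLHS]big_mkcond; apply: ler_sum => v _; case: ifP => [/step //|_].
  by rewrite addr_ge0.
have ag : r%:R * #|[set vz : grid n N * grid n N | agree vz.1 vz.2]%SET|%:R <= K2 * (N%:R ^+ n * N%:R ^+ n) :> R.
  apply: (@le_trans _ _ (r%:R * #|agrL T L Q|%:R * (T'%:R ^+ n * T'%:R ^+ n))).
    by rewrite -mulrA ler_wpM2l // -!natrX -!natrM ler_nat card_agree.
  have -> : K2 * (N%:R ^+ n * N%:R ^+ n) = K2 * T%:R ^+ n * T%:R ^+ n * (T'%:R ^+ n * T'%:R ^+ n).
    by rewrite natrM exprMn; ring.
  by rewrite ler_wpM2r // mulr_ge0 ?exprn_ge0.
have bd : r%:R * #|[set vz : grid n N * grid n N | bad vz.1 vz.2]%SET|%:R <= N%:R ^+ n * N%:R ^+ n :> R.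
  by apply: le_trans hbad; rewrite mulrC ler_wpM2l // ler_nat.
have := ler_wpM2l (ltW r0') tot; rewrite mulrDr => tot'.
have : #|Zv|%:R * r%:R * 2^-1 ^+ n.+1 * N%:R ^+ n <= (K2 + 1) * N%:R ^+ n * N%:R ^+ n.
  have -> : #|Zv|%:R * r%:R * 2^-1 ^+ n.+1 * N%:R ^+ n = r%:R * (#|Zv|%:R * (2^-1 ^+ n.+1 * N%:R ^+ n)) :> R.
    by rewrite [#|Zv|%:R * r%:R]mulrC -!mulrA.
  apply: le_trans tot' _; apply: le_trans (lerD ag bd) _.
  by rewrite -[leRHS]mulrA mulrDl mul1r.
rewrite ler_pM2r // exprVn ler_pdivrMr ?exprn_gt0 //.
by rewrite [X in _ <= X -> _]mulrC mulrA.
Qed.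

Lemma vol_Kset_le : (vol K <= (omega R n * (n%:R / 2) ^+ n * (2 ^+ n.+1 * (K2 + 1) + 1) * del^-1 ^+ n / r%:R)%:E)%E.
Proof.
have Nn : 0 < N%:R ^+ n :> R by rewrite exprn_gt0.
have r0' : 0 < r%:R :> R by rewrite ltr0n.
have [N2lt N2gt N2E] := half_of_four N4 N16.
have N2P (l : 'I_n) : (N./2 < N)%N by [].
(* The cell of the zero vector is added separately, since [Zv] records nonzero [u] only. *)
pose v0 : grid n N := [ffun l => Ordinal (N2P l)].
pose c (v : grid n N) : 'rV[R]_n := del^-1 *: wv v.
have hh : 0 < (N%:R * del)^-1 by rewrite invr_gt0 mulr_gt0.
apply: le_trans (@vol_le_boxes R n _ (v0 |: Zv) c (N%:R * del)^-1 K hh _) _.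
  move=> u Ku; have [u0|u0] := eqVneq u 0.
    exists v0; first by rewrite finset.in_setU1 eqxx.
    move=> l; rewrite u0 !mxE ffunE /=.
    have -> : (N./2)%:R / N%:R - 2^-1 = 0 :> R.
      have -> : N%:R = (N./2)%:R * 2 :> R.
        by rewrite {1}N2E natrM.
      have h2 : 0 < (N./2)%:R :> R by rewrite ltr0n.
      by field; rewrite gt_eqF.
    by rewrite mulr0 lexx add0r.
  have [v vv hv] := cell_exists Ku.
  exists v; first by rewrite finset.in_setU1 finset.in_set; apply/orP; right; apply/asboolP; exists u.
  move=> l; have := hv l; rewrite /c !mxE => /andP[a1 a2].
  rewrite invfM [_^-1 * del^-1]mulrC -mulrDr ler_pdivrMl // ltr_pdivlMl // a1.
  exact: a2.
rewrite lee_fin; set AA := 2 ^+ n.+1 * (K2 + 1) + 1.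
have -> : omega R n * (n%:R / 2) ^+ n * AA * del^-1 ^+ n / r%:R =
   omega R n * (n%:R / 2) ^+ n * (AA / r%:R * del^-1 ^+ n) :> R by ring.
rewrite invfM (exprMn n N%:R^-1) [N%:R^-1 ^+ n]exprVn.
apply: ler_wpM2l.
  by apply: mulr_ge0; [rewrite ltW // omega_gt0 | rewrite exprn_ge0 // divr_ge0].
rewrite mulrA; apply: ler_wpM2r; first by rewrite exprn_ge0 // invr_ge0 ltW.
have : #|(v0 |: Zv)%SET|%:R <= #|Zv|%:R + 1 :> R.
  rewrite natr1 ler_nat; apply: leq_trans (leq_card_setU _ _) _; by rewrite cards1.
move=> cc; rewrite ler_pdivrMr // mulrAC ler_pdivlMr //.
apply: le_trans (ler_wpM2r (ltW r0') cc) _; rewrite mulrDl mul1r mulrDl mul1r lerD ?card_Zv //.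
apply: (@le_trans _ _ N%:R); first by rewrite ler_nat (leq_trans rS).
by rewrite -natrX ler_nat -{1}[N]expn1 leq_pexp2l // muln_gt0 T0.
Qed.
End CubeVolume.

Lemma exists_le_avg (R : realFieldType) (J : nat) (c : 'I_J -> R) B : (0 < J)%N ->
  \sum_j c j <= J%:R * B -> exists j, c j <= B.
Proof.
move=> J0 hs; apply: contrapT => h.
have hc j : B < c j by rewrite ltNge; apply/negP => hj; apply: h; exists j.
have : \sum_(j < J) B < \sum_j c j.
  apply: ltr_sum; first by apply/hasP; exists (Ordinal J0); rewrite // mem_index_enum.
  by move=> j _; exact: hc.
by rewrite sumr_const card_ord -[X in X < _]mulr_natl ltNge hs.
Qed.

(** * Choice of the level and count of the exceptional pairs *)

Section Levels.
Variables (R : realType) (n k T T' : nat).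
Hypotheses (n0 : (0 < n)%N) (T0 : (0 < T)%N) (T'0 : (0 < T')%N).
Local Notation N := (T * T')%N.
Hypothesis N16 : (16 < N)%N.

(** Averaging over [J] candidate levels; the counts are summed over the cubes first, so that one
    level serves all of them. *)
Lemma exists_level (F : poly_k R n k) (QQ : seq (cube_index n)) rho Lam tau r0 (S I J : nat) :
  1 <= Lam -> c2on rho Lam (peval F) (pder F) -> 0 < tau -> 0 < r0 -> (0 < I)%N -> (0 < J)%N ->
  Lam / I%:R <= tau ->
  (forall Q, Q \in QQ -> forall y, cube Q y -> inbox rho y) ->
  (size QQ)%:R * (4 * tau / r0 + I%:R / J%:R) * (2 * S%:R) <= 1 ->
  exists2 b, 0 < b < r0 & forall Q, Q \in QQ ->
    #|[set vz : grid n N * grid n N | crit Q F b tau vz.1 vz.2]%SET|%:R * (2 * S%:R) <= N%:R ^+ n * N%:R ^+ n :> R.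
Proof.
move=> Lam1 cF tau0 r00 I0 J0 hI Qbox hS.
pose b (j : 'I_J) := r0 * j.+1%:R / J.+1%:R.
pose c j : R := \sum_(Q <- QQ) #|[set vz : grid n N * grid n N | crit Q F (b j) tau vz.1 vz.2]%SET|%:R.
have J0' : 0 < J%:R :> R by rewrite ltr0n.
pose X := 4 * tau / r0 + I%:R / J%:R.
have X0 : 0 <= X by rewrite addr_ge0 // divr_ge0 ?mulr_ge0 // ltW.
have N0 : 0 < N%:R :> R by rewrite ltr0n muln_gt0 T0.
have [|j hj] := @exists_le_avg R J c ((size QQ)%:R * X * (N%:R ^+ n * N%:R ^+ n)) J0.
  rewrite /c exchange_big /=.
  apply: (@le_trans _ _ (\sum_(Q <- QQ) J%:R * (X * (N%:R ^+ n * N%:R ^+ n)))); last first.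
    rewrite big_const_seq count_predT iter_addr_0 -[leLHS]mulr_natl.
    by rewrite le_eqVlt; apply/orP; left; apply/eqP; rewrite mulrCA -!mulrA.
  rewrite [leLHS]big_seq [leRHS]big_seq; apply: ler_sum => Q QQQ.
  have -> : \sum_(j < J) #|[set vz : grid n N * grid n N | crit Q F (b j) tau vz.1 vz.2]%SET|%:R =
     \sum_(vz : grid n N * grid n N) #|[set j : 'I_J | crit Q F (b j) tau vz.1 vz.2]%SET|%:R :> R.
    under eq_bigr => j _ do rewrite -sum1_card natr_sum big_mkcond.
    under [RHS]eq_bigr => j _ do rewrite -sum1_card natr_sum big_mkcond.
    rewrite exchange_big; apply: eq_bigr => vz _; apply: eq_bigr => j _.
    by rewrite !finset.in_set.
  apply: (@le_trans _ _ (\sum_(vz : grid n N * grid n N) J%:R * X)); last first.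
    by rewrite sumr_const card_prod !card_grid -[leLHS]mulr_natl !natrM !natrX mulrC mulrA natrM.
  apply: ler_sum => -[v z] _ /=.
  have JX : J%:R * X = 4 * tau * J%:R / r0 + I%:R.
    by rewrite /X; field; rewrite !gt_eqF.
  have [/andP[mz vv]|nmv] := boolP (mid z && valid v); last first.
    rewrite (_ : [set j | _]%SET = finset.set0) ?cards0 ?mulr_ge0 ?(ltW J0') //.
    by apply/setP => j; rewrite finset.in_set finset.in_set0 /crit andbA (negbTE nmv).
  rewrite JX; apply: le_trans (few_critical_levels n0 Lam1 cF tau0 r00 I0 J0 hI
     (z := gpt R Q z) (w' := @wv R n T T' v) _ _); last first.
  - by move=> l; apply: le_trans (wv_le R T0 T'0 N16 l vv) _; lra.
  - move=> s hs; apply: (Qbox Q QQQ); apply: (mid_cube T0 T'0 N16 mz) => l.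
      by rewrite lexx ltrDl invr_gt0.
    rewrite mxE normrM -[leRHS]mul1r ler_pM //; last exact: wv_le.
    by rewrite ger0_norm; lra.
  rewrite ler_nat; apply: subset_leq_card; apply/fintype.subsetP => j.
  by rewrite finset.in_set /crit => /and3P[_ _ hc]; rewrite finset.in_set.
exists (b j).
  have J1 : 0 < J.+1%:R :> R by rewrite ltr0n.
  rewrite /b divr_gt0 ?mulr_gt0 ?ltr0n //= ltr_pdivrMr // ltr_pM2l // ltr_nat ltnS.
  exact: ltn_ord.
move=> Q QQQ; apply: (@le_trans _ _ (c j * (2 * S%:R))).
  apply: ler_wpM2r; first by rewrite mulr_ge0.
  by rewrite /c (big_rem Q) //= lerDl; apply: sumr_ge0.
apply: le_trans (ler_wpM2r _ hj) _; first by rewrite mulr_ge0.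
by rewrite mulrAC; apply: ler_piMl.
Qed.

Let card_snd (P : pred (grid n N)) :
  #|[set vz : grid n N * grid n N | P vz.2]%SET| = (N ^ n * #|[set z | P z]%SET|)%N.
Proof.
rewrite (_ : [set vz : grid n N * grid n N | P vz.2]%SET = finset.setX [set: grid n N]%SET [set z | P z]%SET).
  by rewrite cardsX cardsT card_grid.
by apply/setP => -[v z]; rewrite !inE.
Qed.

Let card_shift (P : pred (grid n N)) :
  (#|[set vz : grid n N * grid n N | P (sh T0 T'0 vz.1 vz.2)]%SET| <= N ^ n * #|[set z | P z]%SET|)%N.
Proof.
rewrite -card_snd; pose g (vz : grid n N * grid n N) := (vz.1, sh T0 T'0 vz.1 vz.2).
have ginj : injective g by move=> [v z] [v' z'] [/= ->] /sh_inj ->.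
rewrite -(card_imset _ ginj); apply: subset_leq_card; apply/fintype.subsetP => _ /imsetP[vz + ->].
by rewrite !finset.in_set.
Qed.

(** With [d] the total degree of [L], [9 n d + 4 n] is the sum of [2 * (2 n d)] for sign changes at
    both ends, [n d] for zeros, and [2 n (2 d + 2)] for sign changes of [F - b]. These events and
    the critical pairs each receive half of the budget [1 / S]. *)
Lemma card_bad (Q : cube_index n) L (F pb : poly_k R n k) b tau (S : nat) :
  allProp (okpair T) L ->
  ((9 * n * (\sum_(kf <- L) kf.1) + 4 * n) * (2 * S) <= T)%N -> k = (2 * (\sum_(kf <- L) kf.1) + 2)%N ->
  #|[set vz : grid n N * grid n N | crit Q F b tau vz.1 vz.2]%SET|%:R * (2 * S%:R) <= N%:R ^+ n * N%:R ^+ n :> R ->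
  #|[set vz : grid n N * grid n N | bad T0 T'0 Q L F pb b tau vz.1 vz.2]%SET|%:R * S%:R <= N%:R ^+ n * N%:R ^+ n :> R.
Proof.
move=> okL hT kE hc.
set kL := (\sum_(kf <- L) kf.1)%N in hT kE.
pose c1 := #|[set z : grid n N | chg T'0 Q L z]%SET|.
pose c2 := #|[set z : grid n N | van T'0 Q L z]%SET|.
pose c3 := #|[set z : grid n N | chb T'0 Q pb z]%SET|.
have h1 : (c1 * T <= 2 * n * kL * N ^ n)%N := card_list_changes T0 T'0 Q okL.
have h2 : (c2 * T <= n * kL * N ^ n)%N := card_list_zeros T'0 Q okL.
have h3 : (c3 * T <= 2 * n * k * N ^ n)%N := card_sign_changes T0 T'0 Q (ispol_peval pb).
have h4 : ((2 * c1 + c2 + c3) * (2 * S) <= N ^ n)%N.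
  rewrite -(leq_pmul2r T0) mulnAC.
  apply: leq_trans (_ : (9 * n * kL + 4 * n) * N ^ n * (2 * S) <= _)%N.
    rewrite leq_mul2r; apply/orP; right; rewrite kE in h3.
    have := leq_add (leq_add (leq_mul (leqnn 2) h1) h2) h3.
    have -> : (2 * (c1 * T) + c2 * T + c3 * T = (2 * c1 + c2 + c3) * T)%N by ring.
    by have -> : (2 * (2 * n * kL * N ^ n) + n * kL * N ^ n + 2 * n * (2 * kL + 2) * N ^ n =
       (9 * n * kL + 4 * n) * N ^ n)%N by ring.
  by rewrite mulnAC [leqRHS]mulnC leq_mul2r hT orbT.
set c5 := #|[set vz : grid n N * grid n N | crit Q F b tau vz.1 vz.2]%SET| in hc.
have hb : (#|[set vz : grid n N * grid n N | bad T0 T'0 Q L F pb b tau vz.1 vz.2]%SET| <=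
    N ^ n * (2 * c1 + c2 + c3) + c5)%N.
  apply: leq_trans (_ : N ^ n * c1 + N ^ n * c1 + N ^ n * c2 + N ^ n * c3 + c5 <= _)%N; last first.
    by rewrite leq_eqVlt; apply/orP; left; apply/eqP; ring.
  rewrite -{1}(card_snd (chg T'0 Q L)) -(card_snd (van T'0 Q L)) -(card_snd (chb T'0 Q pb)).
  apply: leq_trans (leq_add (leq_add (leq_add (leq_add (leqnn _) (card_shift (chg T'0 Q L))) (leqnn _)) (leqnn _)) (leqnn _)).
  do 4 (apply: leq_trans (leq_add _ (leqnn _)); [|exact: leqnn]).
  apply: leq_trans (_ : #|([set vz : grid n N * grid n N | chg T'0 Q L vz.2]
     :|: [set vz : grid n N * grid n N | chg T'0 Q L (sh T0 T'0 vz.1 vz.2)]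
     :|: [set vz : grid n N * grid n N | van T'0 Q L vz.2]
     :|: [set vz : grid n N * grid n N | chb T'0 Q pb vz.2]
     :|: [set vz : grid n N * grid n N | crit Q F b tau vz.1 vz.2])%SET| <= _)%N.
    apply: subset_leq_card; apply/fintype.subsetP => vz; rewrite !finset.in_setU !finset.in_set /bad.
    by rewrite !orbA.
  do 4 (apply: leq_trans (leq_card_setU _ _) _; rewrite leq_add2r).
  exact: leqnn.
rewrite -(ler_nat R) natrD natrM in hb; rewrite -(ler_nat R) natrM in h4.
have S0 : 0 <= S%:R :> R by [].
have := ler_wpM2r S0 hb; move: h4 hc; rewrite natrX natrM.
set NN := N%:R ^+ n; set u := (2 * c1 + c2 + c3)%:R; set x := #|_|%:R; set y := c5%:R.
have NN0 : 0 <= NN by rewrite exprn_ge0.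
move=> a1 a2 a3; have := ler_wpM2l NN0 a1; move: a2 a3; move: (S%:R) => s a2 a3 a4.
by lra.
Qed.
End Levels.

Lemma card_mon_gt1 n k : (0 < n)%N -> (0 < k)%N -> (1 < #|{: mon n k}|)%N.
Proof.
move=> n0 k0; have k1 : (1 < k.+1)%N by rewrite ltnS.
pose z : {ffun 'I_n -> 'I_k.+1} := [ffun=> ord0].
have z0 : (\sum_(i < n) val (z i) <= k)%N by rewrite big1 // => i _; rewrite ffunE.
pose e : {ffun 'I_n -> 'I_k.+1} := [ffun i : 'I_n => if i == Ordinal n0 then Ordinal k1 else ord0].
have e0 : (\sum_(i < n) val (e i) <= k)%N.
  rewrite (bigD1 (Ordinal n0)) //= /e ffunE eqxx /= big1 ?addn0 // => i ni.
  by rewrite ffunE (negbTE ni).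
apply/card_gt1P; exists (exist (fun a : {ffun 'I_n -> 'I_k.+1} => (\sum_(i < n) val (a i) <= k)%N) z z0),
  (exist _ e e0); split => //.
apply/eqP => /(congr1 val) /= /ffunP /(_ (Ordinal n0)); rewrite !ffunE eqxx.
by move/(congr1 val).
Qed.

(** * Choice of the parameters *)

Section Small.
Variables (R : realType) (n : nat).

Lemma cubes_inbox (QQ : seq (cube_index n)) : exists2 rho : R, 0 <= rho &
  forall Q, Q \in QQ -> forall y, cube Q y -> inbox rho y.
Proof.
elim: QQ => [|Q QQ [rho rho0 IH]]; first by exists 0.
have [rho' rho'0 h] := cube_inbox R Q.
exists (rho + rho'); first by rewrite addr_ge0.
move=> Q' + y Qy l; rewrite inE => /orP[/eqP e|QQQ].
  by apply: le_trans (h y _ l) _; rewrite -?e // lerDr.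
by apply: le_trans (IH _ QQQ y Qy l) _; rewrite lerDl.
Qed.

Lemma c2on_le rho (L L' : R) f (g : 'I_n -> 'rV[R]_n -> R) : L <= L' -> c2on rho L f g -> c2on rho L' f g.
Proof.
move=> LL h x y d d0 ix iy dl; have [[h1 h2] h3 h4 h5] := h x y d d0 ix iy dl.
split; last by apply: le_trans h5 _; rewrite ler_wpM2r // exprn_ge0.
- by split; [exact: le_trans h1 _ | move=> i; exact: le_trans (h2 i) _].
- by apply: le_trans h3 _; rewrite ler_wpM2r.
- by move=> i; apply: le_trans (h4 i) _; rewrite ler_wpM2r.
Qed.

Lemma min_pos (s : seq R) : exists2 r0 : R, 0 < r0 & forall x, x \in s -> 0 < x -> r0 <= x.
Proof.
elim: s => [|x s [r0 r00 IH]]; first by exists 1.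
have [x0|x0] := leP x 0.
  exists r0 => // y; rewrite inE => /orP[/eqP -> /lt_le_trans/(_ x0)|]; [by rewrite ltxx | exact: IH].
exists (Num.min r0 x); first by rewrite lt_min r00.
move=> y; rewrite inE ge_min => /orP[/eqP ->|ys y0]; first by rewrite lexx orbT.
by rewrite IH.
Qed.

Lemma ispol_prod (L : seq (nat * ('rV[R]_n -> R))) T : allProp (okpair T) L ->
  ispol (\sum_(kf <- L) kf.1) (fun x => \prod_(kf <- L) kf.2 x).
Proof.
elim: L => [|[k f] L IH] /=.
  move=> _; rewrite big_nil; apply: eq_ispol (ispol_cst _ _ 1) => x; by rewrite big_nil.
move=> [[/= pf _] /IH pL]; rewrite big_cons.
by apply: eq_ispol (ispolM pf pL) => x; rewrite big_cons.
Qed.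

Lemma close_eps k (G : mon n k -> mon n k -> R) (pb : poly_k R n k) rho nu e0 : pos_def_gram G ->
  0 < nu -> 0 < e0 -> exists2 eps, 0 < eps &
  forall q, sph_ball G (fun a => nu^-1 * pb a) eps q -> forall y, inbox rho y ->
    `|peval (fun a => nu * q a) y - peval pb y| <= e0 /\
    forall i, `|pder (fun a => nu * q a) i y - pder pb i y| <= e0.
Proof.
move=> pdG nu0 e00; have [c c0 hc] := coef_le_gnorm pdG.
have [L L0 hL] := peval_c2 n k rho.
have den : 0 < L * (nu * c) + 1 by rewrite ltr_wpDl // mulr_ge0 // ltW // mulr_gt0.
exists (e0 / (L * (nu * c) + 1)); first by rewrite divr_gt0.
set eps := _ / _; have eps0 : 0 < eps by rewrite divr_gt0.
move=> q [_ qp] y iy; pose d : poly_k R n k := fun a => nu * q a - pb a.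
have hd a : `|d a| <= nu * (c * eps).
  have -> : d a = nu * (q a - nu^-1 * pb a) by rewrite /d; field; rewrite gt_eqF.
  rewrite normrM (gtr0_norm nu0); apply: ler_wpM2l; first exact: ltW.
  apply: le_trans (hc (fun a => q a - nu^-1 * pb a) a) _.
  by apply: ler_wpM2l; exact: ltW.
have t0 : 0 <= nu * (c * eps) by rewrite ltW // mulr_gt0 // mulr_gt0.
have [|[h1 h2] _ _ _] := hL d _ hd t0 y y 0 (lexx 0) iy iy; first by move=> l; rewrite subrr normr0.
have le0 : L * (nu * (c * eps)) <= e0.
  have -> : L * (nu * (c * eps)) = L * (nu * c) * eps by rewrite !mulrA.
  apply: (@le_trans _ _ ((L * (nu * c) + 1) * eps)).
    by apply: ler_wpM2r; [exact: ltW | rewrite lerDl].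
  by rewrite mulrC /eps mulfVK // gt_eqF.
split.
  have -> : peval (fun a => nu * q a) y - peval pb y = peval d y.
    by rewrite /peval -sumrB; apply: eq_bigr => a _; rewrite -mulrBl.
  exact: le_trans h1 _.
move=> i; have -> : pder (fun a => nu * q a) i y - pder pb i y = pder d i y.
  by rewrite /pder -sumrB; apply: eq_bigr => a _; rewrite -mulrBl.
exact: le_trans (h2 i) _.
Qed.
End Small.

Lemma grid_size (n S Km kL T' : nat) : (0 < n)%N -> (0 < S)%N -> (kL <= Km)%N -> (0 < T')%N ->
  let T := (4 * (2 * n * n * S * S + (9 * n * Km + 4 * n) * (2 * S) + 5))%N in
  [/\ (0 < T)%N, (4 %| T * T')%N, (16 < T * T')%N & (S <= T * T')%N] /\
  (2 * n * n * S * S <= T)%N /\ ((9 * n * kL + 4 * n) * (2 * S) <= T)%N.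
Proof.
move=> n0 S0 kK T'0 /=; set A := (2 * n * n * S * S)%N.
have hB : ((9 * n * kL + 4 * n) * (2 * S) <= (9 * n * Km + 4 * n) * (2 * S))%N.
  by rewrite leq_mul2r; apply/orP; right; rewrite leq_add2r leq_mul2l kK orbT.
have SA : (S <= A)%N by rewrite leq_pmull // !muln_gt0 n0 S0.
move: hB; set B := ((9 * n * kL + 4 * n) * (2 * S))%N; set C := ((9 * n * Km + 4 * n) * (2 * S))%N => hB.
have TT : (4 * (A + C + 5) <= 4 * (A + C + 5) * T')%N by rewrite leq_pmulr.
have [t1 t2 t3 t4] : [/\ 16 < 4 * (A + C + 5), A <= 4 * (A + C + 5), C <= 4 * (A + C + 5) & 0 < 4 * (A + C + 5)]%N.
  by move: (A) (C) => a c; split; lia.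
split; first split => //.
- by rewrite -mulnA dvdn_mulr.
- exact: leq_trans t1 TT.
- by apply: leq_trans SA _; exact: leq_trans TT.
by split; [|exact: leq_trans t3].
Qed.

Lemma crK_gt0 (R : realType) n : (0 < n)%N -> 0 < crK R n.
Proof. by move=> n0; rewrite /crK divr_gt0 ?omega_gt0 // mulr_gt0 ?exprn_gt0 // mulr_gt0 // tubeK_gt0. Qed.

Lemma finite_visibility (R : realType) (n : nat) : (0 < n)%N -> exists C K : R, [/\ 0 < C, 0 < K &
  forall (G : forall k, mon n k -> mon n k -> R), (forall k, pos_def_gram (G k)) ->
  forall (QQ : seq (cube_index n)) (r : cube_index n -> nat), uniq QQ ->
  (forall Q, Q \in QQ -> 0 < r Q)%N -> (0 < \sum_(Q <- QQ) r Q)%N ->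
  exists (k : nat) (p : poly_k R n k) (eps : R), [/\ psphere (G k) p, 0 < eps,
    k%:R <= C * (\sum_(Q <- QQ) r Q)%:R `^ (n%:R)^-1 &
    forall Q, Q \in QQ -> (vol (Kset (G k) eps p (@cube R n Q)) <= (K / (r Q)%:R)%:E)%E]].
Proof.
move=> n0; have [C1 [K2 [C10 K20 hvis]]] := visible_list R n0.
have crK0 := crK_gt0 R n0.
have n0' : 0 < n%:R :> R by rewrite ltr0n.
pose del := Num.min 8^-1 (2^-1 ^+ n / 2 / crK R n).
have h2n : 0 < (2^-1 : R) ^+ n by rewrite exprn_gt0 // invr_gt0.
have del0 : 0 < del.
  by rewrite lt_min invr_gt0 ltr0n /=; apply: divr_gt0 => //; exact: divr_gt0.
have del8 : del <= 8^-1 by rewrite ge_min lexx.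
have delK : crK R n * del <= 2^-1 ^+ n / 2.
  by rewrite mulrC -ler_pdivlMr // ge_min lexx orbT.
pose K := omega R n * (n%:R / 2) ^+ n * (2 ^+ n.+1 * (K2 + 1) + 1) * del^-1 ^+ n.
have K0 : 0 < K.
  rewrite !mulr_gt0 ?omega_gt0 ?exprn_gt0 ?invr_gt0 // ?divr_gt0 //.
  by rewrite ltr_wpDl // mulr_ge0 ?exprn_ge0 // addr_ge0 // ltW.
exists (2 * C1 + 2), K; split => //; first by rewrite addr_gt0 // mulr_gt0.
move=> G pdG QQ r uQ r0 S0; set S := (\sum_(Q <- QQ) r Q)%N in S0 *.
have S1 : 1 <= S%:R `^ (n%:R)^-1 :> R.
  apply: (@le_trans _ _ (1 `^ (n%:R)^-1)); first by rewrite powR1.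
  by rewrite ge0_ler_powR ?nnegrE ?invr_ge0 ?ler1n.
(* The grid must be large compared with the degree of [L], but [L] is built on the grid; an a priori
   bound of the degree breaks the circle. *)
pose Km := Num.truncn (C1 * S%:R `^ (n%:R)^-1).
pose T := (4 * (2 * n * n * S * S + (9 * n * Km + 4 * n) * (2 * S) + 5))%N.
have [_ [TS _]] := @grid_size n S Km 0 1 n0 S0 (leq0n _) (ltnSn 0).
have [L [okL degL agrLe]] := hvis QQ r T uQ r0 TS.
set kL := (\sum_(kf <- L) kf.1)%N in degL.
have kLK : (kL <= Km)%N.
  by rewrite /Km truncn_ge_nat // mulr_ge0 ?(ltW C10) ?powR_ge0.
pose k := (2 * kL + 2)%N.
have [F FE] : ispol k (fun x : 'rV[R]_n => (\prod_(kf <- L) kf.2 x) ^+ 2).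
  apply: (@ispol_le _ _ (kL + kL)); first by rewrite /k mul2n addnn leq_addr.
  have pP := ispol_prod okL; apply: eq_ispol (ispolM pP pP) => x.
  by rewrite expr2.
have {}FE x : peval F x = (\prod_(kf <- L) kf.2 x) ^+ 2 by rewrite -FE.
have [rho rho0 Qbox] := cubes_inbox R QQ.
have [L1 L10 cF1] := peval_c2' F rho.
pose Lam := L1 + 1.
have Lam1 : 1 <= Lam by rewrite lerDr.
have Lam0 : 0 < Lam by apply: lt_le_trans Lam1.
have cF : c2on rho Lam (peval F) (pder F) by apply: c2on_le cF1; rewrite lerDl.
(* Any level below [r1] is smaller than all nonzero values of [F] on the coarse grid. *)
have [r1 r10 hr1] := min_pos [seq peval F (gpt R Q x) | Q <- QQ, x <- enum {: grid n T}].
have hF Q (x : grid n T) : Q \in QQ -> peval F (gpt R Q x) != 0 -> r1 <= peval F (gpt R Q x).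
  move=> QQQ F0; apply: hr1; first by apply/allpairsP; exists (Q, x); rewrite mem_enum.
  by rewrite lt0r F0 FE sqr_ge0.
have [Q0 Q0Q] : exists Q, Q \in QQ.
  move: S0; rewrite /S; case: (QQ) => [|Q s]; first by rewrite big_nil.
  by exists Q; rewrite inE eqxx.
pose qn := size QQ.
have qnn : (0 < qn)%N by rewrite /qn; move: Q0Q; case: (QQ).
have qn0 : 0 < qn%:R :> R by rewrite ltr0n.
have S0' : 0 < S%:R :> R by rewrite ltr0n.
(* The two terms in the hypothesis of [exists_level] may contribute 1/2 each: [tau] is chosen for
   [4 tau / r1], and [J] for [I / J]. *)
pose tau := Num.min 1 (r1 / (16 * qn%:R * S%:R)).
have den0 : 0 < 16 * qn%:R * S%:R :> R by rewrite mulr_gt0 // mulr_gt0.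
have tau0 : 0 < tau by rewrite lt_min ltr01 divr_gt0.
have tau1 : tau <= 1 by rewrite ge_min lexx.
have tauS : tau * (16 * qn%:R * S%:R) <= r1 by rewrite -ler_pdivlMr // ge_min lexx orbT.
pose I := (Num.truncn (Lam / tau)).+1.
have I0 : 0 < I%:R :> R by rewrite ltr0n.
have hI : Lam / I%:R <= tau.
  rewrite ler_pdivrMr // mulrC -ler_pdivrMr //; apply/ltW/truncnS_gt.
pose J := (4 * qn * S * I)%N.
have J0 : (0 < J)%N by rewrite !muln_gt0 qnn S0.
pose h := tau / (16 * n%:R * Lam).
have dh0 : 0 < 16 * n%:R * Lam by rewrite mulr_gt0 // mulr_gt0.
have h0 : 0 < h by rewrite divr_gt0.
have h16 : h <= 16^-1.
  rewrite /h ler_pdivrMr // !mulrA mulVf // mul1r; apply: le_trans tau1 _.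
  by rewrite -[leLHS]mulr1; apply: ler_pM => //; rewrite ler1n.
have nL0 : 0 < 3 * n%:R * Lam by rewrite mulr_gt0 // mulr_gt0.
pose c0 := Num.min (h / 2) (tau * h / 8 / (3 * n%:R * Lam)).
have th0 : 0 < tau * h / 8 by rewrite divr_gt0 // mulr_gt0.
have c00 : 0 < c0 by rewrite lt_min; apply/andP; split; apply: divr_gt0.
pose T' := (Num.truncn c0^-1).+1.
have T'0 : (0 < T')%N by [].
have [[T0 N4 N16 SN] [_ hT]] := @grid_size n S Km kL T' n0 S0 kLK T'0.
rewrite -/T in T0 N4 N16 SN hT.
have N0 : 0 < (T * T')%:R :> R by rewrite ltr0n muln_gt0 T0.
have Nc0 : (T * T')%:R^-1 <= c0.
  rewrite -[leRHS]invrK lef_pV2 ?posrE ?invr_gt0 //.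
  apply: (@le_trans _ _ T'%:R); first exact/ltW/truncnS_gt.
  by rewrite ler_nat leq_pmull.
have hN : (T * T')%:R^-1 <= h / 2 by apply: le_trans Nc0 _; rewrite ge_min lexx.
have hN2 : 3 * n%:R * Lam * (T * T')%:R^-1 <= tau * h / 8.
  by rewrite mulrC -ler_pdivlMr //; apply: le_trans Nc0 _; rewrite ge_min lexx orbT.
have [|b /andP[b0 br1] hcrit] := @exists_level R n k T T' n0 T0 T'0 N16 F QQ rho Lam tau r1 S I J
   Lam1 cF tau0 r10 (ltn0Sn _) J0 hI Qbox.
  have e1 : I%:R / J%:R = (4 * qn%:R * S%:R)^-1 :> R.
    by rewrite /J !natrM; field; rewrite !gt_eqF.
  rewrite -/qn e1.
  have -> : qn%:R * (4 * tau / r1 + (4 * qn%:R * S%:R)^-1) * (2 * S%:R) =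
     tau * (16 * qn%:R * S%:R) / r1 / 2 + 2^-1 :> R by field; rewrite !gt_eqF.
  have : tau * (16 * qn%:R * S%:R) / r1 <= 1 by rewrite ler_pdivrMr // mul1r.
  by move: (_ / r1) => u; lra.
have [pb pbE'] : ispol k (fun x : 'rV[R]_n => peval F x + (- b)).
  by apply: ispolD (ispol_peval F) (ispol_cst _ _ _).
have pbE x : peval pb x = peval F x - b by rewrite -pbE'.
have bF Q : Q \in QQ -> forall x : grid n T, peval F (gpt R Q x) != 0 -> b < peval F (gpt R Q x).
  by move=> QQQ x F0; apply: lt_le_trans br1 (hF Q x QQQ F0).
pose nu := gnorm (G k) pb.
(* Otherwise [F] would be the constant [b], whereas its nonzero values on the grid exceed [b]. *)
have nu0 : 0 < nu.
  rewrite /nu /Defs.gnorm sqrtr_gt0; apply: (pdG k).2; apply: contrapT => hpb.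
  have pb0 x : peval pb x = 0.
    apply: big1 => a _; have -> : pb a = 0; last by rewrite mul0r.
    by apply: contrapT => /eqP ha; apply: hpb; exists a.
  pose x0 : grid n T := [ffun=> Ordinal T0].
  have e : peval F (gpt R Q0 x0) = b by apply/eqP; rewrite -subr_eq0 -pbE pb0.
  by have := bF Q0 Q0Q x0; rewrite e gt_eqF // ltxx => /(_ isT).
pose e0 := Num.min (tau * h / 8) (tau / 8 / n%:R).
have e00 : 0 < e0 by rewrite lt_min th0 /=; apply: divr_gt0 => //; exact: divr_gt0.
have ep1 : e0 <= tau * h / 8 by rewrite ge_min lexx.
have ep2 : n%:R * e0 <= tau / 8 by rewrite mulrC -ler_pdivlMr // ge_min lexx orbT.
have [eps eps0 hclose] := @close_eps R n k (G k) pb rho nu e0 (pdG k) nu0 e00.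
pose p : poly_k R n k := fun a => nu^-1 * pb a.
have p1 : psphere (G k) p.
  by rewrite /psphere /= gnormZ gtr0_norm ?invr_gt0 // mulVf // gt_eqF.
have D1 : (1 < #|{: mon n k}|)%N by apply: card_mon_gt1 => //; rewrite /k addn_gt0 orbT.
exists k, p, eps; split => //.
  rewrite /k natrD natrM; apply: (@le_trans _ _ (2 * (C1 * S%:R `^ (n%:R)^-1) + 2 * S%:R `^ (n%:R)^-1)).
    by apply: lerD; [rewrite ler_pM2l | rewrite -[leLHS]mulr1 ler_pM2l].
  by rewrite mulrA -mulrDl.
move=> Q QQQ.
have rS : (r Q <= S)%N by rewrite /S (big_rem Q) //= leq_addr.
have hbad := @card_bad R n k T T' T0 T'0 Q L F pb b tau S okL hT erefl (hcrit Q QQQ).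
have close : forall q, sph_ball (G k) p eps q -> forall y, inbox rho y ->
  `|peval (fun a => nu * q a) y - (peval F y - b)| <= e0 /\
  forall i, `|pder (fun a => nu * q a) i y - pder F i y| <= e0.
  move=> q qb y iy; have [h1 h2] := hclose q qb y iy; rewrite -pbE; split => // i.
  by rewrite -(@pder_subcst R n k F pb b pbE).
exact: (vol_Kset_le n0 N4 N16 okL FE b0 pbE (bF Q QQQ) Lam1 cF tau0 erefl h16 hN hN2 (Qbox Q QQQ)
  (pdG k) D1 p1 eps0 nu0 ep1 ep2 close del0 del8 delK (r0 Q QQQ) rS SN (agrLe Q QQQ) hbad).
Qed.

(** * From volumes to visibility *)

Section Visibility.
Variables (R : realType) (n : nat).
Hypothesis n0 : (0 < n)%N.
Local Notation x := ((n%:R : R)^-1).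

Let x0 : 0 <= x. Proof. by rewrite invr_ge0. Qed.

Lemma vis_ge k (G : mon n k -> mon n k -> R) eps p Qc V : 0 < V ->
  (vol (Kset G eps p Qc) <= V%:E)%E -> (((V `^ x)^-1)%:E <= vis G eps p Qc)%E.
Proof.
move=> V0 hV; rewrite /vis; case: eqP => [_|v0]; first by rewrite leey.
have := @haus_ge0 R _ _ (@eucl_dist_ge0 R n) n (Kset G eps p Qc); rewrite -/(vol _).
move: v0 hV; case: (vol _) => [a| |] // v0; rewrite !lee_fin => aV a0.
have a1 : 0 < a by rewrite lt0r a0 andbT; apply/eqP => e; apply: v0; rewrite e.
rewrite powRN lef_pV2 ?posrE ?powR_gt0 //.
by rewrite ge0_ler_powR ?nnegrE // ltW.
Qed.

Lemma root_pow (a : R) : 0 <= a -> (a ^+ n) `^ x = a.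
Proof.
move=> a0; rewrite -powR_mulrn // -powRrM mulfV ?powRr1 //.
by rewrite pnatr_eq0 -lt0n.
Qed.

Definition ballV : R := omega R n * (n%:R / 2) ^+ n * 4 ^+ n.

Lemma ballV_gt0 : 0 < ballV.
Proof. by rewrite !mulr_gt0 ?omega_gt0 ?exprn_gt0 ?divr_gt0 ?ltr0n. Qed.

Lemma vol_Kset_ball k (G : mon n k -> mon n k -> R) eps p Qc :
  (vol (Kset G eps p Qc) <= ballV%:E)%E.
Proof.
apply: le_trans (@vol_le_boxes R n unit [set tt]%SET (fun=> \row_l (-2)) 4 _ _ _) _ => //.
  move=> u [u1 _]; exists tt; first by rewrite finset.in_set1.
  move=> l; rewrite !mxE; have := le_trans (coord_le_enorm u l) u1.
  by rewrite ler_norml; lra.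
by rewrite cards1 mul1r /ballV.
Qed.

Variable M : cube_index n -> R.
Hypothesis M0 : forall Q, 0 <= M Q.
Local Notation es := (\esum_(Q in [set: cube_index n]) ((M Q) ^+ n)%:E)%E.

Lemma sum_le_esum (s : seq (cube_index n)) : uniq s -> (es < +oo)%E ->
  \sum_(Q <- s) M Q ^+ n <= fine es.
Proof.
move=> us hfin; have e0 : (0 <= es)%E by apply: esum_ge0 => Q _; rewrite lee_fin exprn_ge0.
rewrite -lee_fin fineK ?ge0_fin_numE //; apply: esum_ge; exists [set` s].
  by split=> //; exact: finite_seq.
by rewrite -fsbig_seq // sumEFin.
Qed.

(** Each cube with [M Q >= 1] contributes at least 1 to a finite sum. *)
Lemma large_cubes : (es < +oo)%E -> exists2 QQ : seq (cube_index n), uniq QQ &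
  forall Q, (Q \in QQ) = (1 <= M Q).
Proof.
move=> hfin; pose A := [set Q | 1 <= M Q].
have /finite_seqP[s sE] : finite_set A.
  apply: contrapT => hinf.
  have [B BA hB] := infinite_set_fset (Num.truncn (fine es)).+1 hinf.
  have h1 := sum_le_esum (finmap.fset_uniq B) hfin.
  have h2 : (Num.truncn (fine es)).+1%:R <= \sum_(Q <- finmap.enum_fset B) 1 :> R.
    by rewrite big_const_seq count_predT iter_addr_0 ler_nat.
  have h3 : \sum_(Q <- finmap.enum_fset B) 1 <= \sum_(Q <- finmap.enum_fset B) M Q ^+ n.
    by rewrite [leLHS]big_seq [leRHS]big_seq; apply: ler_sum => Q QB; rewrite exprn_ege1 //; exact: BA.
  by have := lt_le_trans (truncnS_gt (fine es)) (le_trans h2 (le_trans h3 h1)); rewrite ltxx.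
exists (undup s); first exact: undup_uniq.
move=> Q; rewrite mem_undup; apply/idP/idP => hQ.
  by have : A Q by rewrite sE.
by have : A Q by []; rewrite sE.
Qed.
End Visibility.

Theorem theorem4p1 (R : realType) (n : nat) (n_gt0 : (0 < n)%N) :
  exists C c : R, 0 < C /\ 0 < c /\
  forall G : forall k : nat, mon n k -> mon n k -> R,
  (forall k, pos_def_gram (G k)) ->
  forall M : cube_index n -> R,
  (forall Q, 0 <= M Q) ->
  (\esum_(Q in [set: cube_index n]) ((M Q) ^+ n)%:E < +oo)%E ->
  exists (k : nat) (p : poly_k R n k) (eps : R),
    [/\ psphere (G k) p, 0 < eps,
        k%:R <= C * (fine (\esum_(Q in [set: cube_index n]) ((M Q) ^+ n)%:E))
                      `^ (n%:R)^-1 &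
        forall Q : cube_index n,
          ((c * M Q)%:E <= vis (G k) eps p (@cube R n Q))%E].
Proof.
have [C [K [C0 K0 hfv]]] := finite_visibility R n_gt0.
have V0 : 0 < @ballV R n := ballV_gt0 R n_gt0.
set x : R := (n%:R)^-1.
have x0 : 0 <= x by rewrite invr_ge0.
pose c := Num.min ((@ballV R n `^ x)^-1) ((K `^ x)^-1).
have c0 : 0 < c by rewrite lt_min !invr_gt0 !powR_gt0.
exists (2 * C), c; split; [by rewrite mulr_gt0 | split => //].
move=> G pdG M M0 hfin.
set s := fine _.
have [QQ uQ hQ] := large_cubes M0 hfin.
have small k (p : poly_k R n k) eps Q : Q \notin QQ ->
    ((c * M Q)%:E <= vis (G k) eps p (@cube R n Q))%E.
  rewrite hQ -ltNge => /ltW MQ.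
  apply: (@le_trans _ _ ((@ballV R n `^ x)^-1)%:E); last first.
    by apply: vis_ge => //; exact: vol_Kset_ball.
  rewrite lee_fin; apply: (@le_trans _ _ c); first by rewrite ler_piMr // ltW.
  by rewrite ge_min lexx.
(* On the large cubes [M Q ^+ n < r Q <= 2 * M Q ^+ n]; the upper bound is the source of the factor
   2 in [2 * C]. *)
pose r Q := (Num.truncn (M Q ^+ n)).+1.
(* Without large cubes the sum may vanish, which forces degree 0: a normalised constant is taken. *)
have [S0|S0] := posnP (\sum_(Q <- QQ) r Q)%N.
  have QQ0 Q : Q \notin QQ.
    by apply/negP => QQQ; move: S0; rewrite (big_rem Q).
  pose pb : poly_k R n 0 := fun=> 1.
  have nu0 : 0 < gnorm (G 0%N) pb.
    rewrite /Defs.gnorm sqrtr_gt0; apply: (pdG 0%N).2.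
    have z0 : (\sum_(i < n) val (([ffun=> ord0] : {ffun 'I_n -> 'I_1}) i) <= 0)%N.
      by rewrite big1 // => i _; rewrite ffunE.
    by exists (exist (fun a : {ffun 'I_n -> 'I_1} => (\sum_(i < n) val (a i) <= 0)%N) _ z0); exact: oner_neq0.
  exists 0%N, (fun a => (gnorm (G 0%N) pb)^-1 * pb a), 1; split => //.
  - by rewrite /psphere /= gnormZ gtr0_norm ?invr_gt0 // mulVf // gt_eqF.
  - by rewrite mulr_ge0 ?powR_ge0 // mulr_ge0 // ltW.
  - by move=> Q; exact: small.
have [k [p [eps [p1 eps0 hk hvol]]]] := hfv G pdG QQ r uQ (fun _ _ => ltn0Sn _) S0.
exists k, p, eps; split => //.
  have Ss : (\sum_(Q <- QQ) r Q)%:R <= 2 * s.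
    apply: (@le_trans _ _ (2 * \sum_(Q <- QQ) M Q ^+ n)); last first.
      by rewrite ler_pM2l //; exact: sum_le_esum.
    rewrite natr_sum mulr_sumr [leLHS]big_seq [leRHS]big_seq; apply: ler_sum => Q; rewrite hQ => MQ.
    have M1 : 1 <= M Q ^+ n by rewrite exprn_ege1.
    have /andP[t1 _] := truncn_itv (le_trans ler01 M1).
    by rewrite /r -natr1; lra.
  have s0 : 0 <= s by have : 0 <= 2 * s := le_trans (ler0n _ _) Ss; lra.
  apply: le_trans hk _; rewrite -/x.
  apply: (@le_trans _ _ (C * (2 `^ x * s `^ x))).
    rewrite ler_pM2l // -powRM // ge0_ler_powR ?nnegrE //; lra.
  rewrite mulrA [2 * C]mulrC ler_wpM2r ?powR_ge0 // ler_pM2l //.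
  apply: (@le_trans _ _ (2 `^ 1)); last by rewrite powRr1.
  by rewrite ler_powR ?ler1n // invf_le1 ?ltr0n // ler1n.
move=> Q; have [QQQ|] := boolP (Q \in QQ); last exact: small.
have MQ : 1 <= M Q by rewrite -hQ.
have MQ0 : 0 < M Q by apply: lt_le_trans MQ.
have r0 : 0 < (r Q)%:R :> R by rewrite ltr0n.
apply: (@le_trans _ _ ((K / (r Q)%:R) `^ x)^-1%:E); last first.
  by apply: vis_ge; [rewrite divr_gt0 | exact: hvol].
rewrite lee_fin -/x; apply: (@le_trans _ _ ((K `^ x)^-1 * M Q)).
  by rewrite ler_pM2r // ge_min lexx orbT.
rewrite -[X in _ * X]invrK -invfM lef_pV2 ?posrE ?powR_gt0 ?divr_gt0 ?mulr_gt0 ?powR_gt0 ?invr_gt0 //.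
rewrite -[X in _ <= _ * X](root_pow n_gt0) ?invr_ge0 ?(ltW MQ0) // -powRM ?exprn_ge0 ?invr_ge0 ?(ltW K0) ?(ltW MQ0) //.
rewrite ge0_ler_powR ?nnegrE ?mulr_ge0 ?exprn_ge0 ?invr_ge0 ?(ltW K0) ?(ltW MQ0) ?(ltW r0) //.
rewrite ler_pM2l // exprVn lef_pV2 ?posrE ?exprn_gt0 //.
exact/ltW/truncnS_gt.
Qed.
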